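(* Suppose the cost function satisfies $c\in\mathcal C^k(\mathcal X)$ for some integer $k\ge\frac d2+1$ and $\sigma_\varepsilon^2:=\sum_{j=1}^m\mathrm{Var}_{X_j\sim\nu_j}(f_j^*(X_j))>0$. Then, as $N\to\infty$, $$\sup_{t\in\mathbb R}\Big|\mathbb P^B\Big(\sqrt N\big(S_\varepsilon(\hat\nu^B_1,\dots,\hat\nu^B_m)-S_\varepsilon(\hat\nu^N_1,\dots,\hat\nu^N_m)\big)\le t\Big)-\mathbb P\Big(\sqrt N\big(S_\varepsilon(\hat\nu^N_1,\dots,\hat\nu^N_m)-S_\varepsilon(\nu_1,\dots,\nu_m)\big)\le t\Big)\Big|\xrightarrow{\mathbb P}0.$$
   Context: Fix integers $m\ge 2$, $d\ge 1$ and $\varepsilon>0$; $[m]:=\{1,\dots,m\}$. For $j\in[m]$, $\mathcal X_j\subset[-1,1]^d$ is compact and equal to the closure of its (non-empty) interior, $\nu_j$ is a Borel probability measure on $\mathcal X_j$, and $\mathcal X=\prod_j\mathcal X_j$. $\mathcal C^k(\mathcal X)$ is the space of functions with continuous derivatives of order $\le k$ on the interior, extending continuously to $\mathcal X$. $\Pi(\mu_1,\dots,\mu_m)$ is the set of couplings of $\mu_1,\dots,\mu_m$, $\mathrm{KL}$ is relative entropy, and $$S_\varepsilon(\mu_1,\dots,\mu_m)=\inf_{\pi\in\Pi(\mu_1,\dots,\mu_m)}\int_{\mathcal X}c\,d\pi+\varepsilon\,\mathrm{KL}(\pi\|\otimes_{k=1}^m\mu_k).$$ The optimal dual potentials $(f_1^*,\dots,f_m^*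 )\in\prod_jL^\infty(\nu_j)$ are the unique maximizer, under the normalization $\int f_k^*d\nu_k=0$ for $k\in[m-1]$, of $\sum_j\int f_jd\nu_j-\varepsilon\int\exp\big((\sum_jf_j-c)/\varepsilon\big)d(\otimes_k\nu_k)$. Sampling model: for each $j$, $X^{(j)}_1,\dots,X^{(j)}_N$ are i.i.d. from $\nu_j$, the $m$ samples are independent, and $\hat\nu_j^N=\frac1N\sum_k\delta_{X_k^{(j)}}$. Bootstrap: given the data, for each $j$, $X_1^{(j),B},\dots,X_N^{(j),B}$ is an independent (i.i.d.) sample from $\hat\nu_j^N$ (independent over $j$), and $\hat\nu_j^B=\frac1N\sum_{k=1}^N\delta_{X_k^{(j),B}}$. $\mathbb P^B$ is the conditional probability given the data, and $\xrightarrow{\mathbb P}$ is convergence in probability. *)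

(* Defs.v *)
From HB Require Import structures.
From mathcomp Require Import all_boot all_order all_algebra.
From mathcomp Require Import all_classical all_reals all_analysis measurable_realfun.

Set Implicit Arguments.
Unset Strict Implicit.
Unset Printing Implicit Defensive.

Import Order.TTheory GRing.Theory Num.Theory.
Import numFieldNormedType.Exports.

Local Open Scope classical_set_scope.
Local Open Scope charge_scope.
Local Open Scope ring_scope.

(* R^d with its Borel sigma-algebra.  The carrier is convertible to 'rV[R]_d,
   so that topological notions apply to it through a type annotation. *)
Notation borelV R d := (g_sigma_algebraType (@open 'rV[R]_d)).

(* The library only makes \x a (sub)probability for pairs of subprobabilities. *)
Section ProductMeasure.
Context {d1 d2 : measure_display} {T1 : measurableType d1}
  {T2 : measurableType d2} {R : realType}.
Variables (P : probability T1 R) (Q : probability T2 R).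

Definition prod_prob : set (T1 * T2) -> \bar R := (P \x Q)%E.

HB.instance Definition _ := Measure.on prod_prob.

Let prod_prob_setT : prod_prob setT = 1%E.
Proof.
rewrite /prod_prob -setXTT.
transitivity (P setT * Q setT)%E; first exact: product_measure1E.
by rewrite !probability_setT mule1.
Qed.

HB.instance Definition _ :=
  Measure_isProbability.Build _ _ _ prod_prob prod_prob_setT.

End ProductMeasure.

Section TensorMeasure.
Context {disp : measure_display} {T : measurableType disp} {R : realType}.

Definition tcons (n : nat) (p : T * n.-tuple T) : n.+1.-tuple T :=
  [tuple of p.1 :: p.2].

Lemma measurable_tcons (n : nat) : measurable_fun setT (@tcons n).
Proof. exact: (measurable_cons measurable_fst measurable_snd). Qed.

HB.instance Definition _ (n : nat) :=
  isMeasurableFun.Build _ _ _ _ (@tcons n) (@measurable_tcons n).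

Fixpoint tensor (n : nat) : ('I_n -> probability T R) ->
    probability (n.-tuple T) R :=
  match n with
  | 0 => fun _ => \d_([tuple] : 0.-tuple T)
  | n'.+1 => fun mu =>
      distribution (prod_prob (mu ord0) (tensor (fun i => mu (lift ord0 i))))
        (@tcons n')
  end.

Lemma tensor_box (n : nat) (mu : 'I_n -> probability T R) (A : 'I_n -> set T) :
  (forall i, measurable (A i)) ->
  tensor mu [set x | forall i, A i (tnth x i)] = (\prod_(i < n) mu i (A i))%E.
Proof.
elim: n mu A => [|n IH] mu A mA.
  rewrite big_ord0 /= diracE mem_set//= => -[].
by [].
rewrite big_ord_recl -IH//= /distribution /pushforward /=.
rewrite -[RHS]product_measure1E//; last first.
  rewrite (_ : [set x | _] =
      \bigcap_(i : 'I_n) ((fun x => tnth x i) @^-1` A (lift ord0 i))).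
    apply: fin_bigcap_measurable => // i _.
    by rewrite -[X in measurable X]setTI; exact: measurable_tnth.
  by apply/seteqP; split => [x /= h i _|x h i]; exact: h.
congr (prod_prob _ _ _); apply/seteqP; split => -[a x] /=.
  move=> h; split => /= [|i]; first by have := h ord0.
  by have := h (lift ord0 i); rewrite tnthS.
move=> [/= h0 h] i; case: (unliftP ord0 i) => [j|] ->//.
by rewrite tnthS; exact: h.
Qed.

End TensorMeasure.

Section Empirical.
Context {disp : measure_display} {T : measurableType disp} {R : realType}.
Variables (n : nat) (x : 'I_n.+1 -> T).

Let weight : {nonneg R} := (n.+1%:R^-1)%:nng.

(* [msum] takes a sequence indexed by nat, whence the [inord]. *)
Definition empirical : set T -> \bar R :=
  mscale weight (msum (fun k : nat => \d_(x (inord k))) n.+1).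

HB.instance Definition _ := Measure.on empirical.

Let empirical_setT : empirical setT = 1%E.
Proof.
rewrite /empirical /mscale /= /msum (eq_bigr (fun=> 1%E)); last first.
  by move=> i _; exact: diracT.
rewrite sumEFin -EFinM sumr_const card_ord /=.
by rewrite mulVf// pnatr_eq0.
Qed.

HB.instance Definition _ :=
  Measure_isProbability.Build _ _ _ empirical empirical_setT.

Lemma empiricalE (A : set T) :
  empirical A = ((n.+1%:R^-1)%:E * \sum_(k < n.+1) \d_(x k) A)%E.
Proof.
rewrite /empirical /mscale /= /msum; congr (_ * _)%E.
by apply: eq_bigr => i _; rewrite inord_val.
Qed.

End Empirical.

Section EntropicTransport.
Context {R : realType} {m d : nat}.
Local Notation T := (borelV R d).

(* A point of (R^d)^m is seen as an m-tuple for measure theory and as an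
   m x d matrix, whose j-th row is the j-th component, for differentiation. *)
Definition stack (x : m.-tuple T) : 'M[R]_(m, d) :=
  \matrix_(j < m, i < d) (tnth x j : 'rV[R]_d) ord0 i.

Definition prod_domain (X : 'I_m -> set 'rV[R]_d) : set 'M[R]_(m, d) :=
  [set x | forall j, X j (row j x)].

(* The iterated partial derivative in the directions listed in s. *)
Definition partial (s : seq ('I_m * 'I_d)) (g : 'M[R]_(m, d) -> R) :
    'M[R]_(m, d) -> R :=
  foldr (fun p h x => 'D_(delta_mx p.1 p.2) h x) g s.

Definition Ck (k : nat) (D : set 'M[R]_(m, d)) (g : 'M[R]_(m, d) -> R) : Prop :=
  [/\ {within D, continuous g},
      forall (s : seq ('I_m * 'I_d)) (p : 'I_m * 'I_d), (size s < k)%N ->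
        forall x, D° x -> derivable (partial s g) x (delta_mx p.1 p.2)
    & forall s : seq ('I_m * 'I_d), (size s <= k)%N ->
        exists2 h : 'M[R]_(m, d) -> R, {within D, continuous h}
          & forall x, D° x -> partial s g x = h x].

Definition couplings (mu : 'I_m -> probability T R) :
    set (probability (m.-tuple T) R) :=
  [set pi | forall (j : 'I_m) (A : set T), measurable A ->
     pi [set x | A (tnth x j)] = mu j A].

Definition KL {disp : measure_display} {S : measurableType disp}
    (P Q : probability S R) : \bar R :=
  if `[< P `<< Q >] then
    (\int[P]_x (ln (fine ('d (charge_of_finite_measure P) '/d Q x)))%:E)%E
  else +oo%E.

Definition S_eps (eps : R) (X : 'I_m -> set 'rV[R]_d) (c : 'M[R]_(m, d) -> R)
    (mu : 'I_m -> probability T R) : \bar R :=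
  ereal_inf [set (\int[pi]_(x in stack @^-1` prod_domain X) (c (stack x))%:E
                  + eps%:E * KL pi (tensor mu))%E | pi in couplings mu].

Definition dual_objective (eps : R) (X : 'I_m -> set 'rV[R]_d)
    (c : 'M[R]_(m, d) -> R) (nu : 'I_m -> probability T R)
    (f : 'I_m -> T -> R) : R :=
  \sum_(j < m) \int[nu j]_x f j x
  - eps * \int[tensor nu]_(x in stack @^-1` prod_domain X)
            expR ((\sum_(j < m) f j (tnth x j) - c (stack x)) / eps).

(* Indices are 0-based: the last potential is the one left unnormalized. *)
Definition admissible_potentials (nu : 'I_m -> probability T R)
    (f : 'I_m -> T -> R) : Prop :=
  (forall j, f j \in Lfun (nu j) +oo%E) /\
  (forall j : 'I_m, (j.+1 < m)%N -> \int[nu j]_x f j x = 0).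

Definition optimal_potentials (eps : R) (X : 'I_m -> set 'rV[R]_d)
    (c : 'M[R]_(m, d) -> R) (nu : 'I_m -> probability T R)
    (f : 'I_m -> T -> R) : Prop :=
  admissible_potentials nu f /\
  forall g, admissible_potentials nu g ->
    dual_objective eps X c nu g <= dual_objective eps X c nu f.

End EntropicTransport.

Section Sampling.
Context {dO dT : measure_display} {Omega : measurableType dO}
  {T : measurableType dT} {R : realType}.

Definition mutually_independent (P : probability Omega R) (I : eqType)
    (Y : I -> {mfun Omega >-> T}) : Prop :=
  forall (s : seq I) (A : I -> set T), uniq s ->
    (forall i, measurable (A i)) ->
    P (\bigcap_(i in [set` s]) (Y i @^-1` A i)) =
    (\prod_(i <- s) P (Y i @^-1` A i))%E.

Definition independent_sample (P : probability Omega R) (I : eqType)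
    (law : I -> probability T R) (Y : I -> {mfun Omega >-> T}) : Prop :=
  mutually_independent P Y /\
  forall (i : I) (A : set T), measurable A -> distribution P (Y i) A = law i A.

(* Q is a regular version of the conditional probability P( . | Y). *)
Definition conditional_probability {dS : measure_display}
    {S : measurableType dS} (P : probability Omega R) (Y : Omega -> S)
    (Q : Omega -> probability Omega R) : Prop :=
  forall A : set Omega, measurable A ->
    measurable_fun setT ((fun w => Q w A) :
      g_sigma_algebraType (preimage_set_system setT Y measurable) -> \bar R) /\
    (forall E : set S, measurable E ->
       (\int[P]_(w in Y @^-1` E) Q w A)%E = P (A `&` Y @^-1` E)).

Definition cvg_in_probability (P : probability Omega R)
    (Y : nat -> Omega -> R) (l : R) : Prop :=
  forall delta : R, 0 < delta ->
    P [set w | delta < `|Y n w - l|] @[n --> \oo] --> 0%E.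

End Sampling.

(* Main.v *)
Require Import Defs.
From HB Require Import structures.
From mathcomp Require Import all_boot all_order all_algebra.
From mathcomp Require Import all_classical all_reals all_analysis measurable_realfun.
From mathcomp Require Import ring lra zify.

Set Implicit Arguments.
Unset Strict Implicit.
Unset Printing Implicit Defensive.

Import Order.TTheory GRing.Theory Num.Theory.
Import numFieldNormedType.Exports.

Local Open Scope classical_set_scope.
Local Open Scope charge_scope.
Local Open Scope ring_scope.

(** Entropic transport is linear to first order. By duality [S_eps mu] is the
    maximum of the concave functional [dual], attained at the potentials that
    solve the Schrodinger system ([S_eps_schrodinger]). If [f] are the optimal
    potentials of [nu], the value at another family [mu] is therefore
    [\sum_j mean (mu j) (f j)], up to the defect of optimality of [f] for [mu].
    Because [dual] is strongly concave on bounded potentials, this error is at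
    most a constant times the squared norm of the gradient at [f] ([dual_gap]),
    a quadratic expression in the fluctuations of [mu] around [nu]. At empirical
    measures of [N] points its expectation is of order [1 / N]
    ([second_moment]), so it disappears after multiplication by [sqrt N].

    The same expansion, around the same [f], serves for samples of [nu] and,
    conditionally on the data, for samples of the empirical measures. In the
    second case [f] is no longer optimal at the centre, but the quadratic error
    of a sample of [mu] is in expectation at most a constant times that of [mu]
    ([mean_err]), and for empirical measures the latter is small. In both cases
    the rescaled cost is thus a normalized sum of independent bounded centered
    variables, plus a negligible term; the variances of the summands in the
    bootstrap case are the empirical ones, which converge to those of [nu]
    ([mean_var_empirical]).

    Both sums are compared with one explicit law, that of a sum of independent
    signs with the limiting variances, instead of a normal law. Replacing the
    summands one at a time ([lindeberg]) compares expectations of smooth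
    cutoffs. To pass to distribution functions ([cdf_compare]) it is enough that
    the signed sum charges no short interval, and this follows from the size of
    binomial coefficients ([iter_rad_window]); here some variance has to be
    positive. The outcome is a bound on the distance between distribution
    functions, uniform in the argument ([cdf_empirical_cost]), which the Markov
    inequality turns into convergence in probability ([bootstrap_deviation]).

    Three further points support the argument. Potentials of empirical measures
    exist: they maximize [dual] over finite tables, and soft c-transforms extend
    them to the whole space ([empirical_potentials]). Maximizers solve the
    Schrodinger system because exact maximization in one potential is a strict
    improvement unless the corresponding marginal is right ([defect_eq0]). And
    the bootstrap statistic is centered at a random quantity, which however is a
    function of the data, hence a constant for the conditional probability
    ([conditional_frozen]). *)

(** * Expectations of bounded measurable functions *)

Section BoundedMeasurable.
Context {d : measure_display} {T : measurableType d} {R : realType}.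
Implicit Types f g : T -> R.

(** Bounded measurable functions, on which expectations, differences and
    iterated integrals are free of side conditions. *)
Definition bm f : Prop :=
  measurable_fun setT f /\ exists B, forall x, `|f x| <= B.

Lemma bm_measurable f : bm f -> measurable_fun setT f.
Proof. by case. Qed.

Lemma bm_bound f : bm f -> exists2 B, 0 < B & forall x, `|f x| <= B.
Proof.
move=> [_ [B fB]]; exists (Num.max B 1); first by rewrite lt_max ltr01 orbT.
by move=> x; rewrite le_max fB.
Qed.

Lemma bmI f B : measurable_fun setT f -> (forall x, `|f x| <= B) -> bm f.
Proof. by move=> mf fB; split=> //; exists B. Qed.

Lemma bm_cst (k : R) : bm (fun=> k).
Proof. by apply: (@bmI _ `|k|) => //; exact: measurable_cst. Qed.

Lemma bmD f g : bm f -> bm g -> bm (fun x => f x + g x).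
Proof.
move=> [mf [A fA]] [mg [B gB]]; apply: (@bmI _ (A + B)).
  exact: measurable_funD.
by move=> x; rewrite (le_trans (ler_normD _ _))// lerD.
Qed.

Lemma bmN f : bm f -> bm (fun x => - f x).
Proof.
move=> [mf [A fA]]; apply: (@bmI _ A); first exact: measurableT_comp.
by move=> x; rewrite normrN.
Qed.

Lemma bmB f g : bm f -> bm g -> bm (fun x => f x - g x).
Proof. by move=> bf bg; apply: bmD => //; exact: bmN. Qed.

Lemma bmM f g : bm f -> bm g -> bm (fun x => f x * g x).
Proof.
move=> [mf [A fA]] [mg [B gB]]; apply: (@bmI _ (A * B)).
  exact: measurable_funM.
by move=> x; rewrite normrM ler_pM.
Qed.

Lemma bmX f n : bm f -> bm (fun x => f x ^+ n).
Proof.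
move=> bf; elim: n => [|n IH]; first by under eq_fun do rewrite expr0; exact: bm_cst.
by under eq_fun do rewrite exprS; exact: bmM.
Qed.

Lemma bm_norm f : bm f -> bm (fun x => `|f x|).
Proof.
move=> [mf [A fA]]; apply: (@bmI _ A); first exact: measurableT_comp.
by move=> x; rewrite normr_id.
Qed.

Lemma bm_expR f : bm f -> bm (fun x => expR (f x)).
Proof.
move=> [mf [A fA]]; apply: (@bmI _ (expR A)).
  exact: measurableT_comp.
by move=> x; rewrite ger0_norm ?expR_ge0// ler_expR (le_trans (ler_norm _)).
Qed.

Lemma bm_ln f l : 0 < l -> (forall x, l <= f x) -> bm f -> bm (fun x => ln (f x)).
Proof.
move=> l0 lf [mf [A fA]].
have fp x : 0 < f x by exact: lt_le_trans (lf x).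
have A0 : 0 < A by exact: lt_le_trans (fp point) (le_trans (ler_norm _) (fA _)).
apply: (@bmI _ (`|ln A| + `|ln l|)); first exact: measurableT_comp.
move=> x; rewrite ler_norml; apply/andP; split.
  rewrite lerNl (@le_trans _ _ (- ln l))//.
    by rewrite lerN2 ler_ln ?posrE.
  by rewrite (le_trans (ler_norm _))// normrN lerDr.
rewrite (@le_trans _ _ (ln A))//.
  by rewrite ler_ln ?posrE// (le_trans (ler_norm _)).
by rewrite (le_trans (ler_norm _))// lerDl.
Qed.

Lemma bm_inv f l : 0 < l -> (forall x, l <= f x) -> bm f -> bm (fun x => (f x)^-1).
Proof.
move=> l0 lf bf.
have fp x : 0 < f x by exact: lt_le_trans (lf x).
have -> : (fun x => (f x)^-1) = (fun x => expR (- ln (f x))).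
  by apply/funext => x; rewrite expRN lnK// posrE.
by apply: bm_expR; apply: bmN; exact: (bm_ln l0).
Qed.

Lemma bm_indic (A : set T) : measurable A -> bm (\1_A : T -> R).
Proof.
move=> mA; apply: (@bmI _ 1); first exact: measurable_indic.
by move=> x; rewrite indicE; case: (_ \in _); rewrite ?normr1 ?normr0.
Qed.

Lemma bm_sum (I : Type) (s : seq I) (P : pred I) (F : I -> T -> R) :
  (forall i, P i -> bm (F i)) -> bm (fun x => \sum_(i <- s | P i) F i x).
Proof.
move=> bF; elim: s => [|i s IH].
  have -> : (fun x => \sum_(i <- [::] | P i) F i x) = (fun=> 0).
    by apply/funext => x; rewrite big_nil.
  exact: bm_cst.
have -> : (fun x => \sum_(j <- i :: s | P j) F j x) =
    (fun x => (if P i then F i x else 0) + \sum_(j <- s | P j) F j x).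
  by apply/funext => x; rewrite big_cons; case: ifP => // _; rewrite add0r.
apply: bmD => //; case: (boolP (P i)) => [/bF|_] //=; exact: bm_cst.
Qed.

End BoundedMeasurable.

Lemma bm_comp {d1 d2 : measure_display} {T1 : measurableType d1}
    {T2 : measurableType d2} {R : realType} (f : T2 -> R) (phi : T1 -> T2) :
  measurable_fun setT phi -> bm f -> bm (fun x => f (phi x)).
Proof.
move=> mphi [mf [B fB]]; apply: (@bmI _ _ _ _ B) => //; exact: measurableT_comp.
Qed.

Lemma le_of_eq {disp : Order.disp_t} {T : porderType disp} (x y : T) : x = y -> (x <= y)%O.
Proof. by move->. Qed.

Lemma norm_le_sqr {R : realType} (s a : R) : 0 < s -> `|a| <= s * a ^+ 2 + s^-1.
Proof.
move=> s0; have : 0 <= s^-1 * (s * `|a| - 1) ^+ 2 by rewrite mulr_ge0 ?sqr_ge0 ?invr_ge0 ?ltW.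
have -> : s^-1 * (s * `|a| - 1) ^+ 2 = s * `|a| ^+ 2 - 2 * `|a| + s^-1.
  by field; rewrite gt_eqF.
rewrite (real_normK (num_real a)).
by have := normr_ge0 a; move: (s * a ^+ 2) `|a| s^-1 => x y z; lra.
Qed.

Section RealPreimages.
Context {d : measure_display} {T : measurableType d} {R : realType}.
Variable f : T -> R.

Lemma measurable_gtr t : measurable_fun setT f -> measurable [set x | t < f x].
Proof.
move=> mf; rewrite -[X in measurable X]setTI -preimage_itvoy; apply: mf => //.
Qed.

Lemma measurable_ler t : measurable_fun setT f -> measurable [set x | f x <= t].
Proof.
move=> mf; rewrite (_ : [set x | _] = ~` [set x | t < f x]).
  by apply: measurableC; exact: measurable_gtr.
by apply/seteqP; split => x /=; rewrite leNgt => /negP.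
Qed.

Lemma measurable_fun_gtr : (forall t, measurable [set x | t < f x]) ->
  measurable_fun setT f.
Proof.
move=> mf; apply: (measurability _ (RGenOInfty.measurableE R)).
by move=> /= _ [_ [a ->] <-]; rewrite preimage_itvoy setTI; exact: mf.
Qed.

End RealPreimages.

Section Mean.
Context {d : measure_display} {T : measurableType d} {R : realType}.
Variable mu : probability T R.
Implicit Types f g : T -> R.

Definition mean f : R := \int[mu]_x f x.

Lemma bm_integrable f : bm f -> mu.-integrable setT (EFin \o f).
Proof.
move=> [mf [B fB]]; apply: measurable_bounded_integrable => //.
  by rewrite -ge0_fin_numE// fin_num_measure.
exists B; split; first by rewrite num_real.
by move=> C BC x _ /=; rewrite (le_trans (fB x))// ltW.
Qed.

Lemma EFin_mean f : bm f -> (mean f)%:E = (\int[mu]_x (f x)%:E)%E.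
Proof. by move=> bf; rewrite fineK// integrable_fin_num//; exact: bm_integrable. Qed.

Lemma eq_mean f g : f =1 g -> mean f = mean g.
Proof. by move=> fg; apply: eq_Rintegral => x _; exact: fg. Qed.

Lemma mean_cst k : mean (fun=> k) = k.
Proof.
rewrite /mean Rintegral_cst// -[RHS]mulr1 -[X in _ = _ * X]/(fine 1%E).
by congr (_ * fine _); exact: probability_setT.
Qed.

Lemma meanD f g : bm f -> bm g -> mean (fun x => f x + g x) = mean f + mean g.
Proof. by move=> bf bg; rewrite /mean RintegralD//; exact: bm_integrable. Qed.

Lemma meanB f g : bm f -> bm g -> mean (fun x => f x - g x) = mean f - mean g.
Proof. by move=> bf bg; rewrite /mean RintegralB//; exact: bm_integrable. Qed.

Lemma meanZ k f : bm f -> mean (fun x => k * f x) = k * mean f.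
Proof. by move=> bf; rewrite /mean RintegralZl//; exact: bm_integrable. Qed.

Lemma meanZr k f : bm f -> mean (fun x => f x * k) = mean f * k.
Proof. by move=> bf; under eq_mean do rewrite mulrC; rewrite meanZ// mulrC. Qed.

Lemma meanN f : bm f -> mean (fun x => - f x) = - mean f.
Proof. by move=> bf; under eq_mean do rewrite -mulN1r; rewrite meanZ// mulN1r. Qed.

Lemma mean_sum (I : Type) (s : seq I) (P : pred I) (F : I -> T -> R) :
  (forall i, P i -> bm (F i)) ->
  mean (fun x => \sum_(i <- s | P i) F i x) = \sum_(i <- s | P i) mean (F i).
Proof.
move=> bF; elim: s => [|i s IH].
  by rewrite big_nil -[RHS]mean_cst; apply: eq_mean => x; rewrite big_nil.
rewrite big_cons; case: ifPn => [Pi|/negbTE nPi].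
  rewrite -IH -meanD; [|exact: bF|exact: bm_sum].
  by apply: eq_mean => x; rewrite big_cons Pi.
by rewrite -IH; apply: eq_mean => x; rewrite big_cons nPi.
Qed.

Lemma le_mean f g : bm f -> bm g -> (forall x, f x <= g x) -> mean f <= mean g.
Proof. by move=> bf bg fg; apply: le_Rintegral => //; exact: bm_integrable. Qed.

Lemma mean_ge0 f : (forall x, 0 <= f x) -> 0 <= mean f.
Proof. by move=> f0; exact: Rintegral_ge0. Qed.

Lemma mean_le f k : bm f -> (forall x, f x <= k) -> mean f <= k.
Proof. by move=> bf fk; rewrite -(mean_cst k); apply: le_mean => //; exact: bm_cst. Qed.

Lemma mean_ge f k : bm f -> (forall x, k <= f x) -> k <= mean f.
Proof. by move=> bf fk; rewrite -(mean_cst k); apply: le_mean => //; exact: bm_cst. Qed.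

Lemma mean_norm f : bm f -> `|mean f| <= mean (fun x => `|f x|).
Proof. by move=> bf; apply: le_normr_Rintegral => //; exact: bm_integrable. Qed.

Lemma mean_norm_le f k : bm f -> (forall x, `|f x| <= k) -> `|mean f| <= k.
Proof.
move=> bf fk; rewrite (le_trans (mean_norm bf))// mean_le//; exact: bm_norm.
Qed.

Lemma mean_indic (A : set T) : measurable A -> mean \1_A = fine (mu A).
Proof. by move=> mA; rewrite /mean /Rintegral integral_indic// setIT. Qed.

Lemma mean_ae f g : measurable_fun setT f -> measurable_fun setT g ->
  {ae mu, forall x, f x = g x} -> mean f = mean g.
Proof.
move=> mf mg fg; congr fine; apply: ae_eq_integral => //.
- exact/measurable_EFinP.
- exact/measurable_EFinP.
- by apply: filterS fg => x /= ->.
Qed.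

Lemma markov_mean f a : bm f -> (forall x, 0 <= f x) -> 0 < a ->
  fine (mu [set x | a < f x]) <= mean f / a.
Proof.
move=> bf f0 a0.
have mA := measurable_gtr a (bm_measurable bf).
rewrite -mean_indic// ler_pdivlMr// -meanZr; last exact: bm_indic.
apply: le_mean => //; first by apply: bmM; [exact: bm_indic|exact: bm_cst].
move=> x; rewrite indicE; case: (boolP (x \in _)) => [|_]; last by rewrite mul0r.
by rewrite inE/= mul1r => /ltW.
Qed.

End Mean.

Lemma mean_pushforward {d1 d2 : measure_display} {T1 : measurableType d1}
    {T2 : measurableType d2} {R : realType} (mu : probability T1 R)
    (Y : {mfun T1 >-> T2}) (f : T2 -> R) :
  bm f -> mean (distribution mu Y) f = mean mu (fun x => f (Y x)).
Proof.
move=> bf; congr fine; rewrite /distribution integral_pushforward//.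
  by apply/measurable_EFinP; case: bf.
exact: (@bm_integrable _ _ _ mu (fun x => f (Y x)) (bm_comp _ bf)).
Qed.

Section MeanProduct.
Context {d1 d2 : measure_display} {T1 : measurableType d1}
  {T2 : measurableType d2} {R : realType}.
Variables (P : probability T1 R) (Q : probability T2 R).
Variable f : T1 * T2 -> R.
Hypothesis bf : bm f.

Lemma bm_section1 x : bm (fun y => f (x, y)).
Proof. by apply: (bm_comp _ bf); exact: measurable_pair1. Qed.

Lemma bm_section2 y : bm (fun x => f (x, y)).
Proof. by apply: (bm_comp _ bf); exact: measurable_pair2. Qed.

Lemma bm_mean1 : bm (fun x => mean Q (fun y => f (x, y))).
Proof.
have [B B0 fB] := bm_bound bf.
apply: (@bmI _ _ _ _ B); last first.
  by move=> x; apply: mean_norm_le => //; exact: bm_section1.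
apply/measurable_EFinP.
rewrite (_ : _ \o _ = fubini_F Q (EFin \o f)).
  exact: (measurable_fubini_F (bm_integrable (prod_prob P Q) bf)).
by apply/funext => x; rewrite /= EFin_mean//; exact: bm_section1.
Qed.

Lemma bm_mean2 : bm (fun y => mean P (fun x => f (x, y))).
Proof.
have [B B0 fB] := bm_bound bf.
apply: (@bmI _ _ _ _ B); last first.
  by move=> x; apply: mean_norm_le => //; exact: bm_section2.
apply/measurable_EFinP.
rewrite (_ : _ \o _ = fubini_G P (EFin \o f)).
  exact: (measurable_fubini_G (bm_integrable (prod_prob P Q) bf)).
by apply/funext => x; rewrite /= EFin_mean//; exact: bm_section2.
Qed.

Lemma mean_prod1 : mean (prod_prob P Q) f = mean P (fun x => mean Q (fun y => f (x, y))).
Proof.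
apply: EFin_inj; rewrite !EFin_mean//; last exact: bm_mean1.
rewrite -(integral12_prod_meas1 (bm_integrable (prod_prob P Q) bf)).
apply: eq_integral => x _ /=; rewrite EFin_mean//; exact: bm_section1.
Qed.

Lemma mean_prod2 : mean (prod_prob P Q) f = mean Q (fun y => mean P (fun x => f (x, y))).
Proof.
apply: EFin_inj; rewrite !EFin_mean//; last exact: bm_mean2.
rewrite -(integral21_prod_meas1 (bm_integrable (prod_prob P Q) bf)).
apply: eq_integral => x _ /=; rewrite EFin_mean//; exact: bm_section2.
Qed.

Lemma mean_swap : mean P (fun x => mean Q (fun y => f (x, y))) =
  mean Q (fun y => mean P (fun x => f (x, y))).
Proof. by rewrite -mean_prod1 mean_prod2. Qed.

End MeanProduct.

(** * Integration against product measures and empirical measures *)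

Lemma independent_sample_reindex {dO dT : measure_display} {O : measurableType dO}
    {T : measurableType dT} {R : realType} (P : probability O R) (I J : eqType)
    (law : I -> probability T R) (Y : I -> {mfun O >-> T}) (g : J -> I) :
  injective g -> independent_sample P law Y ->
  independent_sample P (fun j => law (g j)) (fun j => Y (g j)).
Proof.
move=> inj_g [indY lawY]; split; last by move=> j A mA; exact: lawY.
move=> s A us mA.
pose A' (i : I) : set T := [set a | forall k, g k = i -> A k a].
have A'g k : A' (g k) = A k.
  apply/seteqP; split => a /=; first by apply.
  by move=> Aa l /inj_g ->.
have mA' i : measurable (A' i).
  have [[k <-]|ne] := pselect (exists k, g k = i); first by rewrite A'g.
  rewrite (_ : A' i = setT)//; apply/seteqP; split => // a _ k ek.
  by exfalso; apply: ne; exists k.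
have ug : uniq (map g s) by rewrite map_inj_uniq.
have := indY (map g s) A' ug mA'; rewrite big_map => H.
rewrite (eq_bigr (fun i => P (Y (g i) @^-1` A' (g i)))); last by move=> i _; rewrite A'g.
rewrite -H; congr (P _); apply/seteqP; split => w /= Aw.
  by move=> _ /= /mapP[k ks ->]; rewrite A'g; exact: Aw.
by move=> k ks; have := Aw (g k) (map_f g ks); rewrite A'g.
Qed.

Section TensorMean.
Context {disp : measure_display} {T : measurableType disp} {R : realType}.

Lemma mean_tensor0 (mu : 'I_0 -> probability T R) (F : 0.-tuple T -> R) :
  bm F -> mean (tensor mu) F = F [tuple].
Proof.
move=> bF; apply: EFin_inj; rewrite EFin_mean//= integral_dirac//; last first.
  by apply/measurable_EFinP; case: bF.
by rewrite diracT mul1e.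
Qed.

Lemma mean_tensorS n (mu : 'I_n.+1 -> probability T R) (F : n.+1.-tuple T -> R) :
  bm F -> mean (tensor mu) F =
    mean (mu ord0) (fun a =>
      mean (tensor (fun i => mu (lift ord0 i))) (fun x => F (tcons (a, x)))).
Proof.
move=> bF; rewrite [LHS](mean_pushforward _ (@tcons _ T n))//.
by rewrite mean_prod1//; apply: (bm_comp _ bF).
Qed.

Lemma bm_tcons n (F : n.+1.-tuple T -> R) a : bm F -> bm (fun x => F (tcons (a, x))).
Proof.
move=> bF; apply: (@bm_section1 _ _ _ _ _ (fun p => F (tcons p))).
exact: (bm_comp _ bF).
Qed.

Lemma bm_mean_tcons n (Q : probability (n.-tuple T) R) (F : n.+1.-tuple T -> R) :
  bm F -> bm (fun a => mean Q (fun x => F (tcons (a, x)))).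
Proof.
move=> bF; apply: (@bm_mean1 _ _ _ _ _ (\d_point) Q (fun p => F (tcons p))).
exact: (bm_comp _ bF).
Qed.

Lemma eq_tensor n (mu mu' : 'I_n -> probability T R) :
  mu =1 mu' -> tensor mu = tensor mu'.
Proof. by move=> /funext ->. Qed.

Definition tset n (x : n.-tuple T) (j : 'I_n) (a : T) : n.-tuple T :=
  [tuple if i == j then a else tnth x i | i < n].

Lemma tnth_tset n (x : n.-tuple T) j a i :
  tnth (tset x j a) i = if i == j then a else tnth x i.
Proof. by rewrite tnth_mktuple. Qed.

Lemma tset_id n (x : n.-tuple T) j : tset x j (tnth x j) = x.
Proof. by apply: eq_from_tnth => i; rewrite tnth_tset; case: eqP => [->|]. Qed.

Lemma tset_tset n (x : n.-tuple T) j a b : tset (tset x j a) j b = tset x j b.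
Proof. by apply: eq_from_tnth => i; rewrite !tnth_tset; case: eqP. Qed.

Lemma tset_tcons0 n (x : n.-tuple T) a b : tset (tcons (a, x)) ord0 b = tcons (b, x).
Proof.
apply: eq_from_tnth => i; rewrite tnth_tset; case: (unliftP ord0 i) => [k|] ->.
  by rewrite eq_sym (negbTE (neq_lift _ _)) /tcons/= !tnthS.
by rewrite eqxx.
Qed.

Lemma tset_tconsS n (x : n.-tuple T) j a b :
  tset (tcons (a, x)) (lift ord0 j) b = tcons (a, tset x j b).
Proof.
apply: eq_from_tnth => i; rewrite tnth_tset; case: (unliftP ord0 i) => [k|] ->.
  by rewrite (inj_eq lift_inj) /tcons/= !tnthS tnth_tset.
by rewrite (negbTE (neq_lift _ _)).
Qed.

Lemma measurable_tset n j :
  measurable_fun setT (fun p : T * n.-tuple T => tset p.2 j p.1).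
Proof.
apply/measurable_fun_tnthP => i /=.
rewrite (_ : _ \o _ = fun p : T * n.-tuple T => if i == j then p.1 else tnth p.2 i).
  case: (i == j); first exact: measurable_fst.
  apply: (@measurableT_comp _ _ _ _ _ _ (fun x : n.-tuple T => tnth x i)) => //.
  exact: measurable_tnth.
by apply/funext => p /=; rewrite tnth_tset.
Qed.

Lemma bm_tset_pair n j (F : n.-tuple T -> R) :
  bm F -> bm (fun p : T * n.-tuple T => F (tset p.2 j p.1)).
Proof. by apply: bm_comp; exact: measurable_tset. Qed.

Lemma bm_tset n j a (F : n.-tuple T -> R) : bm F -> bm (fun x => F (tset x j a)).
Proof. by move=> bF; exact: (bm_section1 (bm_tset_pair j bF)). Qed.

Lemma bm_tnth n j (h : T -> R) : bm h -> bm (fun x : n.-tuple T => h (tnth x j)).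
Proof. by apply: bm_comp; exact: measurable_tnth. Qed.

(** A coordinate may be redrawn independently of all the others. *)
Lemma mean_resample n (mu : 'I_n -> probability T R) j (F : n.-tuple T -> R) :
  bm F -> mean (tensor mu) F =
    mean (mu j) (fun a => mean (tensor mu) (fun x => F (tset x j a))).
Proof.
elim: n mu j F => [mu []//|n IH mu j F bF].
rewrite mean_tensorS//; case: (unliftP ord0 j) => [k|] ->; last first.
  apply: eq_mean => a; rewrite mean_tensorS; last exact: bm_tset.
  under [RHS]eq_mean do under eq_mean do rewrite tset_tcons0.
  by rewrite mean_cst.
transitivity (mean (mu ord0) (fun b => mean (mu (lift ord0 k)) (fun a =>
    mean (tensor (fun i => mu (lift ord0 i))) (fun x =>
      F (tset (tcons (b, x)) (lift ord0 k) a))))).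
  apply: eq_mean => b; rewrite (IH _ k); last exact: bm_tcons.
  by apply: eq_mean => a; apply: eq_mean => x; rewrite tset_tconsS.
pose Q := tensor (fun i => mu (lift ord0 i)).
pose G (p : T * T) := mean Q (fun x => F (tset (tcons (p.1, x)) (lift ord0 k) p.2)).
have bG : bm G.
  pose K (q : (T * T) * n.-tuple T) := F (tset (tcons (q.1.1, q.2)) (lift ord0 k) q.1.2).
  apply: (@bm_mean1 _ _ _ _ _ (\d_point) Q K).
  apply: (bm_comp _ (bm_tset_pair (lift ord0 k) bF) (phi := fun q =>
    (q.1.2, tcons (q.1.1, q.2)))).
  apply: measurable_fun_pair => /=; first exact: measurableT_comp.
  apply: (measurableT_comp (@measurable_tcons _ T n)).
  by apply: measurable_fun_pair => //; exact: measurableT_comp.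
rewrite (mean_swap (mu ord0) (mu (lift ord0 k)) bG).
by apply: eq_mean => a; rewrite mean_tensorS//; exact: bm_tset.
Qed.

(** The conditional expectation of [F] given that coordinate [j] equals [a];
    integrating over the overwritten coordinate is harmless. *)
Definition marginal n (mu : 'I_n -> probability T R) (F : n.-tuple T -> R)
  (j : 'I_n) (a : T) : R := mean (tensor mu) (fun x => F (tset x j a)).

Lemma bm_marginal n (mu : 'I_n -> probability T R) F j : bm F -> bm (marginal mu F j).
Proof.
by move=> bF; apply: (@bm_mean1 _ _ _ _ _ (\d_point) (tensor mu) _ (bm_tset_pair j bF)).
Qed.

Lemma mean_marginal n (mu : 'I_n -> probability T R) j (F : n.-tuple T -> R) :
  bm F -> mean (tensor mu) F = mean (mu j) (marginal mu F j).
Proof. exact: mean_resample. Qed.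

Lemma mean_tnthM n (mu : 'I_n -> probability T R) j (h : T -> R) (F : n.-tuple T -> R) :
  bm h -> bm F -> mean (tensor mu) (fun x => h (tnth x j) * F x) =
    mean (mu j) (fun a => h a * marginal mu F j a).
Proof.
move=> bh bF; rewrite (mean_resample _ j); last by apply: bmM => //; exact: bm_tnth.
apply: eq_mean => a; rewrite -meanZ; last exact: bm_tset.
by apply: eq_mean => x; rewrite tnth_tset eqxx.
Qed.

Lemma mean_tnth n (mu : 'I_n -> probability T R) j (h : T -> R) :
  bm h -> mean (tensor mu) (fun x => h (tnth x j)) = mean (mu j) h.
Proof.
move=> bh; rewrite (mean_marginal _ j); last exact: bm_tnth.
apply: eq_mean => a; rewrite /marginal; under eq_mean do rewrite tnth_tset eqxx.
by rewrite mean_cst.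
Qed.

Lemma marginal_tnth n (mu : 'I_n -> probability T R) j k (h : T -> R) a : j != k ->
  bm h -> marginal mu (fun x => h (tnth x k)) j a = mean (mu k) h.
Proof.
move=> jk bh; rewrite -(mean_tnth mu)//; apply: eq_mean => x.
by rewrite tnth_tset eq_sym (negbTE jk).
Qed.

Lemma mean_tnth2 n (mu : 'I_n -> probability T R) j k (g h : T -> R) : j != k ->
  bm g -> bm h -> mean (tensor mu) (fun x => g (tnth x j) * h (tnth x k)) =
    mean (mu j) g * mean (mu k) h.
Proof.
move=> jk bg bh; rewrite mean_tnthM//; last exact: bm_tnth.
by under eq_mean do rewrite marginal_tnth//; rewrite meanZr.
Qed.

Lemma measurable_cat n1 n2 :
  measurable_fun setT (fun p : n1.-tuple T * n2.-tuple T => [tuple of p.1 ++ p.2]).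
Proof.
apply/measurable_fun_tnthP => i /=; rewrite -[i]splitK.
case: (fintype.split i) => k /=.
  rewrite (_ : _ \o _ = (fun x : n1.-tuple T => tnth x k) \o fst).
    by apply: measurableT_comp => //; exact: measurable_tnth.
  by apply/funext => p /=; rewrite tnth_lshift.
rewrite (_ : _ \o _ = (fun x : n2.-tuple T => tnth x k) \o snd).
  by apply: measurableT_comp => //; exact: measurable_tnth.
by apply/funext => p /=; rewrite tnth_rshift.
Qed.

Lemma mean_tensor_split n1 n2 (mu : 'I_(n1 + n2) -> probability T R)
    (F : (n1 + n2).-tuple T -> R) : bm F ->
  mean (tensor mu) F =
    mean (tensor (fun i => mu (lshift n2 i))) (fun u =>
      mean (tensor (fun i => mu (rshift n1 i))) (fun v => F [tuple of u ++ v])).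
Proof.
elim: n1 mu F => [|n1 IH] mu F bF.
  rewrite mean_tensor0; last first.
    pose H (p : 0.-tuple T * n2.-tuple T) := F [tuple of p.1 ++ p.2].
    apply: (@bm_mean1 _ _ _ _ _ (\d_[tuple]) _ H).
    rewrite /H; apply: bm_comp bF; exact: measurable_cat.
  rewrite (@eq_tensor _ mu (fun i => mu (rshift 0 i))); last first.
    by move=> i; congr mu; apply: val_inj.
  by apply: eq_mean => x; congr F; apply: val_inj.
rewrite mean_tensorS; last first.
  pose H (p : n1.+1.-tuple T * n2.-tuple T) := F [tuple of p.1 ++ p.2].
  apply: (@bm_mean1 _ _ _ _ _ (\d_(nseq_tuple _ point)) _ H).
  by rewrite /H; apply: bm_comp bF; exact: measurable_cat.
rewrite [LHS](@mean_tensorS (n1 + n2))//.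
have -> : lshift n2 ord0 = ord0 :> 'I_(n1 + n2).+1 by exact: val_inj.
apply: eq_mean => a; rewrite [LHS]IH; last exact: (@bm_tcons (n1 + n2)).
rewrite (@eq_tensor _ (fun i => mu (lift ord0 (lshift n2 i)))
   (fun i => mu (lshift n2 (lift ord0 i)))); last first.
  by move=> i; congr mu; apply: val_inj.
apply: eq_mean => u.
rewrite (@eq_tensor _ (fun i => mu (lift ord0 (rshift n1 i)))
   (fun i => mu (rshift n1.+1 i))); last first.
  by move=> i; congr mu; apply: val_inj.
by apply: eq_mean => v; congr F; apply: val_inj.
Qed.

Let boxes n : set (set (n.-tuple T)) :=
  [set A | exists2 B : 'I_n -> set T, (forall i, measurable (B i)) &
     A = [set x | forall i, B i (tnth x i)]].

Let box_measurable n (A : set (n.-tuple T)) : boxes A -> measurable A.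
Proof.
move=> [B mB ->]; rewrite (_ : [set x | _] =
    \bigcap_(i : 'I_n) ((fun x => tnth x i) @^-1` B i)).
  apply: fin_bigcap_measurable => // i _.
  by rewrite -[X in measurable X]setTI; exact: measurable_tnth.
by apply/seteqP; split => [x /= h i _|x h i]; exact: h.
Qed.

(** Boxes form a pi-system that generates the product sigma-algebra. *)
Lemma tensor_unique n (mu : 'I_n -> probability T R) (Q : probability (n.-tuple T) R) :
  (forall A : 'I_n -> set T, (forall i, measurable (A i)) ->
    Q [set x | forall i, A i (tnth x i)] = (\prod_(i < n) mu i (A i))%E) ->
  forall A, measurable A -> Q A = tensor mu A.
Proof.
move=> h A mA.
apply: (measure_unique (@boxes n) (fun=> setT)) => //.
- apply/seteqP; split.
    apply: smallest_sub; first exact: smallest_sigma_algebra.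
    rewrite -bigcup_seq => B/= [i _ [C mC <-]]; apply: sub_sigma_algebra.
    exists (fun k => if k == i then C else setT); first by move=> k; case: ifP.
    apply/seteqP; split => x /=; first by move=> [_ Cx] k; case: eqP => [->|].
    by move=> /(_ i); rewrite eqxx.
  apply: smallest_sub; first exact: sigma_algebra_measurable.
  exact: box_measurable.
- move=> B C [B' mB ->] [C' mC ->]; exists (fun i => B' i `&` C' i).
    by move=> i; exact: measurableI.
  apply/seteqP; split => x /=; first by move=> [? ?] i.
  by move=> H; split => i; have [] := H i.
- by move=> _; exists (fun=> setT) => //; apply/seteqP; split.
- by rewrite bigcup_const.
- move=> B [C mC ->]; transitivity (\prod_(i < n) mu i (C i))%E; first exact: h.
  by apply: esym; exact: tensor_box.
- by move=> _; rewrite -ge0_fin_numE// fin_num_measure.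
Qed.

Lemma mean_tensor_unique n (mu : 'I_n -> probability T R)
    (Q : probability (n.-tuple T) R) (F : n.-tuple T -> R) :
  (forall A : 'I_n -> set T, (forall i, measurable (A i)) ->
    Q [set x | forall i, A i (tnth x i)] = (\prod_(i < n) mu i (A i))%E) ->
  mean Q F = mean (tensor mu) F.
Proof.
move=> h; congr fine; apply: eq_measure_integral => A mA _.
exact: tensor_unique.
Qed.

Lemma measurable_mktuple {d1 : measure_display} {T1 : measurableType d1} n
    (Y : 'I_n -> T1 -> T) : (forall i, measurable_fun setT (Y i)) ->
  measurable_fun setT (fun w => [tuple Y i w | i < n]).
Proof.
move=> mY; apply/measurable_fun_tnthP => i.
by rewrite (_ : _ \o _ = Y i)//; apply/funext => w /=; rewrite tnth_mktuple.
Qed.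

(** Independence gives the mass of boxes, which determine the law. *)
Lemma mean_sample {dO : measure_display} {Omega : measurableType dO} {I : eqType}
    (P : probability Omega R) (law : I -> probability T R)
    (Y : I -> {mfun Omega >-> T}) n (e : 'I_n -> I) (F : n.-tuple T -> R) :
  independent_sample P law Y -> injective e -> bm F ->
  mean P (fun w => F [tuple Y (e i) w | i < n]) = mean (tensor (fun i => law (e i))) F.
Proof.
move=> ind inj_e bF; have [indY lawY] := independent_sample_reindex inj_e ind.
have mY := measurable_mktuple (fun i => measurable_funP (Y (e i))).
pose Z : {mfun Omega >-> n.-tuple T} :=
  HB.pack (fun w => [tuple Y (e i) w | i < n]) (isMeasurableFun.Build _ _ _ _ _ mY).
rewrite -(mean_pushforward P Z bF); apply: mean_tensor_unique => A mA.
have := indY (enum 'I_n) A (enum_uniq _) mA; rewrite big_enum /= => H.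
transitivity (P (\bigcap_(i in [set` enum 'I_n]) (Y (e i) @^-1` A i))).
  rewrite /distribution /pushforward; congr (P _); apply/seteqP; split => w /= Aw k.
    by have := Aw k; rewrite tnth_mktuple.
  by rewrite tnth_mktuple; apply: (Aw k); rewrite /= mem_enum.
by rewrite H; apply: eq_bigr => k _; exact: lawY.
Qed.

Lemma mean_empirical n (x : 'I_n.+1 -> T) (F : T -> R) :
  bm F -> mean (empirical x) F = n.+1%:R^-1 * \sum_(k < n.+1) F (x k).
Proof.
move=> bF; have [B B0 FB] := bm_bound bF.
suff H (G : T -> R) : bm G -> (forall t, 0 <= G t) ->
    mean (empirical x) G = n.+1%:R^-1 * \sum_(k < n.+1) G (x k).
  have bFB := bmD bF (bm_cst B).
  have := H _ bFB; rewrite meanD//; last exact: bm_cst.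
  rewrite mean_cst big_split /= sumr_const card_ord mulrDr.
  rewrite -[B *+ _]mulr_natl mulKf ?pnatr_eq0// => H0; apply: (addIr B); apply: H0.
  by move=> t; rewrite -lerBlDr sub0r; have := FB t; rewrite ler_norml => /andP[].
move=> bG G0; apply: EFin_inj; rewrite EFin_mean//.
have mG : measurable_fun setT (EFin \o G) by apply/measurable_EFinP; case: bG.
rewrite ge0_integral_mscale//; last by move=> t _; rewrite lee_fin.
rewrite ge0_integral_measure_sum//; last by move=> t _; rewrite lee_fin.
rewrite EFinM; congr (_ * _)%E; rewrite -sumEFin; apply: eq_bigr => k _.
by rewrite integral_dirac// diracT mul1e /= inord_val.
Qed.

End TensorMean.

(** Product measures are determined by their marginals, so they commute with
    coordinatewise images. *)
Lemma mean_tensor_map {d1 d2 : measure_display} {T1 : measurableType d1}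
    {T2 : measurableType d2} {R : realType} n (mu : 'I_n -> probability T1 R)
    (nu : 'I_n -> probability T2 R) (phi : 'I_n -> T1 -> T2) (F : n.-tuple T2 -> R) :
  (forall i, measurable_fun setT (phi i)) ->
  (forall i h, bm h -> mean (nu i) h = mean (mu i) (fun a => h (phi i a))) ->
  bm F ->
  mean (tensor nu) F = mean (tensor mu) (fun x => F [tuple phi i (tnth x i) | i < n]).
Proof.
move=> mphi; elim: n mu nu phi mphi F => [|n IH] mu nu phi mphi F nuE bF.
  rewrite !mean_tensor0//.
    by congr F; apply: eq_from_tnth => -[].
  apply: (bm_comp _ bF); apply: measurable_mktuple => i.
  by case: i.
have mm : measurable_fun setT (fun x : n.+1.-tuple T1 => [tuple phi i (tnth x i) | i < n.+1]).
  apply: measurable_mktuple => i.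
  apply: measurableT_comp => //; exact: measurable_tnth.
rewrite mean_tensorS// mean_tensorS; last exact: (bm_comp mm bF).
rewrite nuE; last exact: bm_mean_tcons.
apply: eq_mean => a.
rewrite (IH (fun i => mu (lift ord0 i)) _ (fun i => phi (lift ord0 i)))//; last 2 first.
- by move=> i; exact: nuE.
- exact: bm_tcons.
apply: eq_mean => x; congr F; apply: eq_from_tnth => i; rewrite [RHS]tnth_mktuple.
case: (unliftP ord0 i) => [k|] ->; last by [].
by rewrite /tcons/= !tnthS tnth_mktuple.
Qed.

(** * The dual functional of entropic optimal transport *)

Section DualFunctional.
Context {disp : measure_display} {T : measurableType disp} {R : realType}.
Context {m : nat}.
Variables (eps : R) (c : m.-tuple T -> R).
Hypotheses (eps0 : 0 < eps) (bc : bm c).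
Implicit Types (mu : 'I_m -> probability T R) (f : 'I_m -> T -> R).

Definition oplus f (x : m.-tuple T) : R := \sum_(j < m) f j (tnth x j).

(** The density, with respect to the product of the marginals, of the measure
    associated with the potentials [f]. *)
Definition gibbs f (x : m.-tuple T) : R := expR ((oplus f x - c x) / eps).

Definition excess f (x : m.-tuple T) : R := gibbs f x - 1.

Definition dual mu f : R :=
  \sum_(j < m) mean (mu j) (f j) - eps * mean (tensor mu) (excess f).

(** The Schrodinger system, tested against bounded functions: [gibbs f] is the
    density of a coupling of [mu]. *)
Definition schrodinger mu f : Prop := forall j h, bm h ->
  mean (tensor mu) (fun x => h (tnth x j) * gibbs f x) = mean (mu j) h.

(** The squared norm in [L^2 (mu j)] of the failure of [gibbs f] to have [mu j]
    as its marginal, that is, of the gradient of the dual functional. *)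
Definition defect mu f (j : 'I_m) : R :=
  mean (mu j) (fun a => marginal mu (excess f) j a ^+ 2).

Lemma bm_oplus f : (forall j, bm (f j)) -> bm (oplus f).
Proof. by move=> bf; apply: bm_sum => j _; exact: bm_tnth. Qed.

Lemma bm_gibbs f : (forall j, bm (f j)) -> bm (gibbs f).
Proof.
move=> bf; apply: bm_expR; apply: bmM; last exact: bm_cst.
by apply: bmB => //; exact: bm_oplus.
Qed.

Lemma bm_excess f : (forall j, bm (f j)) -> bm (excess f).
Proof. by move=> bf; apply: bmB; [exact: bm_gibbs|exact: bm_cst]. Qed.

Lemma gibbs_gt0 f x : 0 < gibbs f x. Proof. exact: expR_gt0. Qed.

Lemma gibbs_ge f : (forall j, bm (f j)) -> exists2 l, 0 < l & forall x, l <= gibbs f x.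
Proof.
move=> bf.
have [B B0 fB] := bm_bound (bmM (bmB (bm_oplus bf) bc) (bm_cst eps^-1)).
exists (expR (- B)); first exact: expR_gt0.
by move=> x; rewrite ler_expR; have := fB x; rewrite ler_norml => /andP[].
Qed.

Lemma mean_oplus mu f : (forall j, bm (f j)) ->
  mean (tensor mu) (oplus f) = \sum_(j < m) mean (mu j) (f j).
Proof.
move=> bf; rewrite mean_sum; last by move=> j _; exact: bm_tnth.
by apply: eq_bigr => j _; rewrite mean_tnth.
Qed.

Lemma mean_oplusM mu f F : (forall j, bm (f j)) -> bm F ->
  mean (tensor mu) (fun x => oplus f x * F x) =
  \sum_(j < m) mean (mu j) (fun a => f j a * marginal mu F j a).
Proof.
move=> bf bF; under eq_mean do rewrite mulr_suml.
rewrite mean_sum; last by move=> j _; apply: bmM => //; exact: bm_tnth.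
by apply: eq_bigr => j _; rewrite mean_tnthM.
Qed.

(** Functions of distinct coordinates are uncorrelated. *)
Lemma mean_oplus_sqr mu f : (forall j, bm (f j)) ->
  mean (tensor mu) (fun x => oplus f x ^+ 2) =
  \sum_(j < m) mean (mu j) (fun a => (f j a - mean (mu j) (f j)) ^+ 2) +
  (\sum_(j < m) mean (mu j) (f j)) ^+ 2.
Proof.
move=> bf.
pose g j a := f j a - mean (mu j) (f j).
have bg j : bm (g j) by apply: bmB => //; exact: bm_cst.
have g0 j : mean (mu j) (g j) = 0.
  by rewrite meanB//; [rewrite mean_cst subrr|exact: bm_cst].
pose s := \sum_(j < m) mean (mu j) (f j).
have oE x : oplus f x = oplus g x + s.
  by rewrite /oplus /s -big_split/=; apply: eq_bigr => j _; rewrite subrK.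
have bo := bm_oplus bg.
rewrite (@eq_mean _ _ _ _ _ (fun x => oplus g x * oplus g x + (2 * s) * oplus g x + s ^+ 2)); last first.
  by move=> x; rewrite oE; ring.
have bs := bmM (bm_cst (2 * s)) bo.
rewrite meanD; [|by apply: bmD => //; exact: bmM|exact: bm_cst].
rewrite meanD//; last exact: bmM.
rewrite meanZ// mean_oplus// big1 ?mulr0 ?addr0//; congr (_ + _); last first.
  by rewrite mean_cst.
rewrite mean_oplusM//; apply: eq_bigr => j _; apply: eq_mean => a.
rewrite expr2; congr (_ * _).
rewrite /marginal /oplus (@eq_mean _ _ _ _ _ (fun x => g j a +
  \sum_(i < m | i != j) g i (tnth x i))); last first.
  move=> x; rewrite (bigD1 j)//= tnth_tset eqxx; congr (_ + _).
  by apply: eq_bigr => i /negbTE ij; rewrite tnth_tset ij.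
have bgi : forall i, i != j -> bm (fun x : m.-tuple T => g i (tnth x i)).
  by move=> i _; exact: bm_tnth.
rewrite meanD; [|exact: bm_cst|exact: bm_sum].
rewrite mean_cst mean_sum// big1 ?addr0// => i _; by rewrite mean_tnth.
Qed.

Lemma marginal_excess mu f j a : (forall j, bm (f j)) ->
  marginal mu (excess f) j a = marginal mu (gibbs f) j a - 1.
Proof.
move=> bf; rewrite /marginal meanB ?mean_cst//; last exact: bm_cst.
by apply: bm_tset; exact: bm_gibbs.
Qed.

Lemma mean_gibbs mu f : (forall j, bm (f j)) ->
  mean (tensor mu) (gibbs f) = 1 + mean (tensor mu) (excess f).
Proof.
move=> bf; rewrite meanB ?mean_cst; [by rewrite addrC subrK|exact: bm_gibbs|exact: bm_cst].
Qed.

Lemma schrodinger_mean mu f (j : 'I_m) : (forall j, bm (f j)) -> schrodinger mu f ->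
  mean (tensor mu) (gibbs f) = 1.
Proof.
move=> bf ex; have := ex j (fun=> 1) (bm_cst 1); rewrite mean_cst => <-.
by apply: eq_mean => x; rewrite mul1r.
Qed.

Lemma schrodinger_oplus mu f g : (forall j, bm (f j)) -> (forall j, bm (g j)) ->
  schrodinger mu f ->
  mean (tensor mu) (fun x => oplus g x * gibbs f x) = \sum_(j < m) mean (mu j) (g j).
Proof.
move=> bf bg ex; under eq_mean do rewrite mulr_suml.
rewrite mean_sum; last by move=> j _; apply: bmM; [exact: bm_tnth|exact: bm_gibbs].
by apply: eq_bigr => j _; rewrite ex.
Qed.

Lemma gibbs_shift f g x :
  gibbs g x = gibbs f x * expR ((oplus g x - oplus f x) / eps).
Proof.
rewrite /gibbs -expRD -mulrDl; move: (oplus f x) (oplus g x) (c x) => u v w.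
by have -> : u - w + (v - u) = v - w by ring.
Qed.

Lemma dual_shift mu f (s : 'I_m -> R) : (forall j, bm (f j)) ->
  \sum_(j < m) s j = 0 -> dual mu (fun j a => f j a + s j) = dual mu f.
Proof.
move=> bf s0; rewrite /dual; congr (_ - eps * _).
  rewrite (eq_bigr (fun j => mean (mu j) (f j) + s j)); last first.
    by move=> j _; rewrite meanD ?mean_cst//; exact: bm_cst.
  by rewrite big_split/= s0 addr0.
by apply: eq_mean => x; rewrite /excess /gibbs /oplus big_split/= s0 addr0.
Qed.

(** The dual functional is concave and the Schrodinger system is its first-order
    condition. *)
Lemma dual_le mu f g : (0 < m)%N -> (forall j, bm (f j)) -> (forall j, bm (g j)) ->
  schrodinger mu g -> dual mu f <= \sum_(j < m) mean (mu j) (g j).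
Proof.
move=> m0 bf bg ex; pose j0 := Ordinal m0.
have bG := bm_gibbs bg; have bof := bm_oplus bf; have bog := bm_oplus bg.
have ineq : mean (tensor mu) (fun x => gibbs g x +
    eps^-1 * (oplus f x * gibbs g x - oplus g x * gibbs g x)) <= mean (tensor mu) (gibbs f).
  apply: le_mean; last 1 first.
  - move=> x; rewrite (gibbs_shift g f).
    have -> : gibbs g x + eps^-1 * (oplus f x * gibbs g x - oplus g x * gibbs g x) =
      gibbs g x * (1 + (oplus f x - oplus g x) / eps) by ring.
    by rewrite ler_pM2l ?gibbs_gt0// expR_ge1Dx.
  - by apply: bmD => //; apply: bmM; [exact: bm_cst|apply: bmB; exact: bmM].
  - exact: bm_gibbs.
move: ineq; rewrite meanD//; last by apply: bmM; [exact: bm_cst|apply: bmB; exact: bmM].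
rewrite meanZ; last by apply: bmB; exact: bmM.
rewrite meanB; [|exact: bmM|exact: bmM].
rewrite !schrodinger_oplus// (schrodinger_mean j0)// mean_gibbs// lerD2l /dual.
by rewrite ler_pdivrMl// => h; lra.
Qed.

(** Strong convexity of the exponential on bounded intervals, from
    [exp s - 1 - s >= (exp (s / 2) - 1)^2]. *)
Lemma expR_quadratic (L s : R) : `|s| <= L -> expR (- L) / 4 * s ^+ 2 <= expR s - 1 - s.
Proof.
move=> sL; have [y sE] : exists y, s = y + y by exists (s / 2); rewrite -splitr.
have h1 : 1 + y <= expR y by exact: expR_ge1Dx.
have L0 : 0 <= L by exact: le_trans sL.
have h2 : expR (- L) * y ^+ 2 <= (expR y - 1) ^+ 2.
  have eL1 : expR (- L) <= 1 by rewrite -expR0 ler_expR oppr_le0.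
  have [y0|y0] := leP 0 y.
    rewrite (@le_trans _ _ (y ^+ 2))//; first by rewrite ler_piMl// sqr_ge0.
    by rewrite ler_sqr ?nnegrE//; lra.
  have yL : expR (- L) <= expR (y + y).
    by rewrite ler_expR -sE; move: sL; rewrite ler_norml => /andP[].
  apply: (@le_trans _ _ (expR (y + y) * y ^+ 2)); first by rewrite ler_wpM2r ?sqr_ge0.
  have h3 : 1 - y <= expR (- y) by exact: expR_ge1Dx.
  have -> : expR y - 1 = - (expR y * (expR (- y) - 1)).
    by rewrite mulrBr -expRD subrr expR0 mulr1 opprB.
  have -> : expR (y + y) = expR y ^+ 2 by rewrite expRD.
  rewrite sqrrN exprMn; apply: ler_wpM2l; first exact: sqr_ge0.
  by rewrite -sqrrN ler_sqr ?nnegrE; lra.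
have -> : s ^+ 2 = 4 * y ^+ 2 by rewrite sE; ring.
rewrite mulrA mulfVK//; apply: (le_trans h2).
by rewrite sE expRD; nra.
Qed.

(** Strong concavity of the dual functional: on potentials whose sums differ
    from the optimal ones by at most [L], the optimality gap is controlled by
    the square of the gradient. *)
Lemma dual_gap mu f g L p : (0 < m)%N -> (forall j, bm (f j)) -> (forall j, bm (g j)) ->
  schrodinger mu g -> (forall x, `|oplus g x - oplus f x| <= L) ->
  0 < p -> (forall x, p <= gibbs f x) ->
  \sum_(j < m) mean (mu j) (g j) - dual mu f <=
  eps * expR (L / eps) / p *
    (\sum_(j < m) defect mu f j + mean (tensor mu) (excess f) ^+ 2).
Proof.
move=> m0 bf bg ex HL p0 pf; pose j0 := Ordinal m0.
pose h j a := g j a - f j a.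
have bh j : bm (h j) by exact: bmB.
have hE x : oplus h x = oplus g x - oplus f x by rewrite /oplus /h sumrB.
have bH := bm_oplus bh; have bz := bm_excess bf; have bp := bm_gibbs bf.
(* [a] is the modulus of convexity of [eps * gibbs] along [h] *)
pose a := p * expR (- (L / eps)) / (4 * eps).
have a0 : 0 < a by rewrite divr_gt0 ?mulr_gt0 ?expR_gt0.
have point x : oplus h x * excess f x + oplus h x + a * oplus h x ^+ 2 + eps * gibbs f x
    <= eps * gibbs g x.
  rewrite (gibbs_shift f g) -hE.
  have := @expR_quadratic (L / eps) (oplus h x / eps).
  rewrite normrM (gtr0_norm (x := eps^-1)) ?invr_gt0// ler_pM2r ?invr_gt0//.
  rewrite hE => /(_ (HL x)); rewrite -hE => q.
  have -> : oplus h x * excess f x + oplus h x = oplus h x * gibbs f x.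
    by rewrite /excess; ring.
  suff : a * oplus h x ^+ 2 <= eps * gibbs f x * (expR (oplus h x / eps) - 1 - oplus h x / eps).
    have -> : eps * gibbs f x * (expR (oplus h x / eps) - 1 - oplus h x / eps) =
      eps * (gibbs f x * expR (oplus h x / eps)) - eps * gibbs f x - oplus h x * gibbs f x.
      by field; rewrite gt_eqF.
    by move=> ?; lra.
  apply: (@le_trans _ _ (eps * p * (expR (- (L / eps)) / 4 * (oplus h x / eps) ^+ 2))).
    apply: le_of_eq; rewrite /a.
    by field; rewrite gt_eqF.
  apply: ler_pM => //.
  - by rewrite mulr_ge0// ltW.
  - by rewrite mulr_ge0 ?sqr_ge0// divr_ge0 ?expR_ge0.
  - by rewrite ler_pM2l.
have hm : \sum_(j < m) mean (mu j) (h j) =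
    \sum_(j < m) mean (mu j) (g j) - \sum_(j < m) mean (mu j) (f j).
  by rewrite -sumrB; apply: eq_bigr => j _; rewrite meanB.
have b1 := bmM bH bz; have b2 := bmM (bm_cst a) (bmX 2 bH).
have b3 := bmM (bm_cst eps) bp.
have := le_mean (tensor mu) (bmD (bmD (bmD b1 bH) b2) b3) (bmM (bm_cst eps) (bm_gibbs bg)) point.
rewrite meanD//; last by apply: bmD => //; exact: bmD.
rewrite meanD//; last exact: bmD.
rewrite meanD// !meanZ//; [|exact: bm_gibbs|exact: bmX].
rewrite (schrodinger_mean j0 bg ex) mean_gibbs// mean_oplus// mean_oplusM//.
rewrite mean_oplus_sqr//.
pose b j := mean (mu j) (h j); pose w := mean (tensor mu) (excess f).
rewrite -/w -[\sum_(j < m) mean (mu j) (h j)]/(\sum_(j < m) b j).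
have -> : \sum_(j < m) mean (mu j) (fun t => h j t * marginal mu (excess f) j t) =
  \sum_(j < m) mean (mu j) (fun t => (h j t - b j) * marginal mu (excess f) j t) +
  (\sum_(j < m) b j) * w.
  rewrite mulr_suml -big_split/=; apply: eq_bigr => j _.
  have bm1 := bm_marginal mu j bz.
  rewrite {1}/w (mean_marginal _ j)// -meanZ// -meanD; last 2 first.
  - by apply: bmM => //; apply: bmB => //; exact: bm_cst.
  - by apply: bmM => //; exact: bm_cst.
  by apply: eq_mean => t; ring.
rewrite /dual -/w mulrDr mulr_sumr => main.
(* complete the square in each coordinate, and once more for the means *)
have square (u v : R) : - ((4 * a)^-1 * v ^+ 2) <= u * v + a * u ^+ 2.
  rewrite -subr_ge0 opprK.
  have -> : u * v + a * u ^+ 2 + (4 * a)^-1 * v ^+ 2 = (4 * a)^-1 * (2 * a * u + v) ^+ 2.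
    by field; rewrite gt_eqF.
  by rewrite mulr_ge0 ?sqr_ge0// invr_ge0 mulr_ge0// ltW.
have hj j : - ((4 * a)^-1 * defect mu f j) <=
    mean (mu j) (fun t => (h j t - b j) * marginal mu (excess f) j t) +
    a * mean (mu j) (fun t => (h j t - b j) ^+ 2).
  have bm1 := bm_marginal mu j bz.
  have bhb : bm (fun t => h j t - b j) by apply: bmB => //; exact: bm_cst.
  have -> : - ((4 * a)^-1 * defect mu f j) =
      mean (mu j) (fun t => - ((4 * a)^-1 * marginal mu (excess f) j t ^+ 2)).
    by rewrite meanN ?meanZ//; [exact: bmX|apply: bmM; [exact: bm_cst|exact: bmX]].
  rewrite -(meanZ _ _ (bmX 2 bhb)).
  rewrite -meanD; [|exact: bmM|by apply: bmM; [exact: bm_cst|exact: bmX]].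
  apply: le_mean => [||t]; last exact: square.
  - by apply: bmN; apply: bmM; [exact: bm_cst|exact: bmX].
  - by apply: bmD; [exact: bmM|by apply: bmM; [exact: bm_cst|exact: bmX]].
have hw := square (\sum_(j < m) b j) w.
have hs : - ((4 * a)^-1 * \sum_(j < m) defect mu f j) <=
    \sum_(j < m) mean (mu j) (fun t => (h j t - b j) * marginal mu (excess f) j t) +
    \sum_(j < m) a * mean (mu j) (fun t => (h j t - b j) ^+ 2).
  by rewrite mulr_sumr -sumrN -big_split/=; apply: ler_sum => j _; exact: hj.
have aE : eps * expR (L / eps) / p = (4 * a)^-1.
  rewrite /a expRN; have := expR_gt0 (L / eps) => e0.
  by field; rewrite !gt_eqF.
rewrite aE mulrDr.
have hm' : \sum_(j < m) b j =
    \sum_(j < m) mean (mu j) (g j) - \sum_(j < m) mean (mu j) (f j) by rewrite -hm.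
move: main hs hw; rewrite {2}hm' => *; lra.
Qed.

(** The exact maximization of the dual functional in its [j]-th potential. *)
Definition update mu f (j i : 'I_m) (a : T) : R :=
  if i == j then f i a - eps * ln (marginal mu (gibbs f) j a) else f i a.

Lemma marginal_ge mu f j : (forall i, bm (f i)) ->
  exists2 l, 0 < l & forall a, l <= marginal mu (gibbs f) j a.
Proof.
move=> bf; have [l l0 lf] := gibbs_ge bf; exists l => // a.
by apply: mean_ge => //; apply: bm_tset; exact: bm_gibbs.
Qed.

Lemma bm_ln_marginal mu f j : (forall i, bm (f i)) ->
  bm (fun a => ln (marginal mu (gibbs f) j a)).
Proof.
move=> bf; have [l l0 lf] := marginal_ge mu j bf.
by apply: bm_ln l0 lf _; apply: bm_marginal; exact: bm_gibbs.
Qed.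

Lemma bm_update mu f j : (forall i, bm (f i)) -> forall i, bm (update mu f j i).
Proof.
move=> bf i; rewrite /update; case: (i == j) => //.
by apply: bmB => //; apply: bmM; [exact: bm_cst|exact: bm_ln_marginal].
Qed.

Lemma gibbs_update mu f j x : (forall i, bm (f i)) ->
  gibbs (update mu f j) x = (marginal mu (gibbs f) j (tnth x j))^-1 * gibbs f x.
Proof.
move=> bf; have [l l0 lf] := marginal_ge mu j bf.
rewrite (gibbs_shift f) [RHS]mulrC; congr (_ * _).
have -> : oplus (update mu f j) x - oplus f x = - eps * ln (marginal mu (gibbs f) j (tnth x j)).
  rewrite /oplus (bigD1 j)//= [X in _ - X](bigD1 j)//= /update eqxx.
  rewrite (eq_bigr (fun i => f i (tnth x i))); last by move=> i /negbTE ->.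
  by ring.
rewrite mulNr mulrC mulrN mulKf ?gt_eqF// expRN lnK// posrE.
exact: lt_le_trans (lf _).
Qed.

Lemma dual_update mu f j : (forall i, bm (f i)) ->
  dual mu (update mu f j) = dual mu f + eps * mean (mu j) (fun a =>
    marginal mu (gibbs f) j a - 1 - ln (marginal mu (gibbs f) j a)).
Proof.
move=> bf; have [l l0 lf] := marginal_ge mu j bf.
have bG := bm_gibbs bf; have bu := bm_marginal mu j bG; have bl := bm_ln_marginal mu j bf.
have g1 : mean (tensor mu) (gibbs (update mu f j)) = 1.
  rewrite (eq_mean _ (fun x => gibbs_update mu j x bf)).
  rewrite (@mean_tnthM _ _ _ _ mu j (fun a => (marginal mu (gibbs f) j a)^-1))//; last first.
    exact: (bm_inv l0).
  rewrite -[RHS](mean_cst (mu j)); apply: eq_mean => a.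
  by rewrite mulVf// gt_eqF// (lt_le_trans l0).
have bu' := bm_update mu j bf.
have := mean_gibbs mu bu'; rewrite g1 => e1.
have e3 : mean (tensor mu) (excess (update mu f j)) = 0 by lra.
have := mean_gibbs mu bf; rewrite (mean_marginal _ j)// => e2.
rewrite meanB//; last by apply: bmB => //; exact: bm_cst.
rewrite meanB// ?mean_cst; last exact: bm_cst.
rewrite /dual e3 e2 (bigD1 j)//= [in RHS](bigD1 j)//= {1}/update eqxx.
rewrite (eq_bigr (fun i => mean (mu i) (f i))); last first.
  by move=> i /negbTE ij; apply: eq_mean => a; rewrite /update ij.
rewrite (meanB _ (bf j)); last by apply: bmM => //; exact: bm_cst.
by rewrite meanZ//; ring.
Qed.

(** Turns the gain of an update into a squared distance. *)
Lemma ln_sqrt_gain (u : R) : 0 < u -> (Num.sqrt u - 1) ^+ 2 <= u - 1 - ln u.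
Proof.
move=> u0; have s0 : 0 < Num.sqrt u by rewrite sqrtr_gt0.
have -> : ln u = 2 * ln (Num.sqrt u).
  by rewrite -{1}(sqr_sqrtr (ltW u0)) lnXn// mulr_natl.
have : ln (Num.sqrt u) <= Num.sqrt u - 1 by rewrite -[X in ln X](subrK 1) addrC le_ln1Dx//; lra.
have := sqr_sqrtr (ltW u0); move: (Num.sqrt u) => s <- h; nra.
Qed.

(** The gain of an update is the mean of [u - 1 - ln u], where [u] is the current
    [j]-th marginal density, and it controls the mean of [(u - 1)^2]. *)
Lemma defect_eq0 mu f j : (forall i, bm (f i)) ->
  dual mu (update mu f j) <= dual mu f -> defect mu f j = 0.
Proof.
move=> bf; rewrite dual_update// gerDl pmulr_rle0// => gain.
have [l l0 lf] := marginal_ge mu j bf.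
have bG := bm_gibbs bf; have bu := bm_marginal mu j bG; have bl := bm_ln_marginal mu j bf.
have [B B0 uB] := bm_bound bu.
apply/eqP; rewrite eq_le; apply/andP; split; last by apply: mean_ge0 => a; exact: sqr_ge0.
have bg : bm (fun a => marginal mu (gibbs f) j a - 1 - ln (marginal mu (gibbs f) j a)).
  by apply: bmB => //; apply: bmB => //; exact: bm_cst.
(* (u - 1)^2 <= (sqrt B + 1)^2 (sqrt u - 1)^2 when 0 < u <= B *)
apply: (@le_trans _ _ (mean (mu j) (fun a => (Num.sqrt B + 1) ^+ 2 *
   (marginal mu (gibbs f) j a - 1 - ln (marginal mu (gibbs f) j a))))); last first.
  by rewrite meanZ// mulr_ge0_le0// sqr_ge0.
apply: le_mean.
- by apply: bmX; apply: bm_marginal; exact: bm_excess.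
- by apply: bmM => //; exact: bm_cst.
move=> a; rewrite marginal_excess//; move: (lf a) (uB a).
move: (marginal mu (gibbs f) j a) => u lu uB'.
have u0 : 0 < u by exact: lt_le_trans lu.
apply: (@le_trans _ _ ((Num.sqrt B + 1) ^+ 2 * (Num.sqrt u - 1) ^+ 2)).
  rewrite -{1}(sqr_sqrtr (ltW u0)) subr_sqr_1 exprMn mulrC.
  rewrite ler_wpM2r ?sqr_ge0// ler_sqr ?nnegrE ?addr_ge0 ?sqrtr_ge0//.
  by rewrite lerD2r ler_wsqrtr// (le_trans (ler_norm _)).
by rewrite ler_wpM2l ?sqr_ge0// ln_sqrt_gain.
Qed.

(** A function with vanishing second moment integrates to 0 against bounded
    functions. *)
Lemma schrodinger_defect mu f : (forall i, bm (f i)) ->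
  (forall j, defect mu f j = 0) -> schrodinger mu f.
Proof.
move=> bf d0 j h bh.
have bG := bm_gibbs bf; have bE := bm_excess bf.
have bg := bm_marginal mu j bE.
rewrite mean_tnthM//.
have -> : mean (mu j) (fun a => h a * marginal mu (gibbs f) j a) =
    mean (mu j) h + mean (mu j) (fun a => h a * marginal mu (excess f) j a).
  rewrite -meanD//; last exact: bmM.
  by apply: eq_mean => a; rewrite marginal_excess//; ring.
suff -> : mean (mu j) (fun a => h a * marginal mu (excess f) j a) = 0 by rewrite addr0.
have [B B0 hB] := bm_bound bh.
(* the inequality B q <= e B^2 + q^2 / e, with e arbitrarily small *)
have small e : 0 < e -> `|mean (mu j) (fun a => h a * marginal mu (excess f) j a)| <= e * B ^+ 2.
  move=> e0; apply: (le_trans (mean_norm _ (bmM bh bg))).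
  apply: (@le_trans _ _ (mean (mu j) (fun a => e * B ^+ 2 + e^-1 * marginal mu (excess f) j a ^+ 2))).
    apply: le_mean.
    - exact: (bm_norm (bmM bh bg)).
    - by apply: bmD; [exact: bm_cst|apply: bmM; [exact: bm_cst|exact: bmX]].
    move=> a; rewrite normrM; set v := marginal _ _ _ _.
    apply: (@le_trans _ _ (B * `|v|)); first by rewrite ler_wpM2r.
    rewrite -(real_normK (num_real v)); set q := `|v|.
    rewrite -subr_ge0.
    have -> : e * B ^+ 2 + e^-1 * q ^+ 2 - B * q =
        e^-1 * ((e * B - q / 2) ^+ 2 + 3 / 4 * q ^+ 2).
      by field; rewrite gt_eqF.
    by rewrite mulr_ge0 ?invr_ge0 ?(ltW e0)// addr_ge0 ?sqr_ge0// mulr_ge0 ?sqr_ge0.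
  rewrite meanD; [|exact: bm_cst|by apply: bmM; [exact: bm_cst|exact: bmX]].
  rewrite mean_cst meanZ; last exact: bmX.
  by rewrite (_ : mean _ _ = 0) ?mulr0 ?addr0//; exact: d0.
apply/eqP; rewrite -normr_eq0 eq_le normr_ge0 andbT leNgt; apply/negP.
set v := `|_| => v0.
have := small (v / (2 * B ^+ 2)); rewrite divr_gt0 ?mulr_gt0 ?exprn_gt0// => /(_ isT).
rewrite -/v (_ : v / (2 * B ^+ 2) * B ^+ 2 = v / 2); first by lra.
by field; rewrite gt_eqF.
Qed.

End DualFunctional.

(** * Duality for the regularized transport cost *)

Section Density.
Context {d : measure_display} {T : measurableType d} {R : realType}.
Variables (Q : probability T R) (p : T -> R).

Definition is_density : Prop := [/\ bm p, forall x, 0 <= p x & mean Q p = 1].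

Hypothesis hp : is_density.

Definition with_density (h : is_density) (A : set T) : \bar R :=
  (\int[Q]_(x in A) (p x)%:E)%E.

Let density0 : with_density hp set0 = 0%E.
Proof. by rewrite /with_density integral_set0. Qed.

Let density_ge0 A : (0 <= with_density hp A)%E.
Proof. by have [_ p0 _] := hp; apply: integral_ge0 => x _; rewrite lee_fin. Qed.

Let density_sigma : semi_sigma_additive (with_density hp).
Proof.
have [bp p0 _] := hp; apply: semi_sigma_additive_nng_induced.
  by apply/measurable_EFinP; case: bp.
by move=> x; rewrite lee_fin.
Qed.

HB.instance Definition _ :=
  isMeasure.Build _ _ _ (with_density hp) density0 density_ge0 density_sigma.

Let densityT : with_density hp setT = 1%E.
Proof. by have [bp p0 p1] := hp; rewrite /with_density -EFin_mean// p1. Qed.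

HB.instance Definition _ :=
  Measure_isProbability.Build _ _ _ (with_density hp) densityT.

Lemma with_densityE A : measurable A ->
  with_density hp A = (mean Q (fun x => \1_A x * p x))%:E.
Proof.
move=> mA; have [bp p0 _] := hp; rewrite EFin_mean; last first.
  by apply: bmM => //; exact: bm_indic.
rewrite /with_density integral_mkcond; apply: eq_integral => x _.
by rewrite restrict_EFin/= patchE indicE; case: ifP => _; rewrite ?mul1r ?mul0r.
Qed.

Lemma with_density_dominates : with_density hp `<< Q.
Proof.
have [bp p0 _] := hp; apply/null_content_dominatesP => A mA QA.
apply: null_set_integral => //; apply/measurable_funTS/measurable_EFinP.
by case: bp.
Qed.

Lemma KL_with_density : (forall x, 0 < p x) ->
  KL (with_density hp) Q = (\int[with_density hp]_x (ln (p x))%:E)%E.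
Proof.
move=> pp; rewrite /KL; case: asboolP => [dom|]; last by move/(_ with_density_dominates).
have [bp p0 _] := hp.
have mp : measurable_fun setT p by case: bp.
set r := 'd _ '/d _.
have mr : measurable_fun setT r by apply: measurable_int; exact: Radon_Nikodym_integrable.
have rp : ae_eq Q setT r (EFin \o p).
  apply: integral_ae_eq => //.
  - exact: Radon_Nikodym_integrable.
  - exact/measurable_EFinP.
  - by move=> A _ mA; rewrite -Radon_Nikodym_integral.
apply: ae_eq_integral => //.
- apply/measurable_EFinP; apply: measurableT_comp => //.
  exact: measurableT_comp.
- by apply/measurable_EFinP; apply: measurableT_comp.
have := null_dominates_ae_eq measurableT dom rp.
by apply: filterS => x /= h _; rewrite h.
Qed.

End Density.

(** The Donsker-Varadhan inequality, from [ln r >= G + 1 - exp G / r]. *)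
Lemma KL_ge {d : measure_display} {T : measurableType d} {R : realType}
    (P Q : probability T R) (G : T -> R) : bm G ->
  ((mean P G + 1 - mean Q (fun x => expR (G x)))%:E <= KL P Q)%E.
Proof.
move=> bG; rewrite /KL; case: asboolP => [dom|_]; last by rewrite leey.
(* [r] is an everywhere finite version of the derivative [r'] that defines [KL] *)
pose r := Radon_Nikodym_SigmaFinite.f P Q.
have mr : measurable_fun setT r.
  by apply: measurable_int; exact: Radon_Nikodym_SigmaFinite.f_integrable.
set r' := 'd _ '/d _.
have mr' : measurable_fun setT r' by apply: measurable_int; exact: Radon_Nikodym_integrable.
have r0 x : (0 <= r x)%E by exact: Radon_Nikodym_SigmaFinite.f_ge0.
have rfin x : r x \is a fin_num by exact: Radon_Nikodym_SigmaFinite.f_fin_num.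
have rr' : ae_eq P setT r r'.
  apply: (null_dominates_ae_eq measurableT dom).
  exact: (ae_eq_Radon_Nikodym_SigmaFinite dom).
have mA : measurable [set x | (r x <= 0)%E].
  by rewrite -[X in measurable X]setTI; apply: emeasurable_fun_infty_c.
have rpos : {ae P, forall x, (0 < r x)%E}.
  exists [set x | (r x <= 0)%E]; split => //; last by move=> x /= /negP; rewrite -leNgt.
  rewrite (Radon_Nikodym_SigmaFinite.f_integral dom mA).
  rewrite -[RHS](@integral0 _ _ _ Q [set x | (r x <= 0)%E]).
  by apply: eq_integral => x; rewrite inE/= => rx; apply/eqP; rewrite eq_le rx r0.
have bE := bm_expR bG.
have mfr : measurable_fun setT (fun x => fine (r x)) by exact: measurableT_comp.
have fr0 x : 0 <= fine (r x) by rewrite fine_ge0.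
pose h x := expR (G x) * (fine (r x))^-1.
have h0 x : 0 <= h x by rewrite mulr_ge0 ?expR_ge0// invr_ge0.
have mV : measurable_fun setT (fun x => (fine (r x))^-1).
  have -> : (fun x => (fine (r x))^-1) = (fun x => fine (r x) `^ (-1)).
    by apply/funext => x; rewrite powR_inv1.
  exact: measurableT_comp (measurable_powR _) mfr.
have mh : measurable_fun setT h by apply: measurable_funM => //; case: bE.
have meh : measurable_fun setT (EFin \o h) by exact/measurable_EFinP.
have hle : (\int[P]_x (h x)%:E <= (mean Q (fun x => expR (G x)))%:E)%E.
  rewrite -(@Radon_Nikodym_SigmaFinite.change_of_variables _ _ _ P Q dom (EFin \o h) setT)//.
  rewrite EFin_mean//; apply: ge0_le_integral => //.
  - by move=> x _; rewrite mule_ge0// lee_fin.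
  - exact: emeasurable_funM.
  - by apply/measurable_EFinP; case: bE.
  move=> x _; rewrite -/(r x) -{1}(fineK (rfin x)) /= -EFinM lee_fin /h -mulrA.
  have [->|n0] := eqVneq (fine (r x)) 0; first by rewrite mulr0 mulr0 expR_ge0.
  by rewrite mulVf// mulr1.
have ih : P.-integrable setT (EFin \o h).
  apply/integrableP; split => //; apply: (@le_lt_trans _ _ (\int[P]_x (h x)%:E)%E).
    apply: le_of_eq; apply: eq_integral => x _ /=.
    by rewrite ger0_norm.
  by rewrite (le_lt_trans hle)// ltry.
pose u x := G x + 1 - h x.
have bG1 := bmD bG (bm_cst 1).
have iu : P.-integrable setT (EFin \o u).
  have := integrableB measurableT (bm_integrable P bG1) ih.
  by congr (_.-integrable _ _); apply/funext => x /=.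
apply: (@le_trans _ _ (\int[P]_x (u x)%:E)%E).
  rewrite [leRHS](_ : _ = \int[P]_x ((G x + 1)%:E - (h x)%:E))%E; last first.
    by apply: eq_integral => x _; rewrite -EFinB.
  rewrite integralB//; last exact: bm_integrable.
  rewrite -EFin_mean// meanD//; last exact: bm_cst.
  by rewrite mean_cst EFinB; apply: leeB.
have ml : measurable_fun setT (fun x => (ln (fine (r' x)))%:E).
  by apply/measurable_EFinP; apply: measurableT_comp => //; exact: measurableT_comp.
have mu : measurable_fun setT (EFin \o u) by exact: measurable_int iu.
have ul : {ae P, forall x, u x <= ln (fine (r' x))}.
  apply: filterS2 rr' rpos => x /= <-// rx.
  have fx : 0 < fine (r x) by rewrite fine_gt0// rx ltey_eq rfin.
  have : 1 + (G x - ln (fine (r x))) <= expR (G x - ln (fine (r x))) by exact: expR_ge1Dx.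
  rewrite expRB lnK ?posrE// /u /h; lra.
rewrite [leLHS]integralE [leRHS]integralE; apply: leeB.
- apply: ae_ge0_le_integral => //; [exact: measurable_funepos|exact: measurable_funepos|].
  apply: filterS ul => x /= h1 _; rewrite !funeposE.
  by rewrite ge_max !le_max !lee_fin h1 /= lexx orbT.
- apply: ae_ge0_le_integral => //; [exact: measurable_funeneg|exact: measurable_funeneg|].
  apply: filterS ul => x /= h1 _; rewrite !funenegE.
  by rewrite ge_max !le_max !lee_fin lerN2 h1 /= lexx orbT.
Qed.

Section Duality.
Context {R : realType} {m d : nat}.
Local Notation T := (borelV R d).
Variables (eps : R) (X : 'I_m -> set 'rV[R]_d) (c : 'M[R]_(m, d) -> R).
Implicit Types (mu : 'I_m -> probability T R) (f : 'I_m -> T -> R).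

(** The cost extended by zero outside the domain: the value of [S_eps] at
    measures that charge the complement of the domain depends on it. *)
Definition cost (x : m.-tuple T) : R :=
  ((fun x => c (stack x)) \_ (stack @^-1` prod_domain X)) x.

Hypotheses (m0 : (0 < m)%N) (eps0 : 0 < eps) (bc : bm cost).

Lemma coupling_mean mu (pi : probability (m.-tuple T) R) j h :
  couplings mu pi -> bm h -> mean pi (fun x => h (tnth x j)) = mean (mu j) h.
Proof.
move=> cpi bh.
pose Y : {mfun m.-tuple T >-> T} :=
  HB.pack (fun x : m.-tuple T => tnth x j) (isMeasurableFun.Build _ _ _ _ _ (measurable_tnth j)).
rewrite -(mean_pushforward pi Y bh); congr fine; apply: eq_measure_integral => A mA _.
exact: cpi.
Qed.

Lemma cost_integral (pi : probability (m.-tuple T) R) :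
  (\int[pi]_(x in stack @^-1` prod_domain X) (c (stack x))%:E)%E = (mean pi cost)%:E.
Proof.
by rewrite EFin_mean// integral_mkcond; apply: eq_integral => x _; rewrite restrict_EFin.
Qed.

(** Weak duality: [KL_ge] for the exponent of [gibbs]. *)
Lemma dual_le_primal mu f (pi : probability (m.-tuple T) R) :
  (forall j, bm (f j)) -> couplings mu pi ->
  ((dual eps cost mu f)%:E <= (mean pi cost)%:E + eps%:E * KL pi (tensor mu))%E.
Proof.
move=> bf cpi; have bo := bm_oplus bf.
pose G x := (oplus f x - cost x) / eps.
have bG : bm G by apply: bmM; [exact: bmB|exact: bm_cst].
have := KL_ge pi (tensor mu) bG.
have pE : mean pi (oplus f) = \sum_(j < m) mean (mu j) (f j).
  rewrite mean_sum; last by move=> j _; exact: bm_tnth.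
  by apply: eq_bigr => j _; apply: coupling_mean.
rewrite /G meanZr ?meanB ?pE//; last exact: bmB.
rewrite -/(gibbs eps cost f) => H.
apply: (@le_trans _ _ ((mean pi cost)%:E + eps%:E *
  ((\sum_(j < m) mean (mu j) (f j) - mean pi cost) / eps + 1 -
   mean (tensor mu) (gibbs eps cost f))%:E)%E); last first.
  by apply: leeD => //; apply: lee_wpmul2l => //; rewrite lee_fin ltW.
rewrite -EFinM -EFinD lee_fin /dual.
have := mean_gibbs eps bc mu bf => ->.
by apply: le_of_eq; field; rewrite gt_eqF.
Qed.

(** Strong duality: weak duality is an equality for the coupling of density
    [gibbs]. *)
Lemma S_eps_schrodinger mu f : (forall j, bm (f j)) ->
  schrodinger eps cost mu f ->
  S_eps eps X c mu = (\sum_(j < m) mean (mu j) (f j))%:E.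
Proof.
move=> bf ex; pose j0 := Ordinal m0.
have bg : bm (gibbs eps cost f) by exact: bm_gibbs.
have hp : is_density (tensor mu) (gibbs eps cost f).
  by split=> //; [move=> x; exact: ltW (gibbs_gt0 _ _ _ _)|exact: (schrodinger_mean j0)].
pose pi : probability (m.-tuple T) R := with_density hp.
have cpi : couplings mu pi.
  move=> j A mA.
  have mA' : measurable [set x : m.-tuple T | A (tnth x j)].
    by rewrite -[X in measurable X]setTI; exact: measurable_tnth.
  rewrite [LHS](with_densityE hp mA').
  have := ex j \1_A (bm_indic mA); rewrite mean_indic// => e.
  rewrite -[RHS]fineK; last by rewrite fin_num_measure.
  by rewrite -e; congr EFin; apply: eq_mean => x; rewrite !indicE; congr (_%:R * _).
have dE : dual eps cost mu f = \sum_(j < m) mean (mu j) (f j).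
  have := mean_gibbs eps bc mu bf; rewrite (schrodinger_mean j0)// => e.
  rewrite /dual (_ : mean _ _ = 0) ?mulr0 ?subr0//; lra.
apply/eqP; rewrite eq_le; apply/andP; split; last first.
  apply: le_ereal_inf_tmp => _ [q cq <-].
  by rewrite cost_integral -dE; exact: dual_le_primal.
apply: ereal_inf_lbound; exists pi => //.
rewrite cost_integral KL_with_density; last by move=> x; exact: gibbs_gt0.
have bo := bm_oplus bf.
rewrite (_ : (fun x => (ln (gibbs eps cost f x))%:E) = fun x => ((oplus f x - cost x) / eps)%:E); last first.
  by apply/funext => x; rewrite expRK.
rewrite -EFin_mean; last by apply: bmM; [exact: bmB|exact: bm_cst].
rewrite -EFinM -EFinD; congr EFin; rewrite meanZr; last exact: bmB.
rewrite meanB// mean_sum; last by move=> j _; exact: bm_tnth.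
rewrite (eq_bigr (fun j => mean (mu j) (f j))); last first.
  by move=> j _; exact: (coupling_mean j cpi (bf j)).
by field; rewrite gt_eqF.
Qed.

End Duality.

(** * Potentials of empirical measures *)

Section Softmin.
Context {disp : measure_display} {T : measurableType disp} {R : realType}.
Variables (eps : R) (Q : probability T R).
Hypothesis eps0 : 0 < eps.
Implicit Types F G : T -> R.

Definition softmin F : R := - (eps * ln (mean Q (fun x => expR (F x / eps)))).

Let bmE F : bm F -> bm (fun x => expR (F x / eps)).
Proof. by move=> bF; apply: bm_expR; apply: bmM => //; exact: bm_cst. Qed.

Lemma mean_expR_gt0 F : bm F -> 0 < mean Q (fun x => expR (F x / eps)).
Proof.
move=> bF; have [B B0 FB] := bm_bound bF.
apply: (@lt_le_trans _ _ (expR (- B / eps))); first exact: expR_gt0.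
apply: mean_ge; first exact: bmE.
move=> x; rewrite ler_expR ler_pM2r ?invr_gt0//.
by have := FB x; rewrite ler_norml => /andP[].
Qed.

Lemma le_softmin F G k : bm F -> bm G -> (forall x, F x <= G x + k) ->
  softmin G <= softmin F + k.
Proof.
move=> bF bG FG.
have h : mean Q (fun x => expR (F x / eps)) <=
    expR (k / eps) * mean Q (fun x => expR (G x / eps)).
  rewrite -meanZ; last exact: bmE.
  apply: le_mean; first exact: bmE.
    by apply: bmM; [exact: bm_cst|exact: bmE].
  move=> x; rewrite -expRD ler_expR -mulrDl ler_pM2r ?invr_gt0// addrC.
  exact: FG.
have := h; rewrite -ler_ln ?posrE ?mulr_gt0 ?expR_gt0 ?mean_expR_gt0//.
rewrite lnM ?posrE ?expR_gt0 ?mean_expR_gt0// expRK /softmin.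
move: (ln _) (ln _) => u v uv.
have := ler_wpM2l (ltW eps0) uv; have e : eps * (k / eps) = k by rewrite mulrC divfK// gt_eqF.
by clear h FG uv; rewrite mulrDr e => uv; lra.
Qed.

Lemma softmin_norm F B : bm F -> (forall x, `|F x| <= B) -> `|softmin F| <= B.
Proof.
move=> bF FB.
have s0 : softmin (fun=> 0) = 0.
  by rewrite /softmin mul0r expR0 mean_cst ln1 mulr0 oppr0.
rewrite ler_norml; apply/andP; split.
  rewrite lerNl -sub0r -s0 lerBlDr addrC; apply: le_softmin => //; first exact: bm_cst.
  by move=> x; rewrite add0r (le_trans (ler_norm _)).
rewrite -[B]add0r -s0; apply: le_softmin => //; first exact: bm_cst.
by move=> x; have := FB x; rewrite ler_norml => /andP[]; lra.
Qed.

End Softmin.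

Section Update.
Context {disp : measure_display} {T : measurableType disp} {R : realType}.
Context {m : nat}.
Variables (eps : R) (c : m.-tuple T -> R).
Hypotheses (eps0 : 0 < eps) (bc : bm c).
Implicit Types (mu : 'I_m -> probability T R) (f : 'I_m -> T -> R).

Definition rest f (j : 'I_m) (a : T) (x : m.-tuple T) : R :=
  \sum_(k < m | k != j) f k (tnth x k) - c (tset x j a).

Lemma bm_rest f j a : (forall k, k != j -> bm (f k)) -> bm (rest f j a).
Proof.
move=> bf; apply: bmB; last exact: bm_tset.
by apply: bm_sum => k kj; apply: bm_tnth; exact: bf.
Qed.

Lemma oplus_tset f (x : m.-tuple T) j a :
  oplus f (tset x j a) = f j a + \sum_(k < m | k != j) f k (tnth x k).
Proof.
rewrite /oplus (bigD1 j)//= tnth_tset eqxx; congr (_ + _).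
by apply: eq_bigr => k /negbTE kj; rewrite tnth_tset kj.
Qed.

Lemma marginal_gibbs mu f j a : (forall k, bm (f k)) ->
  marginal mu (gibbs eps c f) j a =
  expR (f j a / eps) * mean (tensor mu) (fun x => expR (rest f j a x / eps)).
Proof.
move=> bf; rewrite -meanZ; last first.
  by apply: bm_expR; apply: bmM; [exact: bm_rest|exact: bm_cst].
apply: eq_mean => x; rewrite /gibbs oplus_tset -expRD; congr (expR _).
by rewrite /rest; ring.
Qed.

(** An update is a soft c-transform. *)
Lemma update_softmin mu f j a : (forall k, bm (f k)) ->
  update eps c mu f j j a = softmin eps (tensor mu) (rest f j a).
Proof.
move=> bf; rewrite /update eqxx marginal_gibbs// lnM ?posrE ?expR_gt0//; last first.
  by apply: mean_expR_gt0 => //; exact: bm_rest.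
by rewrite expRK /softmin; field; rewrite gt_eqF.
Qed.

Lemma dual_update_ge mu f j : (forall i, bm (f i)) ->
  dual eps c mu f <= dual eps c mu (update eps c mu f j).
Proof.
move=> bf; rewrite dual_update// lerDl mulr_ge0 ?(ltW eps0)// mean_ge0// => a.
have [l l0 lf] := marginal_ge eps bc mu j bf.
by rewrite (le_trans (sqr_ge0 _) (ln_sqrt_gain (lt_le_trans l0 (lf a)))).
Qed.

(** The soft c-transform does not oscillate more than the cost. *)
Lemma update_osc mu f j a b K : (forall i, bm (f i)) -> (forall x, `|c x| <= K) ->
  `|update eps c mu f j j a - update eps c mu f j j b| <= 2 * K.
Proof.
move=> bf cK; rewrite !update_softmin//.
have osc t u x : rest f j t x <= rest f j u x + 2 * K.
  rewrite /rest; have := cK (tset x j t); have := cK (tset x j u).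
  by rewrite !ler_norml => /andP[? ?] /andP[? ?]; lra.
have br a' : bm (rest f j a') by apply: bm_rest.
have h1 := le_softmin (tensor mu) eps0 (br a) (br b) (osc a b).
have h2 := le_softmin (tensor mu) eps0 (br b) (br a) (osc b a).
move: h1 h2; move: (softmin _ _ (rest f j a)) (softmin _ _ (rest f j b)) => u v.
by move=> h1 h2; rewrite ler_norml; apply/andP; split; lra.
Qed.

End Update.

(** Sample indices, with all sets measurable: integrals against empirical
    measures are pulled back to this finite space, where potentials are finite
    tables of numbers even when sample points coincide. *)
Definition idx (n : nat) : Type := 'I_n.+1.

Section Idx.
Variable n : nat.
HB.instance Definition _ := Finite.on (idx n).
HB.instance Definition _ := isPointed.Build (idx n) (ord0 : 'I_n.+1).
HB.instance Definition _ := @isMeasurable.Build default_measure_display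
  (idx n) discrete_measurable discrete_measurable0
  discrete_measurableC discrete_measurableU.
End Idx.

Lemma continuous_sum {R : realType} (X : topologicalType) (I : Type) (r : seq I)
    (P : pred I) (G : I -> X -> R) : (forall i, continuous (G i)) ->
  continuous (fun x => \sum_(i <- r | P i) G i x).
Proof.
move=> cG; elim: r => [|i r IH].
  have -> : (fun x => \sum_(i <- [::] | P i) G i x) = fun=> 0.
    by apply/funext => x; rewrite big_nil.
  by move=> x; exact: cvg_cst.
have -> : (fun x => \sum_(j <- i :: r | P j) G j x) =
    (fun x => (if P i then G i x else 0) + \sum_(j <- r | P j) G j x).
  by apply/funext => x; rewrite big_cons; case: ifP => // _; rewrite add0r.
move=> x; apply: cvgD; last exact: IH.
by case: (P i); [exact: cG|exact: cvg_cst].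
Qed.

Section FiniteTuples.
Context {R : realType} {n m : nat}.
Local Notation S := (m.-tuple (idx n)).

Lemma measurable_idx_set (A : set S) : measurable A.
Proof.
rewrite (_ : A = \big[setU/set0]_(s <- index_enum S | `[< A s >]) [set s]); last first.
  rewrite -bigcup_seq_cond; apply/seteqP; split => [s As|_ [s /= /andP[_ /asboolP As] ->]//].
  by exists s => //=; rewrite mem_index_enum asboolT.
apply: bigsetU_measurable => s _.
rewrite (_ : [set s] = \bigcap_(i : 'I_m) ((fun x : S => tnth x i) @^-1` [set tnth s i])).
  apply: fin_bigcap_measurable => // i _.
  by rewrite -[X in measurable X]setTI; exact: measurable_tnth.
apply/seteqP; split => [x -> i _ //|x h /=].
by apply: eq_from_tnth => i; exact: h.
Qed.

Lemma measurable_idx_fun {d : measure_display} {T : measurableType d} (F : S -> T) :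
  measurable_fun setT F.
Proof. by move=> _ B _; exact: measurable_idx_set. Qed.

Lemma bm_idx_tuple (F : S -> R) : bm F.
Proof.
apply: (@bmI _ _ _ _ (\sum_(s : S) `|F s|)); first exact: measurable_idx_fun.
by move=> s; rewrite (bigD1 s)//= lerDl sumr_ge0.
Qed.

Lemma bm_idx (F : idx n -> R) : bm F.
Proof.
apply: (@bmI _ _ _ _ (\sum_(s : idx n) `|F s|)); first by move=> _ B _.
by move=> s; rewrite (bigD1 s)//= lerDl sumr_ge0.
Qed.

Lemma mean_idx_tuple (Q : probability S R) (F : S -> R) :
  mean Q F = \sum_(s : S) mean Q \1_[set s] * F s.
Proof.
rewrite (@eq_mean _ _ _ _ _ (fun x => \sum_(s : S) \1_[set s] x * F s)).
  rewrite mean_sum; last by move=> s _; exact: bm_idx_tuple.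
  by apply: eq_bigr => s _; rewrite meanZr//; exact: bm_idx_tuple.
move=> x; rewrite (bigD1 x)//= indicE mem_set// mul1r big1 ?addr0// => s sx.
by rewrite indicE memNset ?mul0r//= => xs; rewrite xs eqxx in sx.
Qed.

Lemma continuous_mean_idx (X : topologicalType) (Q : probability S R) (F : X -> S -> R) :
  (forall s, continuous (F ^~ s)) -> continuous (fun x => mean Q (F x)).
Proof.
move=> cF; under eq_fun do rewrite mean_idx_tuple.
by apply: continuous_sum => s x; apply: cvgM; [exact: cvg_cst|exact: cF].
Qed.

Lemma measurable_mean_idx {d : measure_display} {X : measurableType d}
    (Q : probability S R) (F : X -> S -> R) :
  (forall s, measurable_fun setT (F ^~ s)) ->
  measurable_fun setT (fun x => mean Q (F x)).
Proof.
move=> mF; under eq_fun do rewrite mean_idx_tuple.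
by apply: measurable_sum => s; apply: measurable_funM => //; exact: measurable_cst.
Qed.

Lemma mean_idx_swap {d : measure_display} {X : measurableType d}
    (P : probability X R) (Q : probability S R) (F : X -> S -> R) :
  (forall s, bm (F ^~ s)) ->
  mean P (fun w => mean Q (F w)) = mean Q (fun s => mean P (F ^~ s)).
Proof.
move=> bF; under eq_mean do rewrite mean_idx_tuple.
rewrite mean_sum; last by move=> s _; apply: bmM => //; exact: bm_cst.
by rewrite mean_idx_tuple; apply: eq_bigr => s _; rewrite meanZ.
Qed.

Lemma bm_mean_idx {d : measure_display} {X : measurableType d}
    (Q : probability S R) (F : X -> S -> R) :
  (forall s, bm (F ^~ s)) -> bm (fun w => mean Q (F w)).
Proof.
move=> bF; under eq_fun do rewrite mean_idx_tuple.
by apply: bm_sum => s _; apply: bmM => //; exact: bm_cst.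
Qed.

End FiniteTuples.

Section FinitePotentials.
Context {R : realType} {m n : nat}.
Variables (eps K : R) (C : m.-tuple (idx n) -> R).
Hypotheses (m0 : (0 < m)%N) (eps0 : 0 < eps) (CK : forall s, `|C s| <= K).

Definition uniform : probability (idx n) R := empirical (@id (idx n)).

Local Notation unif := (fun _ : 'I_m => uniform).
Local Notation D := (dual eps C unif).

Lemma mean_uniform (F : idx n -> R) :
  mean uniform F = n.+1%:R^-1 * \sum_(k < n.+1) F k.
Proof. by rewrite mean_empirical//; exact: bm_idx. Qed.

Let bC : bm C. Proof. exact: bm_idx_tuple. Qed.

Let last : 'I_m := Ordinal (etrans (congr1 (leq^~ m) (prednK m0)) (leqnn m)).

Let K0 : 0 <= K. Proof. exact: le_trans (CK [tuple of nseq m point]). Qed.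

(* constants are moved to the last potential, so that the others are bounded by
   their oscillation *)
Let box (j : 'I_m) : R := if j == last then 2 * K * m%:R + K else 2 * K.

Let box_update f : (forall k, k != last -> forall a, `|f k a| <= 2 * K) ->
  forall k a, `|update eps C unif f last k a| <= box k.
Proof.
move=> fK k a; rewrite /box; case: eqP => [->|/eqP kl]; last first.
  by rewrite /update (negbTE kl); exact: fK.
rewrite update_softmin//; last by move=> j; exact: bm_idx.
apply: softmin_norm => //; first by apply: bm_rest => // j _; exact: bm_idx.
move=> x; rewrite /rest (le_trans (ler_normB _ _))// lerD//.
rewrite (le_trans (ler_norm_sum _ _ _))//.
apply: (@le_trans _ _ (\sum_(k0 < m) 2 * K)); last first.
  by rewrite sumr_const card_ord -[_ *+ m]mulr_natr.
rewrite [leRHS](bigID (fun k0 => k0 != last))/=.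
rewrite -[leLHS]addr0 lerD//; first by apply: ler_sum => i il; exact: fK.
by apply: sumr_ge0 => i _; rewrite mulr_ge0.
Qed.

Let continuous_dual (X : topologicalType) (g : X -> 'I_m -> idx n -> R) :
  (forall j a, continuous (fun x => g x j a)) -> continuous (fun x => D (g x)).
Proof.
move=> cg.
have c1 : continuous (fun x => \sum_(j < m) mean uniform (g x j)).
  apply: continuous_sum => j; under eq_fun do rewrite mean_uniform.
  move=> x; apply: cvgM; first exact: cvg_cst.
  by apply: continuous_sum => i; exact: cg.
have c2 s : continuous (fun x => excess eps C (g x) s).
  have c3 : continuous (fun x => (oplus (g x) s - C s) / eps).
    move=> x; apply: cvgM; last exact: cvg_cst.
    apply: cvgB; last exact: cvg_cst.
    by apply: continuous_sum => j; exact: cg.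
  move=> x; apply: cvgB; last exact: cvg_cst.
  exact: (@continuous_comp _ _ _ (fun x => (oplus (g x) s - C s) / eps) (@expR R) x
    (c3 x) (@continuous_expR R _)).
have c4 := @continuous_mean_idx R n m X (tensor unif) _ c2.
move=> x; apply: cvgB; first exact: c1.
by apply: cvgM; [exact: cvg_cst|exact: c4].
Qed.

(** The dual functional attains its maximum on a box of tables. Updating a
    potential of the maximizer, shifting it back into the box and updating the
    last potential does not leave the box, so no update is a strict
    improvement. *)
Lemma finite_potentials : exists2 phi : 'I_m -> idx n -> R,
  (forall j a, `|phi j a| <= 2 * K * m%:R + K) & schrodinger eps C unif phi.
Proof.
pose Phi := prod_topology (fun _ : 'I_m * idx n => R).
pose A : set Phi := [set phi | forall p, `[- box p.1, box p.1]%classic (phi p)].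
have box0 j : 0 <= box j.
  by rewrite /box; case: ifP => _; rewrite ?addr_ge0 ?mulr_ge0.
have A0 : A !=set0.
  exists (fun=> 0) => p /=; rewrite in_itv/= oppr_le0.
  by rewrite box0.
have cA : compact A.
  apply: (@tychonoff _ (fun _ : 'I_m * idx n => R) (fun p => `[- box p.1, box p.1]%classic)).
  by move=> p; exact: segment_compact.
have cD : continuous (fun phi : Phi => D (fun j a => phi (j, a))).
  apply: continuous_dual => j a.
  exact: (@proj_continuous _ (fun _ : 'I_m * idx n => R) (j, a)).
have [phi phiA phimax] := compact_EVT_max A0 cA (continuous_subspaceT cD).
pose f j a : R := phi (j, a).
have fbox j a : `|f j a| <= box j.
  by move: phiA; rewrite inE => /(_ (j, a)) /=; rewrite in_itv/= ler_norml.
have fmax g : (forall j a, `|g j a| <= box j) -> D g <= D f.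
  move=> gb; pose psi : Phi := fun p => g p.1 p.2.
  apply: (phimax psi); rewrite inE => p /=; rewrite in_itv/= -ler_norml; exact: gb.
have bm' (g : 'I_m -> idx n -> R) j : bm (g j) by exact: bm_idx.
have f2K k : k != last -> forall a, `|f k a| <= 2 * K.
  by move=> kl a; have := fbox k a; rewrite /box (negbTE kl).
exists f.
  move=> j a; apply: (le_trans (fbox j a)); rewrite /box; case: ifP => // _.
  rewrite -[leLHS]addr0 lerD// ler_peMr ?mulr_ge0//.
  by rewrite ler1n.
apply: schrodinger_defect => [//|//|j]; apply: (@defect_eq0 _ _ _ _ _ _ eps0 bC); first exact: bm'.
have [->|jl] := eqVneq j last; first by apply: fmax; exact: box_update.
(* shift the updated potential to vanish at a point, at the expense of the last *)
pose g0 := update eps C unif f j; pose s := g0 j point.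
pose sh k : R := if k == j then - s else if k == last then s else 0.
pose g1 k a := g0 k a + sh k.
have g1E : D g1 = D g0.
  apply: dual_shift; first exact: bm'.
  rewrite (bigD1 j)// (bigD1 last)/=; last by rewrite eq_sym.
  rewrite big1 ?addr0 /sh ?eqxx; last by move=> k /andP[/negPf -> /negPf ->].
  by rewrite eq_sym (negPf jl) addNr.
rewrite -/g0 -g1E; apply: le_trans (dual_update_ge eps0 bC unif last (bm' g1)) _.
apply: fmax; apply: box_update => k kl a; rewrite /g1 /sh (negPf kl) /g0.
have [->|kj] := eqVneq k j; first exact: update_osc.
by rewrite addr0 /update (negPf kj) f2K.
Qed.

End FinitePotentials.

(** Lowering potentials by half of the slack [V - a] in total keeps the dual value
    above [a]. *)
Lemma rounding {R : realType} (eps u v x y a V : R) : 0 < eps -> a < V -> u <= v ->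
  y - (V - a) / 2 <= x -> y - eps * v = V -> a < x - eps * u.
Proof. by move=> eps0 aV uv xy e; have := ler_wpM2l (ltW eps0) uv; lra. Qed.

Section EmpiricalPotentials.
Context {disp : measure_display} {T : measurableType disp} {R : realType}.
Context {m n : nat}.
Variables (eps K : R) (c : m.-tuple T -> R).
Hypotheses (m0 : (0 < m)%N) (eps0 : 0 < eps) (bc : bm c) (cK : forall x, `|c x| <= K).

Local Notation unif := (fun _ : 'I_m => uniform : probability (idx n) R).

Definition sample (X : 'I_m -> idx n -> T) (s : m.-tuple (idx n)) : m.-tuple T :=
  [tuple X i (tnth s i) | i < m].

Definition table (X : 'I_m -> idx n -> T) (s : m.-tuple (idx n)) : R := c (sample X s).

Local Notation emp X := (fun j : 'I_m => empirical (X j) : probability T R).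

Lemma mean_empirical_idx (x : idx n -> T) (F : T -> R) : bm F ->
  mean (empirical x) F = mean uniform (fun i => F (x i)).
Proof. by move=> bF; rewrite mean_uniform mean_empirical. Qed.

Lemma mean_tensor_empirical (X : 'I_m -> idx n -> T) (F : m.-tuple T -> R) :
  bm F -> mean (tensor (emp X)) F = mean (tensor unif) (fun s => F (sample X s)).
Proof.
move=> bF; apply: mean_tensor_map => // i h bh; exact: mean_empirical_idx.
Qed.

Lemma tset_sample (X : 'I_m -> idx n -> T) s j i :
  tset (sample X s) j (X j i) = sample X (tset s j i).
Proof.
apply: eq_from_tnth => k; rewrite tnth_tset [RHS]tnth_mktuple tnth_tset.
by case: eqP => [->//|_]; rewrite tnth_mktuple.
Qed.

Definition potential_bound : R := m%:R * (m%:R * (2 * K * m%:R + K) + K).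

Let K0 : 0 <= K. Proof. exact: le_trans (cK point). Qed.

(** Soft c-transforms extend potentials from the sample to the whole space. *)
Lemma empirical_potentials (X : 'I_m -> idx n -> T) :
  exists fh : 'I_m -> T -> R, [/\ forall j, bm (fh j),
    forall x, `|oplus fh x| <= potential_bound,
    schrodinger eps c (emp X) fh &
    exists2 phi, schrodinger eps (table X) unif phi &
      \sum_(j < m) mean (empirical (X j)) (fh j) = \sum_(j < m) mean uniform (phi j)].
Proof.
have CK s : `|table X s| <= K by exact: cK.
have [phi phiK phiS] := @finite_potentials R m n eps K (table X) m0 eps0 CK.
pose r j a (s : m.-tuple (idx n)) : R :=
  \sum_(k < m | k != j) phi k (tnth s k) - c (tset (sample X s) j a).
pose fh j a := softmin eps (tensor unif) (r j a).
pose B := m%:R * (2 * K * m%:R + K) + K.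
have rB j a s : `|r j a s| <= B.
  rewrite (le_trans (ler_normB _ _))// lerD// (le_trans (ler_norm_sum _ _ _))//.
  apply: (@le_trans _ _ (\sum_(k < m) (2 * K * m%:R + K))); last first.
    by rewrite sumr_const card_ord -[_ *+ m]mulr_natl.
  rewrite [leRHS](bigID (fun k => k != j))/= -[leLHS]addr0 lerD//.
    by apply: ler_sum => k _; exact: phiK.
  by apply: sumr_ge0 => k _; rewrite addr_ge0// !mulr_ge0.
have br j a : bm (r j a) by exact: bm_idx_tuple.
have fhB j a : `|fh j a| <= B by apply: softmin_norm.
have bfh j : bm (fh j).
  apply: bmN; apply: bmM; first exact: bm_cst.
  pose G (p : T * m.-tuple (idx n)) := expR (r j p.1 p.2 / eps).
  have bG : bm G.
    apply: bm_expR; apply: bmM; last exact: bm_cst.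
    apply: bmB; first exact: (bm_comp (@measurable_snd _ _ T (m.-tuple (idx n)))
      (bm_idx_tuple (fun s => \sum_(k < m | k != j) phi k (tnth s k)))).
    apply: (bm_comp _ (bm_tset_pair j bc) (phi := fun p : T * m.-tuple (idx n) =>
      (p.1, sample X p.2))).
    apply: measurable_fun_pair => //=; apply: measurableT_comp => //.
    exact: measurable_idx_fun.
  apply: (@bm_ln _ _ _ _ (expR (- B / eps))); first exact: expR_gt0.
    move=> a; apply: mean_ge; first exact: (bm_section1 bG).
    move=> s; rewrite ler_expR ler_pM2r ?invr_gt0//.
    by have := rB j a s; rewrite ler_norml => /andP[].
  exact: (@bm_mean1 _ _ _ _ _ (\d_point) (tensor unif) _ bG).
have fhX j i : fh j (X j i) = phi j i.
  have bphi k : bm (phi k) by exact: bm_idx.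
  have -> : fh j (X j i) = update eps (table X) unif phi j j i.
    rewrite (update_softmin eps0 (bm_idx_tuple (table X)) unif j i bphi).
    by congr softmin; apply/funext => s; rewrite /r /rest tset_sample.
  suff e : marginal unif (gibbs eps (table X) phi) j i = 1.
    by rewrite /update eqxx e ln1 mulr0 subr0.
  have := phiS j \1_[set i] (bm_idx _).
  rewrite mean_tnthM; [|exact: bm_idx|exact: bm_idx_tuple].
  rewrite !mean_uniform => /(mulfI _); rewrite invr_eq0 pnatr_eq0 => /(_ isT).
  rewrite (bigD1 i)//= [in RHS](bigD1 i)//= !big1; last 2 first.
  - by move=> k /negP ki; rewrite indicE memNset//= => ki'; apply: ki; rewrite ki'.
  - by move=> k /negP ki; rewrite indicE memNset ?mul0r//= => ki'; apply: ki; rewrite ki'.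
  by rewrite indicE mem_set// mul1r !addr0.
have oE s : oplus fh (sample X s) = oplus phi s.
  by apply: eq_bigr => j _; rewrite tnth_mktuple fhX.
exists fh; split => //.
- move=> x; rewrite (le_trans (ler_norm_sum _ _ _))//.
  rewrite (le_trans (ler_sum _ (fun j _ => fhB j (tnth x j))))//.
  by rewrite sumr_const card_ord -[_ *+ m]mulr_natl.
- move=> j h bh.
  rewrite mean_tensor_empirical; last by apply: bmM; [exact: bm_tnth|exact: bm_gibbs].
  rewrite mean_empirical_idx// -(phiS j (fun i => h (X j i)) (bm_idx _)).
  by apply: eq_mean => s; rewrite /gibbs oE tnth_mktuple.
exists phi => //; apply: eq_bigr => j _.
by rewrite mean_empirical_idx//; apply: eq_mean => i; rewrite fhX.
Qed.

(** The value of the empirical problem is a supremum over rational tables: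
    lowering a table slightly lowers the dual functional only slightly, because
    the exponential term decreases. *)
Lemma measurable_empirical_value {dO : measure_display} {O : measurableType dO}
    (X : O -> 'I_m -> idx n -> T) (V : O -> R) :
  (forall j i, measurable_fun setT (fun w => X w j i)) ->
  (forall w, exists2 phi, schrodinger eps (table (X w)) unif phi &
     V w = \sum_(j < m) mean uniform (phi j)) ->
  measurable_fun setT V.
Proof.
move=> mX VE; apply: measurable_fun_gtr => a.
pose tab (q : {ffun 'I_m * 'I_n.+1 -> rat}) (j : 'I_m) (i : idx n) : R := ratr (q (j, i)).
pose D w f := dual eps (table (X w)) unif f.
have bt (f : 'I_m -> idx n -> R) j : bm (f j) by exact: bm_idx.
have bC w : bm (table (X w)) by exact: bm_idx_tuple.
have mD q : measurable_fun setT (fun w => D w (tab q)).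
  apply: measurable_funB => //; apply: measurable_funM => //.
  apply: measurable_mean_idx => s; apply: measurable_funB => //.
  apply: measurableT_comp => //; apply: measurable_funM => //.
  apply: measurable_funB => //; apply: (measurableT_comp (bm_measurable bc)).
  by apply: measurable_mktuple => j; exact: mX.
rewrite (_ : [set w | _] = \bigcup_(q in setT) [set w | a < D w (tab q)]).
  by apply: countable_bigcupT_measurable => // q; exact: measurable_gtr.
apply/seteqP; split => [w /= aV|w [q _ /= aD]]; have [phi phiS VEw] := VE w; last first.
  rewrite VEw (lt_le_trans aD)//.
  exact: (dual_le eps0 (bC w) m0 (bt _) (bt _) phiS).
have DV : D w phi = V w.
  have e := mean_gibbs eps (bC w) unif (bt phi).
  rewrite (schrodinger_mean (Ordinal m0) (bt phi) phiS) in e.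
  rewrite /D /dual -VEw (_ : mean _ _ = 0) ?mulr0 ?subr0//.
  by apply: (addrI 1); rewrite addr0 -e.
pose del := (V w - a) / (2 * m%:R).
have mR : 0 < m%:R :> R by rewrite ltr0n.
have del0 : 0 < del by rewrite divr_gt0 ?subr_gt0// mulr_gt0.
have Hq p : exists q : rat, phi p.1 p.2 - del < ratr q < phi p.1 p.2.
  have [|q] := @rat_in_itvoo R (phi p.1 p.2 - del) (phi p.1 p.2).
    by rewrite ltrBlDr ltrDl.
  by rewrite in_itv/= => h; exists q.
have [q qP] := choice Hq.
exists [ffun p => q p] => //=; rewrite /D /dual.
have t1 j i : tab [ffun p => q p] j i <= phi j i.
  by rewrite /tab ffunE; have /andP[_ /ltW] := qP (j, i).
have t2 j i : phi j i - del <= tab [ffun p => q p] j i.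
  by rewrite /tab ffunE; have /andP[/ltW] := qP (j, i).
have h1 : mean (tensor unif) (excess eps (table (X w)) (tab [ffun p => q p])) <=
    mean (tensor unif) (excess eps (table (X w)) phi).
  apply: le_mean; [exact: bm_idx_tuple|exact: bm_idx_tuple|move=> s].
  rewrite lerD2r ler_expR ler_pM2r ?invr_gt0// lerD2r.
  by apply: ler_sum => j _; exact: t1.
have h2 : \sum_(j < m) mean uniform (phi j) - m%:R * del <=
    \sum_(j < m) mean uniform (tab [ffun p => q p] j).
  have -> : m%:R * del = \sum_(j < m) del by rewrite sumr_const card_ord mulr_natl.
  rewrite -sumrB; apply: ler_sum => j _.
  rewrite -[X in _ - X](mean_cst (uniform : probability (idx n) R) del) -meanB//; last exact: bm_cst.
  by apply: le_mean => //; apply: bmB => //; exact: bm_cst.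
have h3 : m%:R * del = (V w - a) / 2 by rewrite /del; field; rewrite gt_eqF.
rewrite h3 in h2; exact: rounding eps0 aV h1 h2 DV.
Qed.

End EmpiricalPotentials.

(** * Second moments of empirical averages over several samples *)

Section SecondMoment.
Context {dO dT : measure_display} {O : measurableType dO} {T : measurableType dT}.
Context {R : realType} {m n : nat}.
Variables (P : probability O R) (mu : 'I_m -> probability T R).
Variable Y : 'I_m -> 'I_n.+1 -> {mfun O >-> T}.
Hypothesis Yind : independent_sample P (fun p : 'I_m * 'I_n.+1 => mu p.1)
  (fun p => Y p.1 p.2).
Variables (z : m.-tuple T -> R) (B : R).
Hypotheses (bz : bm z) (zB : forall x, `|z x| <= B) (n0 : (0 < n)%N).

Local Notation unif := (fun _ : 'I_m => uniform : probability (idx n) R).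

Let X (w : O) (j : 'I_m) (i : idx n) : T := Y j i w.
Let emp (w : O) (j : 'I_m) : probability T R := empirical (X w j).

Let measurable_sample s : measurable_fun setT (fun w => sample (X w) s).
Proof. by apply: measurable_mktuple => j. Qed.

Let B0 : 0 <= B. Proof. exact: le_trans (zB point). Qed.

(** Disjoint systems of indices select distinct members of an independent family. *)
Lemma mean_disjoint_samples (s t : m.-tuple (idx n)) (H : m.-tuple T * m.-tuple T -> R) :
  (forall k, tnth s k != tnth t k) -> bm H ->
  mean P (fun w => H (sample (X w) s, sample (X w) t)) =
  mean (tensor mu) (fun u => mean (tensor mu) (fun v => H (u, v))).
Proof.
move=> st bH.
pose e (r : 'I_(m + m)) : 'I_m * 'I_n.+1 := match fintype.split r with
  | inl k => (k, tnth s k) | inr k => (k, tnth t k) end.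
have eL k : e (lshift m k) = (k, tnth s k) by rewrite /e (unsplitK (inl k)).
have eR k : e (rshift m k) = (k, tnth t k) by rewrite /e (unsplitK (inr k)).
have inj_e : injective e.
  move=> a b; rewrite -[a]splitK -[b]splitK.
  case: (fintype.split a) => k; case: (fintype.split b) => l /=; rewrite ?eL ?eR.
  - by move=> [->].
  - by move=> [<- /eqP]; rewrite (negbTE (st k)).
  - by move=> [<- /eqP]; rewrite eq_sym (negbTE (st k)).
  - by move=> [->].
pose L (y : (m + m).-tuple T) : m.-tuple T := [tuple tnth y (lshift m k) | k < m].
pose Rt (y : (m + m).-tuple T) : m.-tuple T := [tuple tnth y (rshift m k) | k < m].
have bF : bm (fun y => H (L y, Rt y)).
  apply: (bm_comp (phi := fun y => (L y, Rt y)) _ bH).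
  by apply: measurable_fun_pair; apply: measurable_mktuple => k; exact: measurable_tnth.
have := mean_sample Yind inj_e bF.
rewrite (@eq_mean _ _ _ _ _ (fun w => H (sample (X w) s, sample (X w) t))) => [->|w].
  rewrite mean_tensor_split//.
  rewrite (@eq_tensor _ _ _ _ _ mu); last by move=> k; rewrite eL.
  rewrite (@eq_tensor _ _ _ _ (fun i => mu (e (rshift m i)).1) mu); last first.
    by move=> k; rewrite eR.
  apply: eq_mean => u; apply: eq_mean => v; congr (H (_, _));
    apply: eq_from_tnth => k; rewrite tnth_mktuple.
    exact: tnth_lshift.
  exact: tnth_rshift.
by congr (H (_, _)); apply: eq_from_tnth => k; rewrite !tnth_mktuple ?eL ?eR.
Qed.

Let w0 := mean (tensor mu) z.
Let G j := mean (mu j) (fun a => marginal mu z j a ^+ 2).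

Let G0 j : 0 <= G j. Proof. by apply: mean_ge0 => a; exact: sqr_ge0. Qed.

Let zz s t w := z (sample (X w) s) * z (sample (X w) t).

Let bzz s t : bm (zz s t).
Proof. by apply: bmM; apply: (bm_comp (measurable_sample _) bz). Qed.

Lemma covariance_disjoint s t : (forall k, tnth s k != tnth t k) ->
  mean P (zz s t) = w0 ^+ 2.
Proof.
move=> st; rewrite (mean_disjoint_samples (H := fun p => z p.1 * z p.2) st); last first.
  by apply: bmM; apply: bm_comp bz.
transitivity (mean (tensor mu) (fun u => z u * w0)); last by rewrite meanZr// expr2.
by apply: eq_mean => u; rewrite -meanZ.
Qed.

(** Given the shared draw of coordinate [j] the two factors are independent and
    have the same conditional mean. *)
Lemma covariance_common j s t : tnth s j = tnth t j ->
  (forall k, k != j -> tnth s k != tnth t k) -> mean P (zz s t) = G j.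
Proof.
move=> stj st; have [b bs] : exists b : idx n, tnth s j != b.
  have [->|ne] := eqVneq (tnth s j) ord0; last by exists ord0.
  by exists (ord_max : 'I_n.+1); rewrite -val_eqE /= eq_sym -lt0n.
pose t' := tset t j b.
have st' k : tnth s k != tnth t' k.
  by rewrite /t' tnth_tset; have [->//|/st] := eqVneq k j.
pose H (p : m.-tuple T * m.-tuple T) := z p.1 * z (tset p.2 j (tnth p.1 j)).
have bH : bm H.
  apply: bmM; first exact: bm_comp bz.
  apply: (bm_comp (phi := fun p : m.-tuple T * m.-tuple T => (tnth p.1 j, p.2)) _ (bm_tset_pair j bz)).
  apply: measurable_fun_pair => //.
  by apply: (measurableT_comp (f := fun x : m.-tuple T => tnth x j)) => //; exact: measurable_tnth.
transitivity (mean P (fun w => H (sample (X w) s, sample (X w) t'))).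
  apply: eq_mean => w; rewrite /zz /H /=; congr (_ * z _).
  by rewrite tnth_mktuple stj tset_sample tset_tset tset_id.
rewrite mean_disjoint_samples//.
have bg := bm_marginal mu j bz.
under eq_mean => u.
  rewrite /H /= meanZ; last exact: bm_tset.
  rewrite -/(marginal mu z j (tnth u j)) mulrC.
  over.
rewrite mean_tnthM//; apply: eq_mean => a; by rewrite expr2.
Qed.

Lemma covariance_le s t : mean P (zz s t) <= B ^+ 2.
Proof.
apply: mean_le => // w; rewrite (le_trans (ler_norm _))// normrM expr2.
by rewrite ler_pM.
Qed.

Let eqr (a b : idx n) : R := (a == b)%:R.

Let mean_eqr a : mean uniform (eqr a) = n.+1%:R^-1.
Proof.
rewrite mean_uniform (bigD1 a)//= /eqr eqxx big1 ?addr0 ?mulr1// => i.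
by rewrite eq_sym => /negbTE ->.
Qed.

Let pair_le_common j s t : tnth s j = tnth t j ->
  mean P (zz s t) <= G j + B ^+ 2 * \sum_(k < m | k != j) eqr (tnth s k) (tnth t k).
Proof.
move=> stj; have [/existsP[k /andP[kj /eqP stk]]|/existsPn ne] :=
    boolP [exists k, (k != j) && (tnth s k == tnth t k)].
  rewrite (le_trans (covariance_le s t))// (bigD1 k)//= /eqr stk eqxx mulrDr mulr1.
  rewrite addrC -addrA lerDl addr_ge0// mulr_ge0 ?sqr_ge0//.
  by apply: sumr_ge0 => i _; exact: ler0n.
rewrite (covariance_common stj) ?lerDl ?mulr_ge0 ?sqr_ge0//.
  by apply: sumr_ge0 => i _; exact: ler0n.
by move=> k kj; have := ne k; rewrite kj.
Qed.

Let pair_le s t : mean P (zz s t) <= w0 ^+ 2 + \sum_(j < m) eqr (tnth s j) (tnth t j) *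
  (G j + B ^+ 2 * \sum_(k < m | k != j) eqr (tnth s k) (tnth t k)).
Proof.
have pos j : 0 <= eqr (tnth s j) (tnth t j) *
    (G j + B ^+ 2 * \sum_(k < m | k != j) eqr (tnth s k) (tnth t k)).
  rewrite mulr_ge0// addr_ge0// mulr_ge0 ?sqr_ge0//.
  by apply: sumr_ge0 => i _; exact: ler0n.
have [/existsP[j /eqP stj]|/existsPn ne] := boolP [exists j, tnth s j == tnth t j].
  rewrite (bigD1 j)//= {1}/eqr stj eqxx mul1r.
  rewrite (le_trans (pair_le_common stj))//.
  by rewrite addrCA lerDl addr_ge0 ?sqr_ge0// sumr_ge0.
by rewrite covariance_disjoint ?lerDl ?sumr_ge0.
Qed.

Lemma sqr_mean_tuple (Q : probability (m.-tuple (idx n)) R) (F : m.-tuple (idx n) -> R) :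
  (mean Q F) ^+ 2 = mean Q (fun s => mean Q (fun t => F s * F t)).
Proof.
rewrite expr2 -meanZr; last exact: bm_idx_tuple.
by apply: eq_mean => s; rewrite meanZ//; exact: bm_idx_tuple.
Qed.

(** Expand the square over pairs of index systems: two uniform systems agree in a
    given coordinate with probability [1 / N], and in two given coordinates with
    probability [1 / N^2]. *)
Lemma second_moment :
  mean P (fun w => mean (tensor (emp w)) z ^+ 2) <=
  w0 ^+ 2 + n.+1%:R^-1 * \sum_(j < m) G j + (m%:R * B / n.+1%:R) ^+ 2.
Proof.
have E w : mean (tensor (emp w)) z ^+ 2 =
    mean (tensor unif) (fun s => mean (tensor unif) (fun t => zz s t w)).
  by rewrite (mean_tensor_empirical (X w) bz) sqr_mean_tuple.
rewrite (eq_mean _ E) mean_idx_swap; last first.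
  by move=> s; apply: bm_mean_idx => t; exact: bzz.
apply: (@le_trans _ _ (mean (tensor unif) (fun s => w0 ^+ 2 +
  \sum_(j < m) (n.+1%:R^-1 * G j + n.+1%:R^-1 * B ^+ 2 * \sum_(k < m | k != j) n.+1%:R^-1)))).
  apply: le_mean; [exact: bm_idx_tuple|exact: bm_idx_tuple|move=> s].
  rewrite (mean_idx_swap P); last by move=> t; exact: bzz.
  apply: (le_trans (le_mean _ (bm_idx_tuple _) (bm_idx_tuple _) (pair_le s))).
  rewrite meanD; [|exact: bm_cst|exact: bm_idx_tuple].
  rewrite mean_cst lerD2l mean_sum; last by move=> j _; exact: bm_idx_tuple.
  apply: ler_sum => j _.
  rewrite (@eq_mean _ _ _ _ _ (fun t => eqr (tnth s j) (tnth t j) * G j +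
    B ^+ 2 * \sum_(k < m | k != j) eqr (tnth s j) (tnth t j) * eqr (tnth s k) (tnth t k))); last first.
    by move=> t; rewrite mulrDr; congr (_ + _); rewrite mulrCA; congr (_ * _); rewrite mulr_sumr.
  rewrite meanD; [|exact: bm_idx_tuple|exact: bm_idx_tuple].
  rewrite meanZr; last exact: bm_idx_tuple.
  rewrite meanZ; last exact: bm_idx_tuple.
  rewrite (mean_tnth _ _ (bm_idx (eqr (tnth s j)))) mean_eqr lerD2l.
  rewrite mean_sum; last by move=> k _; exact: bm_idx_tuple.
  have -> : n.+1%:R^-1 * B ^+ 2 * \sum_(k < m | k != j) n.+1%:R^-1 =
    B ^+ 2 * (n.+1%:R^-1 * \sum_(k < m | k != j) n.+1%:R^-1) by ring.
  rewrite ler_wpM2l ?sqr_ge0// mulr_sumr; apply: ler_sum => k kj.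
  by rewrite (mean_tnth2 _ _ (bm_idx (eqr (tnth s j))) (bm_idx (eqr (tnth s k)))) 1?eq_sym// !mean_eqr.
rewrite mean_cst -addrA lerD2l big_split/= -mulr_sumr lerD2l.
apply: (@le_trans _ _ (\sum_(j < m) (n.+1%:R^-1 * B ^+ 2 * (m%:R * n.+1%:R^-1)))).
  apply: ler_sum => j _; rewrite ler_wpM2l ?mulr_ge0 ?sqr_ge0 ?invr_ge0//.
  rewrite sumr_const -[_ *+ _]mulr_natl ler_wpM2r ?invr_ge0// ler_nat.
  by rewrite -[leqRHS]card_ord max_card.
rewrite sumr_const card_ord -[_ *+ m]mulr_natl; apply: le_of_eq.
by field; rewrite addrC natr1 pnatr_eq0.
Qed.

(** As for [second_moment], with coordinate [j] always shared. *)
Lemma second_moment_marginal j :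
  mean P (fun w => mean (emp w j) (fun a => marginal (emp w) z j a ^+ 2)) <=
  G j + m%:R * B ^+ 2 / n.+1%:R.
Proof.
have bsq w : bm (fun a => marginal (emp w) z j a ^+ 2) by apply: bmX; exact: bm_marginal.
pose V i w := mean (tensor unif) (fun s => mean (tensor unif) (fun t =>
  zz (tset s j i) (tset t j i) w)).
have E w : mean (emp w j) (fun a => marginal (emp w) z j a ^+ 2) =
    n.+1%:R^-1 * \sum_(i < n.+1) V i w.
  rewrite mean_empirical//; congr (_ * _); apply: eq_bigr => i _.
  rewrite /marginal (mean_tensor_empirical (X w) (bm_tset j (X w j i) bz)).
  rewrite sqr_mean_tuple; apply: eq_mean => s; apply: eq_mean => t.
  by rewrite !tset_sample.
have bV i : bm (V i) by apply: bm_mean_idx => s; apply: bm_mean_idx => t; exact: bzz.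
rewrite (eq_mean _ E) meanZ; last by apply: bm_sum.
rewrite mean_sum//.
rewrite -[leRHS](mulKf (_ : n.+1%:R != 0 :> R)) ?pnatr_eq0//.
rewrite ler_wpM2l ?invr_ge0//.
apply: (@le_trans _ _ (\sum_(i < n.+1) (G j + m%:R * B ^+ 2 / n.+1%:R))); last first.
  by rewrite sumr_const card_ord -[leLHS]mulr_natl.
apply: ler_sum => i _.
rewrite /V mean_idx_swap; last by move=> s; apply: bm_mean_idx => t; exact: bzz.
rewrite -[leRHS](mean_cst (tensor unif)).
apply: le_mean; [exact: bm_idx_tuple|exact: bm_idx_tuple|move=> s].
rewrite (mean_idx_swap P); last by move=> t; exact: bzz.
apply: (@le_trans _ _ (mean (tensor unif) (fun t => G j + B ^+ 2 *
    \sum_(k < m | k != j) eqr (tnth s k) (tnth t k)))).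
  apply: le_mean; [exact: bm_idx_tuple|exact: bm_idx_tuple|move=> t].
  rewrite (le_trans (@pair_le_common j _ _ _))//; first by rewrite !tnth_tset eqxx.
  by rewrite lerD2l ler_wpM2l ?sqr_ge0//; apply: ler_sum => k /negbTE kj; rewrite !tnth_tset kj.
rewrite meanD; [|exact: bm_cst|exact: bm_idx_tuple].
rewrite mean_cst lerD2l meanZ; last exact: bm_idx_tuple.
rewrite mean_sum; last by move=> k _; exact: bm_idx_tuple.
have -> : m%:R * B ^+ 2 / n.+1%:R = B ^+ 2 * (m%:R / n.+1%:R) by ring.
rewrite ler_wpM2l ?sqr_ge0//.
rewrite (eq_bigr (fun=> n.+1%:R^-1)); last first.
  by move=> k _; rewrite (mean_tnth _ _ (bm_idx (eqr (tnth s k)))) mean_eqr.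
rewrite sumr_const -[_ *+ _]mulr_natl ler_wpM2r ?invr_ge0// ler_nat.
by rewrite -[leqRHS]card_ord max_card.
Qed.

End SecondMoment.

(** * The Lindeberg replacement argument *)

Section Rademacher.
Context {R : realType}.
Implicit Types (h g : R -> R) (l : seq R).

(** Convolution of [h] with the law of a fair random sign times [s]. *)
Definition rad (s : R) h (x : R) : R := (h (x + s) + h (x - s)) / 2.

Definition rads l h : R -> R := foldr rad h l.

Lemma radD s f g x : rad s (fun y => f y + g y) x = rad s f x + rad s g x.
Proof. by rewrite /rad -mulrDl; congr (_ / _); ring. Qed.

Lemma le_rad s f g : (forall x, f x <= g x) -> forall x, rad s f x <= rad s g x.
Proof. by move=> fg x; rewrite ler_pM2r ?invr_gt0// lerD. Qed.

Lemma rad_le s f M : (forall x, f x <= M) -> forall x, rad s f x <= M.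
Proof.
move=> fM x; rewrite /rad ler_pdivrMr// mulr_natr mulr2n lerD//; exact: fM.
Qed.

Lemma eq_rad s f g : f =1 g -> rad s f =1 rad s g.
Proof. by move=> fg x; rewrite /rad !fg. Qed.

Lemma radC s t h : rad s (rad t h) =1 rad t (rad s h).
Proof.
move=> x; rewrite /rad; congr (_ / _); rewrite -!mulrDl; congr (_ / _).
by rewrite addrACA; congr (_ + _ + (_ + _)); congr h; ring.
Qed.

Lemma radsD l f g x : rads l (fun y => f y + g y) x = rads l f x + rads l g x.
Proof. by elim: l x => [//|s l IH] x /=; rewrite (eq_rad _ IH) radD. Qed.

Lemma le_rads l f g : (forall x, f x <= g x) -> forall x, rads l f x <= rads l g x.
Proof. by move=> fg; elim: l => [//|s l IH] /=; exact: le_rad. Qed.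

Lemma rads_rad l t h : rads l (rad t h) =1 rad t (rads l h).
Proof.
elim: l => [//|s l IH] x /=; rewrite (eq_rad _ IH); exact: radC.
Qed.

Lemma iter_rad n s t h : iter n (rad s) (rad t h) =1 rad t (iter n (rad s) h).
Proof. by elim: n => [//|n IH] x /=; rewrite (eq_rad _ IH); exact: radC. Qed.

(** Adding independent terms does not increase the maximal concentration. *)
Lemma rads_le s l h M : (forall x, iter (count_mem s l) (rad s) h x <= M) ->
  forall x, rads l h x <= M.
Proof.
elim: l h => [//|t l IH] h /= hM x.
rewrite -rads_rad; apply: IH => y; move: hM.
have [->|ts] := eqVneq t s; first by move=> /(_ y); rewrite add1n iterSr.
rewrite add0n iter_rad => hM; exact: rad_le.
Qed.

Lemma iter_radE n s h x : iter n (rad s) h x =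
  (2 ^+ n)^-1 * \sum_(k < n.+1) 'C(n, k)%:R * h (x + (2 * k%:R - n%:R) * s).
Proof.
elim: n x => [|n IH] x.
  rewrite big_ord1 expr0 invr1 mul1r bin0 mul1r /=.
  by congr h; ring.
rewrite iterS /rad !IH -mulrDr mulrAC -[_ / 2]invfM -exprSr; congr (_ * _).
pose F (k : nat) := h (x + (2 * k%:R - n.+1%:R) * s).
rewrite (eq_bigr (fun k : 'I_n.+1 => 'C(n, k)%:R * F k.+1)); last first.
  by move=> k _; congr (_ * h _); rewrite -!natr1; ring.
rewrite [X in _ + X](eq_bigr (fun k : 'I_n.+1 => 'C(n, k)%:R * F k)); last first.
  by move=> k _; congr (_ * h _); rewrite -!natr1; ring.
rewrite [RHS](eq_bigr (fun k : 'I_n.+2 => 'C(n.+1, k)%:R * F k))//.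
rewrite [RHS]big_ord_recl [X in _ + X = _]big_ord_recl /= !bin0 addrCA; congr (_ + _).
rewrite [X in _ + X = _](_ : _ = \sum_(k < n.+1) 'C(n, k.+1)%:R * F k.+1); last first.
  by rewrite big_ord_recr /= bin_small// mul0r addr0; apply: eq_bigr.
rewrite -big_split/=; apply: eq_bigr => k _.
by rewrite /bump/= add1n binS natrD mulrDl addrC.
Qed.

End Rademacher.

Lemma bin_le_middle n k : ('C(n.*2, k) <= 'C(n.*2, n))%N.
Proof.
have step j : (j < n)%N -> ('C(n.*2, j) <= 'C(n.*2, j.+1))%N.
  move=> jn; rewrite -(leq_pmul2l (ltn0Sn j)) mul_bin_left leq_mul2r.
  by apply/orP; right; rewrite -addnn; lia.
have mono j i : (j + i = n)%N -> ('C(n.*2, j) <= 'C(n.*2, n))%N.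
  elim: i j => [|i IH] j; first by rewrite addn0 => ->.
  by move=> e; apply: (leq_trans (step j _)); [lia|apply: IH; lia].
have [kn|nk] := leqP k n; first by apply: (mono k (n - k)%N); lia.
have [k2|k2] := leqP k n.*2; last by rewrite bin_small.
rewrite -bin_sub//; apply: (mono (n.*2 - k)%N (k - n)%N).
by move: nk k2; rewrite -addnn; lia.
Qed.

(** The factor [2 n + 1], rather than [2 n], makes the induction close. *)
Lemma central_bin n : ('C(n.*2, n) ^ 2 * n.*2.+1 <= 16 ^ n)%N.
Proof.
elim: n => [//|n IH].
have e : (n.+1 * 'C(n.+1.*2, n.+1) = 2 * n.*2.+1 * 'C(n.*2, n))%N.
  have e1 := mul_bin_diag n.*2.+2 n; have e2 := mul_bin_down n.*2.+1 n.
  rewrite doubleS -e1.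
  have e3 : (n.*2.+1 - n = n.+1)%N by lia.
  rewrite e3 /= in e2.
  rewrite /=; move: e2; set u := 'C(_, _); set v := 'C(_, _); nia.
rewrite -(leq_pmul2l (ltn0Sn n)) -(leq_pmul2l (ltn0Sn n)).
have -> : (n.+1 * (n.+1 * ('C(n.+1.*2, n.+1) ^ 2 * n.+1.*2.+1)) =
   (n.+1 * 'C(n.+1.*2, n.+1)) ^ 2 * n.+1.*2.+1)%N by rewrite !expnS !expn0; ring.
rewrite e.
have -> : ((2 * n.*2.+1 * 'C(n.*2, n)) ^ 2 * n.+1.*2.+1 =
   4 * n.*2.+1 * n.+1.*2.+1 * ('C(n.*2, n) ^ 2 * n.*2.+1))%N by rewrite !expnS !expn0; ring.
have -> : (n.+1 * (n.+1 * 16 ^ n.+1) = 16 * n.+1 * n.+1 * 16 ^ n)%N by rewrite expnS; ring.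
apply: leq_mul => //; rewrite -!addnn; nia.
Qed.

Lemma bin_le n k : ('C(n, k) ^ 2 * n <= 4 ^ n)%N.
Proof.
have [m [->|->]] : exists m, n = m.*2 \/ n = m.*2.+1.
  by exists n./2; have := odd_double_half n; case: odd => /=; [right|left]; lia.
- apply: (@leq_trans ('C(m.*2, m) ^ 2 * m.*2.+1)%N).
    by apply: leq_mul => //; rewrite leq_sqr bin_le_middle.
  by rewrite (leq_trans (central_bin m))// -mul2n expnM.
- apply: (@leq_trans (4 * ('C(m.*2, m) ^ 2 * m.*2.+1))%N); last first.
    by rewrite [leqRHS]expnS leq_pmul2l// -[m.*2 in leqRHS]mul2n expnM central_bin.
  rewrite mulnA leq_mul2r; apply/orP; right.
  rewrite -[4%N]/(2 ^ 2)%N -expnMn leq_sqr.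
  case: k => [|k]; first by rewrite bin0 muln_gt0 bin_gt0 -addnn leq_addr.
  by rewrite binS mul2n -[leqRHS]addnn leq_add// bin_le_middle.
Qed.

Section AntiConcentration.
Context {R : realType}.

Definition window (a del u : R) : R := ((a <= u) && (u <= a + del))%:R.

Lemma card_window n (y eta : R) : 0 <= eta ->
  \sum_(k < n) window y eta k%:R <= eta + 1.
Proof.
move=> eta0.
(* the second bound is what the first needs when [n] lies in the interval *)
suff [] : \sum_(k < n) window y eta k%:R <= eta + 1 /\
  \sum_(k < n) window y eta k%:R <= Num.max 0 (n%:R - y) by [].
elim: n => [|n [IH1 IH2]]; first by rewrite big_ord0 addr_ge0// le_max lexx.
rewrite big_ord_recr /= [window y eta n%:R]/window; case: andP => [[yn ny]|_] /=.
  rewrite max_r in IH2; last by rewrite subr_ge0.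
  split; first lra.
  by rewrite le_max; apply/orP; right; rewrite -natr1; lra.
rewrite addr0; split=> //; apply: (le_trans IH2).
by rewrite ge_max !le_max lexx/= lerD2r ler_nat leqnSn orbT.
Qed.

(** A window of length [del] meets at most [del / (2 s) + 1] atoms of the law of
    a sum of [n] signs, and by [bin_le] no atom exceeds [1 / sqrt n]. *)
Lemma iter_rad_window n (s a del x : R) : (0 < n)%N -> 0 < s -> 0 <= del ->
  iter n (rad s) (window a del) x <= (del / (2 * s) + 1) / Num.sqrt n%:R.
Proof.
move=> n0 s0 del0; rewrite iter_radE.
have sn : 0 < Num.sqrt n%:R :> R by rewrite sqrtr_gt0 ltr0n.
pose y := ((a - x) / s + n%:R) / 2.
have wE k : window a del (x + (2 * k%:R - n%:R) * s) = window y (del / (2 * s)) k%:R.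
  rewrite /window /y; congr (_ && _)%:R; apply/idP/idP => h.
  - rewrite ler_pdivrMr// -lerBrDr ler_pdivrMr//; lra.
  - by move: h; rewrite ler_pdivrMr// -lerBrDr ler_pdivrMr//; lra.
  - have : 2 * k%:R - n%:R <= (a - x + del) / s by rewrite ler_pdivlMr//; lra.
    rewrite mulrDl invfM mulrA [del / 2 / s]mulrAC; lra.
  - suff : 2 * k%:R - n%:R <= (a - x + del) / s by rewrite ler_pdivlMr//; lra.
    by move: h; rewrite mulrDl invfM mulrA [del / 2 / s]mulrAC; lra.
have cb k : 'C(n, k)%:R <= 2 ^+ n / Num.sqrt n%:R :> R.
  rewrite ler_pdivlMr// -ler_sqr ?nnegrE ?mulr_ge0 ?exprn_ge0 ?sqrtr_ge0//.
  have -> : (2 ^+ n) ^+ 2 = (4 ^ n)%:R :> R by rewrite -exprM mulnC exprM -!natrX.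
  by rewrite exprMn sqr_sqrtr// -natrX -natrM ler_nat bin_le.
apply: (@le_trans _ _ ((2 ^+ n)^-1 * (2 ^+ n / Num.sqrt n%:R *
    \sum_(k < n.+1) window y (del / (2 * s)) k%:R))).
  rewrite ler_wpM2l ?invr_ge0 ?exprn_ge0// mulr_sumr; apply: ler_sum => k _.
  by rewrite wE ler_wpM2r.
rewrite mulrA mulKf ?expf_neq0// mulrC ler_wpM2r ?invr_ge0 ?sqrtr_ge0//.
by apply: card_window; rewrite divr_ge0// mulr_ge0// ltW.
Qed.

End AntiConcentration.

Section Lindeberg.
Context {R : realType}.
Implicit Types (h g : R -> R).

(** A third-order Taylor bound, with no reference to derivatives: it is stable
    under averaging over translates and holds for splines. *)
Definition smooth3 (K L : R) h : Prop := bm h /\ exists h1 h2 : R -> R,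
  (forall x, `|h2 x| <= L) /\
  (forall x y, `|h (x + y) - h x - h1 x * y - h2 x / 2 * y ^+ 2| <= K * `|y| ^+ 3).

Lemma bm_shift h x : bm h -> bm (fun y : R => h (y + x)).
Proof. by apply: bm_comp; apply: measurable_funD => //; exact: measurable_cst. Qed.

Lemma bm_shiftr h x : bm h -> bm (fun y : R => h (x + y)).
Proof. by apply: bm_comp; apply: measurable_funD => //; exact: measurable_cst. Qed.

Lemma bm_rad s h : bm h -> bm (rad s h).
Proof.
move=> bh; apply: bmM; last exact: bm_cst.
by apply: bmD; exact: bm_shift.
Qed.

Lemma smooth3_rad K L s h : smooth3 K L h -> smooth3 K L (rad s h).
Proof.
move=> [bh [h1 [h2 [h2L hK]]]]; split; first exact: bm_rad.
exists (rad s h1), (rad s h2); split=> [x|x y].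
  rewrite /rad normrM (ger0_norm (x := 2^-1))// ler_pdivrMr// mulr_natr mulr2n.
  by rewrite (le_trans (ler_normD _ _))// lerD.
have -> : rad s h (x + y) - rad s h x - rad s h1 x * y - rad s h2 x / 2 * y ^+ 2 =
  ((h (x + s + y) - h (x + s) - h1 (x + s) * y - h2 (x + s) / 2 * y ^+ 2) +
   (h (x - s + y) - h (x - s) - h1 (x - s) * y - h2 (x - s) / 2 * y ^+ 2)) / 2.
  by rewrite /rad (addrAC x y s) (addrAC x y (- s)); field.
rewrite normrM (ger0_norm (x := 2^-1))// ler_pdivrMr// mulr_natr mulr2n.
by rewrite (le_trans (ler_normD _ _))// lerD.
Qed.

Lemma smooth3_rads K L l h : smooth3 K L h -> smooth3 K L (rads l h).
Proof. by move=> sh; elim: l => [//|s l IH] /=; exact: smooth3_rad. Qed.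

Lemma bm_rads l h : bm h -> bm (rads l h).
Proof. by move=> sh; elim: l => [//|s l IH] /=; exact: bm_rad. Qed.

Context {disp : measure_display} {T : measurableType disp}.

(** Both laws are centered, so expansions to the second order differ by the second
    moments and the remainders. *)
Lemma lindeberg1 (mu : probability T R) (zeta : T -> R) K L b s g x :
  0 <= K -> smooth3 K L g -> bm zeta -> mean mu zeta = 0 ->
  (forall a, `|zeta a| <= b) -> `|s| <= b ->
  `|mean mu (fun a => g (x + zeta a)) - rad s g x| <=
  2 * K * b ^+ 3 + L * `|mean mu (fun a => zeta a ^+ 2) - s ^+ 2|.
Proof.
move=> K0 [bg [g1 [g2 [g2L gK]]]] bz z0 zb sb.
have b0 : 0 <= b by exact: le_trans (normr_ge0 s) sb.
have L0 : 0 <= L by exact: le_trans (normr_ge0 _) (g2L 0).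
have bgz : bm (fun a => g (x + zeta a)) by exact: (bm_comp (bm_measurable bz) (bm_shiftr x bg)).
have bz2 := bmX 2 bz.
set v := mean mu (fun a => zeta a ^+ 2).
have KB (y : R) : `|y| <= b -> K * `|y| ^+ 3 <= K * b ^+ 3.
  by move=> yb; rewrite ler_wpM2l// lerXn2r ?nnegrE.
have e1 : `|mean mu (fun a => g (x + zeta a)) - g x - g2 x / 2 * v| <= K * b ^+ 3.
  have -> : mean mu (fun a => g (x + zeta a)) - g x - g2 x / 2 * v =
      mean mu (fun a => g (x + zeta a) - g x - g1 x * zeta a - g2 x / 2 * zeta a ^+ 2).
    have b1 := bmM (bm_cst (g1 x)) bz; have b2 := bmM (bm_cst (g2 x / 2)) bz2.
    have b3 := bmB bgz (bm_cst (g x)).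
    rewrite meanB//; last exact: bmB.
    rewrite meanB// meanB//; last exact: bm_cst.
    by rewrite !meanZ// z0 mulr0 subr0 mean_cst.
  apply: mean_norm_le.
    apply: bmB; last by apply: bmM => //; exact: bm_cst.
    apply: bmB; last by apply: bmM => //; exact: bm_cst.
    by apply: bmB => //; exact: bm_cst.
  by move=> a; rewrite (le_trans (gK _ _))// KB.
have e2 : `|rad s g x - g x - g2 x / 2 * s ^+ 2| <= K * b ^+ 3.
  have h1 := le_trans (gK x s) (KB s sb).
  have h2 : `|g (x - s) - g x - g1 x * (- s) - g2 x / 2 * (- s) ^+ 2| <= K * b ^+ 3.
    by rewrite (le_trans (gK _ _))// KB// normrN.
  have -> : rad s g x - g x - g2 x / 2 * s ^+ 2 =
    ((g (x + s) - g x - g1 x * s - g2 x / 2 * s ^+ 2) +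
     (g (x - s) - g x - g1 x * (- s) - g2 x / 2 * (- s) ^+ 2)) / 2.
    by rewrite /rad; field.
  rewrite normrM (ger0_norm (x := 2^-1))// ler_pdivrMr// mulr_natr mulr2n.
  by rewrite (le_trans (ler_normD _ _))// lerD.
have e3 : `|g2 x / 2 * v - g2 x / 2 * s ^+ 2| <= L * `|v - s ^+ 2|.
  rewrite -mulrBr normrM ler_wpM2r// normrM (ger0_norm (x := 2^-1))//.
  by rewrite ler_pdivrMr// mulr_natr mulr2n (le_trans (g2L x))// lerDl.
move: e1 e2 e3; move: (mean _ _) (rad s g x) (g x) (g2 x / 2 * v) (g2 x / 2 * s ^+ 2).
move=> p q r u w; rewrite !ler_norml => /andP[? ?] /andP[? ?] /andP[? ?].
by apply/andP; split; lra.
Qed.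

(** The summands are replaced one at a time; by [smooth3_rads] the function that
    the others leave behind is as smooth as [h]. *)
Lemma lindeberg n (mu : 'I_n -> probability T R) (zeta : 'I_n -> T -> R) K L b
    (s : 'I_n -> R) h x :
  0 <= K -> smooth3 K L h -> (forall r, bm (zeta r)) ->
  (forall r, mean (mu r) (zeta r) = 0) -> (forall r a, `|zeta r a| <= b) ->
  (forall r, `|s r| <= b) ->
  `|mean (tensor mu) (fun y => h (x + oplus zeta y)) - rads [seq s r | r <- enum 'I_n] h x| <=
  \sum_(r < n) (2 * K * b ^+ 3 + L * `|mean (mu r) (fun a => zeta r a ^+ 2) - s r ^+ 2|).
Proof.
move=> K0 sh; elim: n mu zeta s x => [|n IH] mu zeta s x bz z0 zb sb.
  have -> : enum 'I_0 = [::] by apply: size0nil; rewrite size_enum_ord.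
  rewrite big_ord0 /= (@eq_mean _ _ _ _ _ (fun=> h x)); last first.
    by move=> y; rewrite /oplus big_ord0 addr0.
  by rewrite mean_cst subrr normr0.
have bh : bm h by case: sh.
have bo : bm (fun y : n.+1.-tuple T => h (x + oplus zeta y)).
  apply: (bm_comp _ (bm_shiftr x bh)); exact: (bm_measurable (bm_oplus bz)).
rewrite mean_tensorS// enum_ordSl /= -map_comp big_ord_recl.
set l := [seq _ | _ <- _]; set D := \sum_(i < n) _.
set F := fun a : T => _.
have FE a : F a = mean (tensor (fun i => mu (lift ord0 i)))
    (fun y => h ((x + zeta ord0 a) + oplus (fun i => zeta (lift ord0 i)) y)).
  apply: eq_mean => y; congr h; rewrite /oplus big_ord_recl /= -addrA; congr (_ + (_ + _)).
  by apply: eq_bigr => i _; rewrite /tcons/= tnthS.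
have FD a : `|F a - rads l h (x + zeta ord0 a)| <= D.
  rewrite FE /l /D; exact: (IH (fun i => mu (lift ord0 i)) (fun i => zeta (lift ord0 i))
    (fun i => s (lift ord0 i))).
have bF : bm F by exact: (bm_mean_tcons (tensor (fun i => mu (lift ord0 i))) bo).
have bl := bm_rads l bh.
have blz : bm (fun a => rads l h (x + zeta ord0 a)).
  exact: (bm_comp (bm_measurable (bz ord0)) (bm_shiftr x bl)).
have h1 : `|mean (mu ord0) F - mean (mu ord0) (fun a => rads l h (x + zeta ord0 a))| <= D.
  by rewrite -meanB//; apply: mean_norm_le => //; exact: bmB.
have h2 := @lindeberg1 (mu ord0) (zeta ord0) K L b (s ord0) (rads l h) x K0
  (smooth3_rads l sh) (bz ord0) (z0 ord0) (zb ord0) (sb ord0).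
rewrite -[X in `|X|](subrKA (mean (mu ord0) (fun a => rads l h (x + zeta ord0 a)))).
rewrite (le_trans (ler_normD _ _))// addrC lerD//.
Qed.

End Lindeberg.

(** * From smooth test functions to distribution functions *)

Section Cutoff.
Context {R : realType}.
Implicit Types (a del x y t u : R).

Definition ppart x : R := (x + `|x|) / 2.

Lemma ppart_ge0E x : 0 <= x -> ppart x = x.
Proof. by move=> x0; rewrite /ppart ger0_norm//; lra. Qed.

Lemma ppart_le0E x : x <= 0 -> ppart x = 0.
Proof. by move=> x0; rewrite /ppart ler0_norm// subrr mul0r. Qed.

(** The second derivative [6 x_+] of [x_+^3] is 6-Lipschitz. *)
Lemma ppart_cube_taylor x y :
  `|ppart (x + y) ^+ 3 - ppart x ^+ 3 - 3 * ppart x ^+ 2 * y - 3 * ppart x * y ^+ 2|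
  <= `|y| ^+ 3.
Proof.
have [x0|x0] := leP 0 x; have [xy0|xy0] := leP 0 (x + y).
- rewrite !ppart_ge0E// -normrX; apply: le_of_eq.
  by congr `|_|; ring.
- rewrite (ppart_ge0E x0) (ppart_le0E (ltW xy0)).
  have y0 : y <= 0 by lra.
  rewrite (ler0_norm y0).
  have -> : 0 ^+ 3 - x ^+ 3 - 3 * x ^+ 2 * y - 3 * x * y ^+ 2 = y ^+ 3 - (x + y) ^+ 3 by ring.
  have h1 : (- (x + y)) ^+ 3 <= (- y) ^+ 3 by rewrite lerXn2r ?nnegrE; lra.
  have h2 : 0 <= (- (x + y)) ^+ 3 by rewrite exprn_ge0//; lra.
  have e1 : (- (x + y)) ^+ 3 = - (x + y) ^+ 3 by ring.
  have e2 : (- y) ^+ 3 = - y ^+ 3 by ring.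
  by rewrite e1 e2 in h1 h2 *; rewrite ler_norml; apply/andP; split; lra.
- rewrite (ppart_le0E (ltW x0)) (ppart_ge0E xy0) !expr0n /= !mulr0 !mul0r !subr0.
  have y0 : 0 <= y by lra.
  rewrite !ger0_norm ?exprn_ge0// lerXn2r ?nnegrE; lra.
- rewrite (ppart_le0E (ltW x0)) (ppart_le0E (ltW xy0)) !expr0n /= !mulr0 !mul0r !subr0.
  by rewrite normr0 exprn_ge0.
Qed.

(** The distribution function of the quadratic B-spline: a third-order divided
    difference of cubes, rising from 0 to 1 on [0, 3]. *)
Definition smoothstep x : R := (ppart x ^+ 3 - 3 * ppart (x - 1) ^+ 3 +
  3 * ppart (x - 2) ^+ 3 - ppart (x - 3) ^+ 3) / 6.

Lemma smoothstep_taylor x y :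
  `|smoothstep (x + y) - smoothstep x
    - (3 * ppart x ^+ 2 - 9 * ppart (x - 1) ^+ 2 + 9 * ppart (x - 2) ^+ 2
       - 3 * ppart (x - 3) ^+ 2) / 6 * y
    - (ppart x - 3 * ppart (x - 1) + 3 * ppart (x - 2) - ppart (x - 3)) / 2 * y ^+ 2|
  <= 4 / 3 * `|y| ^+ 3.
Proof.
pose q z := ppart (z + y) ^+ 3 - ppart z ^+ 3 - 3 * ppart z ^+ 2 * y - 3 * ppart z * y ^+ 2.
have qle z : `|q z| <= `|y| ^+ 3 by exact: ppart_cube_taylor.
rewrite [X in `|X|](_ : _ = (q x - 3 * q (x - 1) + 3 * q (x - 2) - q (x - 3)) / 6).
  have := qle x; have := qle (x - 1); have := qle (x - 2); have := qle (x - 3).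
  rewrite !ler_norml => /andP[? ?] /andP[? ?] /andP[? ?] /andP[? ?].
  by apply/andP; split; lra.
rewrite /q /smoothstep (addrAC x y (-1)) (addrAC x y (- 2)) (addrAC x y (- 3)).
by field.
Qed.

Lemma smoothstep_curvature x :
  `|ppart x - 3 * ppart (x - 1) + 3 * ppart (x - 2) - ppart (x - 3)| <= 1.
Proof.
have [x0|x0] := leP x 0.
  by rewrite !ppart_le0E ?normr_le1; [rewrite !mulr0 !subr0 addr0 normr0|lra..].
have [x1|x1] := leP x 1.
  rewrite (ppart_ge0E (ltW x0)) !ppart_le0E; [|lra..].
  by rewrite !mulr0 !subr0 addr0 ger0_norm// ltW.
have [x2|x2] := leP x 2.
  rewrite (ppart_ge0E (ltW x0)) (@ppart_ge0E (x - 1)); [|lra].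
  rewrite !ppart_le0E; [|lra..].
  by rewrite ler_norml; apply/andP; split; lra.
have [x3|x3] := leP x 3.
  rewrite (ppart_ge0E (ltW x0)) (@ppart_ge0E (x - 1)); [|lra].
  rewrite (@ppart_ge0E (x - 2)); [|lra].
  rewrite ppart_le0E; [|lra].
  by rewrite ler_norml; apply/andP; split; lra.
rewrite (ppart_ge0E (ltW x0)) (@ppart_ge0E (x - 1)); [|lra].
rewrite (@ppart_ge0E (x - 2)); [|lra].
rewrite ppart_ge0E; [|lra].
by rewrite ler_norml; apply/andP; split; lra.
Qed.

Lemma smoothstep_le0E x : x <= 0 -> smoothstep x = 0.
Proof.
by move=> x0; rewrite /smoothstep !ppart_le0E; [rewrite expr0n/= !mulr0 !subr0 addr0 mul0r|lra..].
Qed.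

Lemma smoothstep_ge3E x : 3 <= x -> smoothstep x = 1.
Proof. by move=> x3; rewrite /smoothstep !ppart_ge0E; [field|lra..]. Qed.

Lemma smoothstep_itv x : 0 <= smoothstep x <= 1.
Proof.
have [x0|x0] := leP x 0; first by rewrite smoothstep_le0E// lexx ler01.
have [x3|x3] := leP 3 x; first by rewrite smoothstep_ge3E// lexx ler01.
rewrite /smoothstep (ppart_ge0E (ltW x0)) (@ppart_le0E (x - 3)); [|lra].
have [x1|x1] := leP x 1.
  rewrite !ppart_le0E; [|lra..].
  rewrite expr0n/= !mulr0 !subr0 addr0.
  have h : x ^+ 3 <= 1 by rewrite exprn_ile1// ltW.
  have h' : 0 <= x ^+ 3 by rewrite exprn_ge0// ltW.
  by apply/andP; split; lra.
rewrite (@ppart_ge0E (x - 1)); [|lra].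
have [x2|x2] := leP x 2.
  rewrite ppart_le0E; [|lra].
  have [s e] : exists s, x = 1 + s by exists (x - 1); ring.
  have s0 : 0 < s by lra.
  have s1 : s <= 1 by lra.
  have s2 : s ^+ 2 <= 1 by rewrite exprn_ile1// ltW.
  have s3 : s ^+ 3 <= 1 by rewrite exprn_ile1// ltW.
  have s2' : 0 <= s ^+ 2 by rewrite sqr_ge0.
  have h : 0 <= (1 - s) * (4 + s - 2 * s ^+ 2) by apply: mulr_ge0; lra.
  have -> : x ^+ 3 - 3 * (x - 1) ^+ 3 + 3 * 0 ^+ 3 - 0 ^+ 3 =
     1 + 3 * s + 3 * s ^+ 2 - 2 * s ^+ 3 by rewrite e; ring.
  have hE : (1 - s) * (4 + s - 2 * s ^+ 2) = 4 - 3 * s - 3 * s ^+ 2 + 2 * s ^+ 3 by ring.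
  have s32 : s ^+ 3 <= s ^+ 2 by rewrite exprS ler_piMl.
  by rewrite hE in h; apply/andP; split; lra.
rewrite (@ppart_ge0E (x - 2)); [|lra].
have [s e] : exists s, x = 3 - s by exists (3 - x); ring.
have s3 : s ^+ 3 <= 1 by rewrite exprn_ile1//; lra.
have s3' : 0 <= s ^+ 3 by rewrite exprn_ge0//; lra.
have -> : x ^+ 3 - 3 * (x - 1) ^+ 3 + 3 * (x - 2) ^+ 3 - 0 ^+ 3 = 6 - s ^+ 3.
  by rewrite e; ring.
by apply/andP; split; lra.
Qed.

(** A smooth function between the indicators of [u <= a] and [u <= a + del]. *)
Definition cutoff a del u : R := 1 - smoothstep ((u - a) * (3 / del)).

Lemma cutoff_itv a del u : 0 <= cutoff a del u <= 1.
Proof.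
by have /andP[? ?] := smoothstep_itv ((u - a) * (3 / del)); apply/andP; split; rewrite /cutoff; lra.
Qed.

Lemma cutoff_left a del u : 0 < del -> u <= a -> cutoff a del u = 1.
Proof.
move=> d0 ua; rewrite /cutoff smoothstep_le0E ?subr0//.
by rewrite mulr_le0_ge0 ?subr_le0// divr_ge0// ltW.
Qed.

Lemma cutoff_right a del u : 0 < del -> a + del <= u -> cutoff a del u = 0.
Proof.
move=> d0 ua; rewrite /cutoff smoothstep_ge3E ?subrr//.
by rewrite mulrA ler_pdivlMr// mulrC ler_pM2r// lerBrDl.
Qed.

Lemma measurable_ppart : measurable_fun setT ppart.
Proof.
apply: measurable_funM; last exact: measurable_cst.
by apply: measurable_funD => //; exact: normr_measurable.
Qed.

Lemma bm_cutoff a del : bm (cutoff a del).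
Proof.
apply: (@bmI _ _ _ _ 1); last first.
  by move=> x; have /andP[? ?] := cutoff_itv a del x; rewrite ger0_norm.
have mp k : measurable_fun setT (fun x => ppart (x - k) ^+ 3).
  apply: measurable_funX.
  apply: (measurableT_comp measurable_ppart).
  by apply: measurable_funB => //; exact: measurable_cst.
have ms : measurable_fun setT smoothstep.
  apply: measurable_funM; last exact: measurable_cst.
  apply: measurable_funB; last exact: mp.
  apply: measurable_funD; last by apply: measurable_funM => //; exact: measurable_cst.
  apply: measurable_funB; last by apply: measurable_funM => //; exact: measurable_cst.
  by have := mp 0; under eq_fun do rewrite subr0.
apply: measurable_funB; first exact: measurable_cst.
apply: (measurableT_comp ms); apply: measurable_funM; last exact: measurable_cst.
by apply: measurable_funB => //; exact: measurable_cst.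
Qed.

Lemma smooth3_cutoff a del : 0 < del ->
  smooth3 (36 / del ^+ 3) (9 / del ^+ 2) (cutoff a del).
Proof.
move=> d0; split; first exact: bm_cutoff.
pose k := 3 / del; have k0 : 0 < k by rewrite divr_gt0.
pose s x := (x - a) * k.
exists (fun x => - ((3 * ppart (s x) ^+ 2 - 9 * ppart (s x - 1) ^+ 2 + 9 * ppart (s x - 2) ^+ 2
       - 3 * ppart (s x - 3) ^+ 2) / 6 * k)).
exists (fun x => - ((ppart (s x) - 3 * ppart (s x - 1) + 3 * ppart (s x - 2) - ppart (s x - 3)) * k ^+ 2)).
have k2 : 9 / del ^+ 2 = k ^+ 2 by rewrite /k expr_div_n; congr (_ / _); ring.
have k3 : 36 / del ^+ 3 = 4 / 3 * k ^+ 3.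
  by rewrite /k expr_div_n mulrA; congr (_ / _); field.
split=> [x|x y].
  rewrite normrN normrM k2 [`|k ^+ 2|]ger0_norm ?exprn_ge0 ?(ltW k0)//.
  by rewrite ler_piMl ?exprn_ge0 ?(ltW k0)// smoothstep_curvature.
have := smoothstep_taylor (s x) (y * k).
have -> : s x + y * k = (x + y - a) * k by rewrite /s; ring.
have -> : 4 / 3 * `|y * k| ^+ 3 = 36 / del ^+ 3 * `|y| ^+ 3.
  by rewrite normrM (gtr0_norm k0) k3; ring.
move=> h; apply: le_trans h; rewrite -normrN; apply: le_of_eq.
by congr `|_|; rewrite /cutoff -/k -/(s x); ring.
Qed.

Definition below t u : R := (u <= t)%R%:R.

Lemma below_window t del u : 0 <= del ->
  below (t + del) u <= below t u + window t del u.
Proof.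
move=> d0; rewrite /below /window; case: (leP u t) => ut.
  by rewrite (le_trans ut) ?lerDl ?ler0n.
by rewrite (ltW ut) /= add0r.
Qed.

Lemma cutoff_le_below a del u : 0 < del -> cutoff a del u <= below (a + del) u.
Proof.
move=> d0; rewrite /below; case: (leP u (a + del)) => h.
  by have /andP[] := cutoff_itv a del u.
by rewrite cutoff_right// ltW.
Qed.

Lemma below_le_cutoff a del u : 0 < del -> below a u <= cutoff a del u.
Proof.
move=> d0; rewrite /below; case: (leP u a) => h; first by rewrite cutoff_left.
by have /andP[] := cutoff_itv a del u.
Qed.

Context {d : measure_display} {Omega : measurableType d}.

(** Outside the event [del < D], which the Markov inequality controls, the indicator
    of [S <= t] lies between two cutoffs of [L], and these differ from [below t]
    on intervals of length [2 * del] only. *)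
Lemma cdf_compare (P : probability Omega R) (S L D : Omega -> R) (l : seq R)
    (kap alp del t : R) :
  measurable_fun setT S -> measurable_fun setT L -> bm D ->
  (forall w, `|S w - L w| <= D w) -> 0 < del ->
  (forall a, `|mean P (fun w => cutoff a del (L w)) - rads l (cutoff a del) 0| <= kap) ->
  (forall a x, rads l (window a (del + del)) x <= alp) ->
  `|fine (P [set w | S w <= t]) - rads l (below t) 0| <= alp + kap + mean P D / del.
Proof.
move=> mS mL bD SLD d0 smooth anti.
have D0 w : 0 <= D w by exact: le_trans (SLD w).
have mSt := measurable_ler t mS.
have mDd := measurable_gtr del (bm_measurable bD).
have tail := markov_mean P bD D0 d0.
have bcL a : bm (fun w => cutoff a del (L w)) by apply: bm_comp (bm_cutoff a del).
have b1 := bm_indic (R := R) mSt; have b2 := bm_indic (R := R) mDd.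
rewrite -(mean_indic P mDd) in tail; rewrite -(mean_indic P mSt).
have up : mean P \1_[set w | S w <= t] <=
    mean P (fun w => cutoff (t + del) del (L w)) + mean P \1_[set w | del < D w].
  rewrite -meanD//; apply: le_mean => //; first exact: bmD.
  move=> w; rewrite !indicE; have [/= Sw|Sw] := boolP (w \in [set w | S w <= t]); last first.
    by rewrite addr_ge0// ?ler0n//; have /andP[] := cutoff_itv (t + del) del (L w).
  rewrite inE /= in Sw; have [Dw|Dw] := boolP (w \in [set w | del < D w]).
    by rewrite lerDr; have /andP[] := cutoff_itv (t + del) del (L w).
  rewrite notin_setE /= in Dw; move/negP: Dw; rewrite -leNgt => Dw.
  rewrite addr0 cutoff_left//.
  by have := SLD w; rewrite ler_norml => /andP[? ?]; lra.
have lo : mean P (fun w => cutoff (t - (del + del)) del (L w)) <=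
    mean P \1_[set w | S w <= t] + mean P \1_[set w | del < D w].
  rewrite -meanD//; apply: le_mean => //; first exact: bmD.
  move=> w; rewrite !indicE; have [Dw|Dw] := boolP (w \in [set w | del < D w]).
    rewrite (@le_trans _ _ 1)//; last by rewrite lerDr ler0n.
    by have /andP[] := cutoff_itv (t - (del + del)) del (L w).
  rewrite notin_setE /= in Dw; move/negP: Dw; rewrite -leNgt => Dw.
  rewrite addr0; have [/= Sw|Sw] := boolP (w \in [set w | S w <= t]).
    by have /andP[] := cutoff_itv (t - (del + del)) del (L w).
  rewrite notin_setE /= in Sw; move/negP: Sw; rewrite -ltNge => Sw.
  rewrite cutoff_right//.
  by have := SLD w; rewrite ler_norml => /andP[? ?]; lra.
have ru : rads l (cutoff (t + del) del) 0 <= rads l (below t) 0 + alp.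
  apply: (@le_trans _ _ (rads l (fun u => below t u + window t (del + del) u) 0)).
    apply: le_rads => u; rewrite (le_trans (cutoff_le_below _ _ d0))// -addrA.
    by apply: below_window; rewrite addr_ge0// ltW.
  by rewrite radsD lerD2l.
have rl : rads l (below t) 0 <= rads l (cutoff (t - (del + del)) del) 0 + alp.
  apply: (@le_trans _ _ (rads l (fun u => cutoff (t - (del + del)) del u +
      window (t - (del + del)) (del + del) u) 0)).
    apply: le_rads => u; have dd : 0 <= del + del by rewrite addr_ge0// ltW.
    have := @below_window (t - (del + del)) (del + del) u dd; rewrite subrK => /le_trans.
    by apply; rewrite lerD2r below_le_cutoff.
  by rewrite radsD lerD2l.
have s1 := smooth (t + del); have s2 := smooth (t - (del + del)).
move: up lo ru rl tail s1 s2; rewrite !ler_norml.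
move: (mean P \1_[set w | S w <= t]) (mean P \1_[set w | del < D w]) (rads l (below t) 0)
  (mean P D / del) => p q r u.
move: (rads l _ 0) (rads l _ 0) (mean P _) (mean P _) => x y z v.
by move=> ? ? ? ? ? /andP[? ?] /andP[? ?]; apply/andP; split; lra.
Qed.

End Cutoff.

(** * Distribution of the empirical cost *)

Section Reindex.
Context {R : realType}.

Lemma sum_enum_val (I : finType) (F : I -> R) :
  \sum_(r < #|I|) F (enum_val r) = \sum_(i : I) F i.
Proof.
rewrite -(big_enum_val (fun i => F i)) /=; apply: eq_bigl => i; by rewrite inE.
Qed.

End Reindex.

Definition var {d : measure_display} {T : measurableType d} {R : realType}
  (mu : probability T R) (f : T -> R) : R := mean mu (fun a => (f a - mean mu f) ^+ 2).

Section EmpiricalCost.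
Context {R : realType} {m d : nat}.
Local Notation T := (borelV R d).
Variables (eps : R) (X : 'I_m -> set 'rV[R]_d) (c : 'M[R]_(m, d) -> R).
Variables (f : 'I_m -> T -> R) (K F p B : R).
Local Notation cst := (@cost R m d X c).
Hypotheses (m0 : (0 < m)%N) (eps0 : 0 < eps) (bc : bm cst) (cK : forall x, `|cst x| <= K).
Hypotheses (bf : forall j, bm (f j)) (fF : forall j a, `|f j a| <= F).
Hypotheses (p0 : 0 < p) (pf : forall x, p <= gibbs eps cst f x).
Hypothesis zB : forall x, `|excess eps cst f x| <= B.

Local Notation z := (excess eps cst f).

Let bz : bm z. Proof. exact: bm_excess. Qed.

Let B0 : 0 <= B. Proof. exact: le_trans (zB point). Qed.

Let F0 : 0 <= F. Proof. exact: le_trans (fF (Ordinal m0) point). Qed.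

Definition Seps (mu : 'I_m -> probability T R) : R := fine (S_eps eps X c mu).

(** The order of magnitude of the nonlinear part of the rescaled cost at
    sample size [n.+1]. It vanishes asymptotically at the population measure,
    and in expectation it is reproduced, up to a constant, by sampling. *)
Definition err (n : nat) (mu : 'I_m -> probability T R) : R :=
  Num.sqrt n.+1%:R * (n.+1%:R * mean (tensor mu) z ^+ 2 +
    \sum_(j < m) defect eps cst mu f j + n.+1%:R^-1).

Lemma err_ge0 n mu : 0 <= err n mu.
Proof.
apply: mulr_ge0; first exact: sqrtr_ge0.
apply: addr_ge0; last by rewrite invr_ge0.
apply: addr_ge0; first by apply: mulr_ge0; rewrite // sqr_ge0.
by apply: sumr_ge0 => j _; apply: mean_ge0 => a; exact: sqr_ge0.
Qed.

Definition remainder_cst : R :=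
  eps + eps * expR ((potential_bound (m:=m) K + m%:R * F) / eps) / p * (1 + B).

Lemma remainder_cst_ge0 : 0 <= remainder_cst.
Proof.
rewrite addr_ge0 ?(ltW eps0)// !mulr_ge0 ?(ltW eps0) ?expR_ge0 ?invr_ge0 ?(ltW p0)//.
by rewrite addr_ge0.
Qed.

(** Compare the dual functional at [f] and at the empirical potentials, by
    [dual_le] and [dual_gap]; the term linear in the mean excess is absorbed by
    [norm_le_sqr]. *)
Lemma Seps_empirical n (x : 'I_m -> 'I_n.+1 -> T) :
  Num.sqrt n.+1%:R * `|Seps (fun j => empirical (x j)) -
    \sum_(j < m) mean (empirical (x j)) (f j)| <=
  remainder_cst * err n (fun j => empirical (x j)).
Proof.
have [fh [bfh fhB fhS _]] := empirical_potentials m0 eps0 bc cK x.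
pose mu j : probability T R := empirical (x j).
rewrite /Seps (S_eps_schrodinger m0 eps0 bc bfh fhS) /= -/mu.
have lo := dual_le eps0 bc m0 bf bfh fhS.
have HL y : `|oplus fh y - oplus f y| <= potential_bound (m:=m) K + m%:R * F.
  rewrite (le_trans (ler_normB _ _))// lerD//.
  rewrite (le_trans (ler_norm_sum _ _ _))//.
  rewrite (le_trans (ler_sum _ (fun j _ => fF j (tnth y j))))//.
  by rewrite sumr_const card_ord -[_ *+ m]mulr_natl.
have hi := dual_gap eps0 bc m0 bf bfh fhS HL p0 pf.
rewrite -/mu in lo hi.
set w := mean (tensor mu) z; set G := \sum_(j < m) defect eps cst mu f j.
have wB : `|w| <= B by exact: mean_norm_le.
have G0 : 0 <= G by apply: sumr_ge0 => j _; apply: mean_ge0 => a; exact: sqr_ge0.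
pose N : R := n.+1%:R; have N0 : 0 < N by rewrite ltr0n.
pose k := eps * expR ((potential_bound (m:=m) K + m%:R * F) / eps) / p.
have k0 : 0 <= k by rewrite /k !mulr_ge0 ?(ltW eps0) ?expR_ge0 ?invr_ge0 ?(ltW p0).
have key : `|\sum_(j < m) mean (mu j) (fh j) - \sum_(j < m) mean (mu j) (f j)| <=
    remainder_cst * (`|w| + G).
  move: lo hi; rewrite /dual -/w -/G -/k.
  move: (\sum_(j < m) mean (mu j) (fh j)) (\sum_(j < m) mean (mu j) (f j)) => u v lo hi.
  have w2 : w ^+ 2 <= B * `|w| by rewrite -(real_normK (num_real w)) expr2 ler_wpM2r.
  have w1 : - `|w| <= w <= `|w| by rewrite -ler_norml.
  have h1 : k * (G + w ^+ 2) <= k * (1 + B) * (`|w| + G).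
    rewrite -mulrA ler_wpM2l//.
    have := mulr_ge0 B0 G0; have := normr_ge0 w; lra.
  have h2 : `|eps * w| <= eps * (`|w| + G).
    by rewrite normrM gtr0_norm// ler_wpM2l ?(ltW eps0)// lerDl.
  rewrite /remainder_cst -/k mulrDl.
  have h3 : 0 <= k * (1 + B) * (`|w| + G).
    by apply: mulr_ge0; [apply: mulr_ge0 => //; rewrite addr_ge0|exact: addr_ge0].
  move: h2; rewrite ler_norml => /andP[? ?].
  by rewrite ler_norml; apply/andP; split; lra.
apply: (@le_trans _ _ (Num.sqrt N * (remainder_cst * (`|w| + G)))).
  by rewrite ler_wpM2l ?sqrtr_ge0.
rewrite mulrCA ler_wpM2l ?remainder_cst_ge0// ler_wpM2l ?sqrtr_ge0//.
rewrite -/mu -/w -/G -/N [leRHS]addrAC lerD2r.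
exact: norm_le_sqr.
Qed.

Section OneSample.
Context {dO : measure_display} {Omega : measurableType dO}.
Variables (n : nat) (P : probability Omega R) (mu : 'I_m -> probability T R).
Variable Y : 'I_m -> 'I_n.+1 -> {mfun Omega >-> T}.
Hypotheses (n0 : (0 < n)%N).
Hypothesis Yind : independent_sample P (fun q : 'I_m * 'I_n.+1 => mu q.1)
  (fun q => Y q.1 q.2).

Local Notation N := (n.+1%:R : R).
Local Notation emp w := (fun j : 'I_m => empirical (fun i => Y j i w) : probability T R).

Let N0 : 0 < N. Proof. by rewrite ltr0n. Qed.

Let sN0 : 0 < Num.sqrt N. Proof. by rewrite sqrtr_gt0. Qed.

Let bmsample s : bm (fun w => z (sample (fun j (i : idx n) => Y j i w) s)).
Proof. by apply: (bm_comp _ bz); apply: measurable_mktuple => j. Qed.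

Let bmw : bm (fun w => mean (tensor (emp w)) z).
Proof.
rewrite (_ : (fun w => _) = fun w => mean (tensor (fun=> uniform)) (fun s =>
    z (sample (fun j (i : idx n) => Y j i w) s))).
  by apply: bm_mean_idx => s; exact: bmsample.
by apply/funext => w; rewrite -mean_tensor_empirical.
Qed.

Let bmdefect j : bm (fun w => defect eps cst (emp w) f j).
Proof.
rewrite (_ : (fun w => _) = fun w => n.+1%:R^-1 * \sum_(i < n.+1)
   (mean (tensor (fun=> uniform)) (fun s =>
    z (sample (fun j (i : idx n) => Y j i w) (tset s j i)))) ^+ 2).
  apply: bmM; first exact: bm_cst.
  by apply: bm_sum => i _; apply: bmX; apply: bm_mean_idx => s; exact: bmsample.
apply/funext => w; rewrite /defect mean_empirical; last first.
  by apply: bmX; exact: bm_marginal.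
congr (_ * _); apply: eq_bigr => i _; congr (_ ^+ 2).
rewrite /marginal (mean_tensor_empirical (fun j (i : idx n) => Y j i w) (bm_tset j (Y j i w) bz)).
by apply: eq_mean => s; rewrite (tset_sample (fun j (i : idx n) => Y j i w)).
Qed.

Lemma bm_err : bm (fun w => err n (emp w)).
Proof.
apply: bmM; first exact: bm_cst.
apply: bmD; last exact: bm_cst.
apply: bmD; last exact: bm_sum.
by apply: bmM; [exact: bm_cst|exact: bmX].
Qed.

Definition err_cst : R := 2 + 2 * m%:R ^+ 2 * B ^+ 2.

(** What allows the expansion to be iterated, from the data to the samples that
    are drawn from the data. *)
Lemma mean_err : mean P (fun w => err n (emp w)) <= err_cst * err n mu.
Proof.
rewrite meanZ; last first.
  apply: bmD; last exact: bm_cst.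
  by apply: bmD; [apply: bmM; [exact: bm_cst|exact: bmX]|exact: bm_sum].
rewrite mulrCA ler_wpM2l ?sqrtr_ge0//.
rewrite meanD; [|apply: bmD; [apply: bmM; [exact: bm_cst|exact: bmX]|exact: bm_sum]
  |exact: bm_cst].
rewrite meanD; [|by apply: bmM; [exact: bm_cst|exact: bmX]|exact: bm_sum].
rewrite mean_cst meanZ; last exact: bmX.
rewrite mean_sum//.
have h1 := second_moment Yind bz zB n0.
have h2 : \sum_(j < m) mean P (fun w => defect eps cst (emp w) f j) <=
    \sum_(j < m) (defect eps cst mu f j + m%:R * B ^+ 2 / N).
  by apply: ler_sum => j _; exact: (second_moment_marginal Yind bz zB n0 j).
rewrite big_split/= sumr_const card_ord -[_ *+ m]mulr_natl in h2.
move: h1 h2; set w2 := mean (tensor mu) z ^+ 2.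
set G := \sum_(j < m) defect eps cst mu f j.
have w20 : 0 <= w2 by exact: sqr_ge0.
have G0 : 0 <= G by apply: sumr_ge0 => j _; apply: mean_ge0 => a; exact: sqr_ge0.
set a := mean P _; set b := \sum_(j < m) _ => h1 h2.
have {}h1 : N * a <= N * w2 + G + m%:R ^+ 2 * B ^+ 2 / N.
  have key (q u v M : R) : 0 < q ->
      q * (u + q^-1 * v + (M * B / q) ^+ 2) = q * u + v + M ^+ 2 * B ^+ 2 / q.
    by move=> q0; field; rewrite gt_eqF.
  by rewrite -(key _ _ _ _ N0) ler_wpM2l ?(ltW N0).
have mB : 0 <= m%:R ^+ 2 * B ^+ 2 :> R by rewrite mulr_ge0 ?sqr_ge0.
have mBw : 0 <= m%:R ^+ 2 * B ^+ 2 * (N * w2 + G).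
  by rewrite mulr_ge0// addr_ge0// mulr_ge0// ltW.
have -> : err_cst * (N * w2 + G + N^-1) = 2 * (N * w2) + 2 * G + 2 * (m%:R ^+ 2 * B ^+ 2 * (N * w2 + G))
   + 2 * N^-1 + 2 * (m%:R ^+ 2 * B ^+ 2 / N) by rewrite /err_cst; ring.
have e : m%:R * (m%:R * B ^+ 2 / N) = m%:R ^+ 2 * B ^+ 2 / N by ring.
rewrite e in h2.
have fin (b' G' x y r u v : R) : x <= y + G' + v -> b' <= G' + v -> 0 <= u -> 0 <= r ->
  0 <= y -> 0 <= G' -> x + b' + r <= 2 * y + 2 * G' + 2 * u + 2 * r + 2 * v by lra.
by apply: fin => //; rewrite mulr_ge0 ?(ltW N0)// /w2 sqr_ge0.
Qed.

Lemma measurable_Seps : measurable_fun setT (fun w => Seps (emp w)).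
Proof.
apply: (measurable_empirical_value m0 eps0 bc (X := fun w j (i : idx n) => Y j i w)) => // w.
have [fh [bfh _ fhS [phi phiS phiE]]] :=
  empirical_potentials m0 eps0 bc cK (fun j (i : idx n) => Y j i w).
exists phi => //.
by rewrite /Seps (S_eps_schrodinger m0 eps0 bc bfh fhS).
Qed.

(** The random signed sum that plays the role of the Gaussian limit. *)
Definition signs (sig : 'I_m -> R) : seq R :=
  [seq sig (enum_val r).1 / Num.sqrt N | r <- enum 'I_#|{: 'I_m * 'I_n.+1}|].

Lemma signs_window sig j0 del a x : 0 < sig j0 -> 0 < del ->
  rads (signs sig) (window a (del + del)) x <= del / sig j0 + (Num.sqrt N)^-1.
Proof.
move=> s0 d0; pose s := sig j0 / Num.sqrt N.
have sp : 0 < s by rewrite divr_gt0.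
apply: (@rads_le _ s) => y.
set k := count_mem s _.
have kN : (n.+1 <= k)%N.
  rewrite /k /signs count_map.
  pose g (i : 'I_n.+1) := enum_rank (j0, i).
  have ug : uniq (map g (enum 'I_n.+1)).
    by rewrite map_inj_uniq ?enum_uniq// => i i' /enum_rank_inj[].
  rewrite -[leqLHS](size_enum_ord) -(size_map g) -size_filter; apply: (uniq_leq_size ug).
  by move=> _ /mapP[i _ ->]; rewrite mem_filter /= enum_rankK eqxx mem_enum.
have k0 : (0 < k)%N by exact: leq_trans kN.
have dd0 : 0 <= del + del by rewrite addr_ge0// ltW.
apply: (le_trans (iter_rad_window a y k0 sp dd0)).
apply: (@le_trans _ _ (((del + del) / (2 * s) + 1) / Num.sqrt N)); last first.
  apply: le_of_eq; rewrite /s.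
  by field; rewrite !gt_eqF.
rewrite ler_wpM2l//; last first.
  rewrite lef_pV2 ?posrE ?sqrtr_gt0 ?ltr0n// ler_wsqrtr// ler_nat//.
by rewrite addr_ge0// divr_ge0// mulr_ge0// ltW.
Qed.

(** The three parts of the bound are the concentration of the signed sum on
    intervals of length [2 * del], the Lindeberg error, made of third moments and
    of the mismatch of variances, and the nonlinear part of the cost with the
    error of the centering [s0]. *)
Lemma cdf_empirical_cost sig j0 s0 del t :
  (forall j, `|sig j| <= 2 * F) -> 0 < sig j0 -> 0 < del ->
  `|fine (P [set w | Num.sqrt N * (Seps (emp w) - s0) <= t]) -
    rads (signs sig) (below t) 0| <=
  del / sig j0 + (Num.sqrt N)^-1 +
  (m%:R * (72 * (2 * F) ^+ 3) / (del ^+ 3 * Num.sqrt N) +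
   9 / del ^+ 2 * \sum_(j < m) `|var (mu j) (f j) - sig j ^+ 2|) +
  (remainder_cst * (err_cst * err n mu) +
   Num.sqrt N * `|s0 - \sum_(j < m) mean (mu j) (f j)|) / del.
Proof.
move=> sigF sj0 d0; pose psi := \sum_(j < m) mean (mu j) (f j).
pose e (r : 'I_#|{: 'I_m * 'I_n.+1}|) : 'I_m * 'I_n.+1 := enum_val r.
pose zeta r (a : T) := (f (e r).1 a - mean (mu (e r).1) (f (e r).1)) / Num.sqrt N.
pose L w := Num.sqrt N * (\sum_(j < m) mean (emp w j) (f j) - psi).
pose D w := remainder_cst * err n (emp w) + Num.sqrt N * `|s0 - psi|.
have bzeta r : bm (zeta r) by apply: bmM; [apply: bmB => //|]; exact: bm_cst.
have LE w : L w = oplus zeta [tuple Y (e r).1 (e r).2 w | r < _].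
  rewrite /oplus (eq_bigr (fun r => (f (e r).1 (Y (e r).1 (e r).2 w) -
    mean (mu (e r).1) (f (e r).1)) / Num.sqrt N)); last by move=> r _; rewrite tnth_mktuple.
  rewrite (sum_enum_val (fun q : 'I_m * 'I_n.+1 => (f q.1 (Y q.1 q.2 w) - mean (mu q.1) (f q.1)) / Num.sqrt N)).
  rewrite -(pair_bigA _ (fun j i => (f j (Y j i w) - mean (mu j) (f j)) / Num.sqrt N))/=.
  rewrite /L /psi -sumrB mulr_sumr; apply: eq_bigr => j _.
  rewrite mean_empirical// -mulr_suml sumrB sumr_const card_ord.
  have key (q u v : R) : 0 < q -> q * ((q ^+ 2)^-1 * u - v) = (u - q ^+ 2 * v) / q.
    by move=> q0; field; rewrite gt_eqF.
  have := key _ (\sum_(i < n.+1) f j (Y j i w)) (mean (mu j) (f j)) sN0.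
  by rewrite sqr_sqrtr ?(ltW N0)// => ->; rewrite mulr_natl.
have bL : bm L.
  rewrite (_ : L = fun w => oplus zeta [tuple Y (e r).1 (e r).2 w | r < _]); last exact/funext.
  by apply: (bm_comp _ (bm_oplus bzeta)); apply: measurable_mktuple => r.
have bD : bm D by apply: bmD; [apply: bmM; [exact: bm_cst|exact: bm_err]|exact: bm_cst].
have mS : measurable_fun setT (fun w => Num.sqrt N * (Seps (emp w) - s0)).
  apply: measurable_funM; first exact: measurable_cst.
  by apply: measurable_funB; [exact: measurable_Seps|exact: measurable_cst].
have SLD w : `|Num.sqrt N * (Seps (emp w) - s0) - L w| <= D w.
  have -> : Num.sqrt N * (Seps (emp w) - s0) - L w =
     Num.sqrt N * (Seps (emp w) - \sum_(j < m) mean (emp w j) (f j)) -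
     Num.sqrt N * (s0 - psi) by rewrite /L; ring.
  rewrite (le_trans (ler_normB _ _))// lerD//.
    by rewrite normrM gtr0_norm// Seps_empirical.
  by rewrite normrM gtr0_norm.
have b0 : 0 <= 2 * F / Num.sqrt N by rewrite divr_ge0 ?mulr_ge0 ?sqrtr_ge0.
have smooth a : `|mean P (fun w => cutoff a del (L w)) - rads (signs sig) (cutoff a del) 0| <=
   m%:R * (72 * (2 * F) ^+ 3) / (del ^+ 3 * Num.sqrt N) +
   9 / del ^+ 2 * \sum_(j < m) `|var (mu j) (f j) - sig j ^+ 2|.
  have -> : mean P (fun w => cutoff a del (L w)) =
      mean (tensor (fun r => mu (e r).1)) (fun y => cutoff a del (0 + oplus zeta y)).
    rewrite -(mean_sample Yind (@enum_val_inj _ _) (F := fun y => cutoff a del (0 + oplus zeta y))); last first.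
      apply: (bm_comp _ (bm_cutoff a del)); apply: measurable_funD; first exact: measurable_cst.
      exact: (bm_measurable (bm_oplus bzeta)).
    by apply: eq_mean => w; rewrite add0r LE.
  have K0 : 0 <= 36 / del ^+ 3 by rewrite divr_ge0// exprn_ge0// ltW.
  have z0 r : mean (mu (e r).1) (zeta r) = 0.
    rewrite meanZr; last by apply: bmB => //; exact: bm_cst.
    by rewrite meanB// ?mean_cst ?subrr ?mul0r//; exact: bm_cst.
  have zb r a' : `|zeta r a'| <= 2 * F / Num.sqrt N.
    rewrite normrM [`|_^-1|]gtr0_norm ?invr_gt0// ler_pM2r ?invr_gt0//.
    rewrite (le_trans (ler_normB _ _))// mulr_natl mulr2n lerD//.
    by apply: mean_norm_le.
  have sb r : `|sig (e r).1 / Num.sqrt N| <= 2 * F / Num.sqrt N.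
    by rewrite normrM [`|_^-1|]gtr0_norm ?invr_gt0// ler_pM2r ?invr_gt0.
  have := @lindeberg R _ _ _ (fun r => mu (e r).1) zeta _ _ (2 * F / Num.sqrt N)
    (fun r => sig (e r).1 / Num.sqrt N) (cutoff a del) 0 K0 (smooth3_cutoff a d0)
    bzeta z0 zb sb.
  move/le_trans; apply.
  have vE r : mean (mu (e r).1) (fun a0 => zeta r a0 ^+ 2) - (sig (e r).1 / Num.sqrt N) ^+ 2 =
      (var (mu (e r).1) (f (e r).1) - sig (e r).1 ^+ 2) / N.
    rewrite expr_div_n sqr_sqrtr ?(ltW N0)// mulrBl; congr (_ - _).
    rewrite /var -meanZr; last by apply: bmX; apply: bmB => //; exact: bm_cst.
    by apply: eq_mean => a0; rewrite expr_div_n sqr_sqrtr// ltW.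
  pose H (q : 'I_m * 'I_n.+1) := 2 * (36 / del ^+ 3) * (2 * F / Num.sqrt N) ^+ 3 +
     9 / del ^+ 2 * (`|var (mu q.1) (f q.1) - sig q.1 ^+ 2| / N).
  rewrite (eq_bigr (fun r => H (e r))); last first.
    by move=> r _; rewrite vE normrM [`|_^-1|]gtr0_norm ?invr_gt0.
  rewrite (sum_enum_val H) -(pair_bigA _ (fun j i => H (j, i)))/= /H /=.
  under eq_bigr do rewrite sumr_const card_ord -[_ *+ n.+1]mulr_natl mulrDr.
  rewrite big_split/= sumr_const card_ord -[_ *+ m]mulr_natl lerD//.
    have sNN : N = Num.sqrt N ^+ 2 by rewrite sqr_sqrtr// ltW.
    rewrite [X in _ * (X * _)]sNN; apply: le_of_eq.
    by field; rewrite !gt_eqF.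
  rewrite mulr_sumr; apply: ler_sum => j _; rewrite mulrCA ler_wpM2l//.
    by rewrite divr_ge0// exprn_ge0// ltW.
  by rewrite mulrCA mulfV ?gt_eqF// mulr1.
have := @cdf_compare R _ Omega P _ L D (signs sig) _ _ del t mS (bm_measurable bL) bD SLD d0 smooth
  (fun a x => signs_window a x sj0 d0).
move/le_trans; apply; rewrite lerD2l ler_pM2r ?invr_gt0//.
rewrite meanD; [|by apply: bmM; [exact: bm_cst|exact: bm_err]|exact: bm_cst].
rewrite mean_cst meanZ; last exact: bm_err.
by rewrite lerD2r ler_wpM2l ?remainder_cst_ge0// mean_err.
Qed.

End OneSample.

End EmpiricalCost.

(** * Measurability of a continuous cost *)

Section ContinuousCost.
Context {R : realType} {m d : nat}.
Local Notation T := (borelV R d).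
Variables (X : 'I_m -> set 'rV[R]_d) (c : 'M[R]_(m, d) -> R).
Hypotheses (cX : forall j, compact (X j)) (cc : {within prod_domain X, continuous c}).

(** Tychonoff's theorem for matrices: the rows of an ultrafilter converge. *)
Lemma compact_prod_domain : compact (prod_domain X).
Proof.
rewrite compact_ultra => F FU FD.
have lim_row j : exists p, X j p /\ forall B, nbhs p B -> F (row j @^-1` B).
  have surj_row : (row j : 'M[R]_(m, d) -> 'rV[R]_d) @` setT = setT.
    apply/seteqP; split=> // v _; exists (\matrix_(_, i) v ord0 i) => //.
    by apply/rowP => i; rewrite !mxE.
  have GU := ultra_image FU surj_row.
  have := @cX j; rewrite compact_ultra => /(_ _ GU)[].
    apply: (@filterS _ _ _ (row j @` prod_domain X)); last by exists (prod_domain X).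
    by move=> _ [x Dx <-]; exact: Dx.
  move=> p [Xp Gp]; exists p; split=> // B /Gp[A FA AB].
  by apply: filterS FA => x Ax; rewrite /preimage /= -AB; exists x.
have [p pP] := choice lim_row.
exists (\matrix_(j, i) p j ord0 i); split.
  move=> j; rewrite (_ : row j _ = p j); first by have [] := pP j.
  by apply/rowP => i; rewrite !mxE.
move=> A [Q nQ QA]; apply: (@filterS _ _ _ _ _ QA).
apply: filter_forall => j; apply: filter_forall => i.
have [_ /(_ [set v | Q j i (v ord0 i)])] := pP j.
have nb : nbhs (p j) [set v : 'rV[R]_d | Q j i (v ord0 i)].
  apply: (@coord_continuous R 1 d ord0 i (p j)).
  by have := nQ j i; rewrite mxE.
by move=> /(_ nb); apply: filterS => x /=; rewrite mxE.
Qed.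

Lemma measurable_coordinate i : measurable_fun setT (fun a : T => (a : 'rV[R]_d) ord0 i).
Proof.
apply: (measurability _ (RGenOpens.measurableE R)) => _ [_ [a [b ->] <-]].
rewrite setTI; apply: sub_sigma_algebra; apply: open_comp; last exact: interval_open.
by move=> v _; exact: coord_continuous.
Qed.

Lemma closed_measurable_borelV (A : set 'rV[R]_d) : closed A -> measurable (A : set T).
Proof.
move=> cA; rewrite -(setCK A); apply: measurableC; apply: sub_sigma_algebra.
exact: closed_openC.
Qed.

Lemma row_stack (x : m.-tuple T) j : row j (stack x) = tnth x j.
Proof. by apply/rowP => i; rewrite !mxE. Qed.

(** A countable base of the topology. The sigma-algebra on tuples only knows the
    coordinates, so open sets of matrices are measured through such a base. *)
Definition rational_box (q : 'M[rat]_(m, d) * rat) : set 'M[R]_(m, d) :=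
  [set N | forall j i, `|N j i - ratr (q.1 j i)| < ratr q.2].

Lemma measurable_stack_box q : measurable (stack @^-1` rational_box q : set (m.-tuple T)).
Proof.
rewrite (_ : _ @^-1` _ = \bigcap_(j : 'I_m) \bigcap_(i : 'I_d)
    [set x | `|(tnth x j : 'rV[R]_d) ord0 i - ratr (q.1 j i)| < ratr q.2]).
  apply: fin_bigcap_measurable => // j _; apply: fin_bigcap_measurable => // i _.
  pose g (x : m.-tuple T) := `|(tnth x j : 'rV[R]_d) ord0 i - ratr (q.1 j i)|.
  have mg : measurable_fun setT g.
    apply: measurableT_comp => //; apply: measurable_funB => //.
    apply: (measurableT_comp (measurable_coordinate i)); exact: measurable_tnth.
  rewrite (_ : [set x | _] = ~` [set x | ratr q.2 <= g x]).
    apply: measurableC; rewrite -[X in measurable X]setTI -preimage_itvcy.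
    exact: mg.
  by apply/seteqP; split => x /=; rewrite ltNge => /negP.
apply/seteqP; split => x /=.
  by move=> h j _ i _; have := h j i; rewrite mxE.
by move=> h j i; rewrite mxE; exact: h.
Qed.

Lemma open_rational_box (V : set 'M[R]_(m, d)) : open V ->
  V = \bigcup_(q in [set q | rational_box q `<=` V]) rational_box q.
Proof.
move=> oV; apply/seteqP; split => [x Vx|x [q qV]]; last exact: qV.
have /nbhs_ballP[e /= e0 eV] : nbhs x V by apply: open_nbhs_nbhs.
have [r] : exists r : rat, ratr r \in `]0, e / 2[%R by apply: rat_in_itvoo; rewrite divr_gt0.
rewrite in_itv /= => /andP[r0 re].
have near_rat (j : 'I_m) (i : 'I_d) : exists q : rat, `|x j i - ratr q| < ratr r.
  have [q] : exists q : rat, ratr q \in `](x j i - ratr r), (x j i)[%R.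
    by apply: rat_in_itvoo; rewrite ltrBlDr ltrDl.
  rewrite in_itv /= => /andP[h1 h2]; exists q.
  by rewrite gtr0_norm ?subr_gt0// ltrBlDr addrC -ltrBlDr.
have {}near_rat (p : 'I_m * 'I_d) := near_rat p.1 p.2.
have [q qx] := choice near_rat.
exists (\matrix_(j, i) q (j, i), r) => /=; last first.
  by move=> j i; rewrite mxE; exact: (qx (j, i)).
move=> y yq; apply: eV; split => // j i; rewrite /ball /=.
have := qx (j, i); have := yq j i; rewrite mxE /= => h1 h2.
have -> : x j i - y j i = (x j i - ratr (q (j, i))) - (y j i - ratr (q (j, i))) by ring.
by rewrite (le_lt_trans (ler_normB _ _))//; lra.
Qed.

Lemma measurable_stack_open (V : set 'M[R]_(m, d)) : open V ->
  measurable (stack @^-1` V : set (m.-tuple T)).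
Proof.
move=> /open_rational_box ->; rewrite preimage_bigcup bigcup_mkcond.
apply: countable_bigcupT_measurable; first exact: countableP.
by move=> q; case: ifP => // _; exact: measurable_stack_box.
Qed.

Lemma measurable_stack_domain : measurable (stack @^-1` prod_domain X : set (m.-tuple T)).
Proof.
rewrite (_ : _ @^-1` _ = \bigcap_(j : 'I_m) (fun x : m.-tuple T => tnth x j) @^-1` X j).
  apply: fin_bigcap_measurable => // j _; rewrite -[X in measurable X]setTI.
  apply: measurable_tnth => //; apply: closed_measurable_borelV.
  exact: (compact_closed (@norm_hausdorff R 'rV[R]_d) (@cX j)).
apply/seteqP; split => x /=; first by move=> h j _ /=; rewrite -row_stack.
by move=> h j; rewrite row_stack; exact: h.
Qed.

Lemma bm_cost : bm (cost X c).
Proof.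
have [M [_ MB]] := compact_bounded (continuous_compact (cc : {within _, continuous (c : _ -> R^o)}) compact_prod_domain).
have mD := measurable_stack_domain.
apply: (@bmI _ _ _ _ (`|M| + 1)); last first.
  move=> x; rewrite /cost patchE; case: ifPn => [|_]; last by rewrite normr0 addr_ge0.
  rewrite inE => Dx; apply: MB; last by exists (stack x).
  by rewrite (le_lt_trans (ler_norm _))// ltrDl.
apply/(measurable_restrictT _ mD) => //.
apply: (measurability _ (RGenOpens.measurableE R)) => _ [_ [a [b ->] <-]].
have /open_subspaceP[V oV VE] : open (c @^-1` `]a, b[%classic : set (subspace (prod_domain X))).
  by move/continuousP : cc; apply; exact: interval_open.
rewrite (_ : _ `&` _ = stack @^-1` (V `&` prod_domain X)).
  by rewrite preimage_setI; apply: measurableI => //; exact: measurable_stack_open.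
by rewrite VE preimage_setI setIC.
Qed.

End ContinuousCost.

(** * Optimal potentials solve the Schrodinger system *)

Section EssentiallyBounded.
Context {disp : measure_display} {T : measurableType disp} {R : realType}.
Variable mu : probability T R.

Let mu_gt0 : (0 < mu setT)%E. Proof. by rewrite probability_setT. Qed.

Lemma bm_Lfun f : bm f -> f \in Lfun mu +oo%E.
Proof.
move=> [mf [B fB]]; apply/andP; split; rewrite inE //= /finite_norm.
rewrite Lnorm.unlock mu_gt0; apply: (@le_lt_trans _ _ B%:E); last exact: ltry.
by apply/ess_sup_inf.ess_supP; apply: aeW => x /=; rewrite lee_fin.
Qed.

Lemma Lfun_bm f : f \in Lfun mu +oo%E ->
  measurable_fun setT f /\ exists2 g, bm g & {ae mu, forall x, f x = g x}.
Proof.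
move=> /andP[]; rewrite !inE /= => mf.
rewrite /finite_norm Lnorm.unlock mu_gt0 => /(@ess_sup_inf.ess_supr_bounded _ _ _ mu (fun x => `|f x|))[M fM].
split=> //; exists (fun x => Num.max (- M) (Num.min M (f x))).
  apply: (@bmI _ _ _ _ `|M|).
    by apply: measurable_maxr => //; exact: measurable_minr.
  move=> x; rewrite ler_norml le_max lerN2 ler_norm/= ge_max ge_min ler_norm/= andbT.
  by rewrite (le_trans (ler_norm _))// normrN.
apply: filterS fM => x; rewrite ler_norml => /andP[h1 h2].
by rewrite min_r// max_r.
Qed.

Lemma ae_tnth n (nu : 'I_n -> probability T R) j (A : T -> Prop) :
  {ae nu j, forall a, A a} -> {ae tensor nu, forall x, A (tnth x j)}.
Proof.
move=> [N [mN N0 AN]].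
have mtN : measurable [set x : n.-tuple T | N (tnth x j)].
  by rewrite -[X in measurable X]setTI; exact: measurable_tnth.
exists [set x : n.-tuple T | N (tnth x j)]; split => //; last by move=> x Ax; exact: AN.
have := mean_tnth nu j (bm_indic mN).
rewrite (@mean_indic _ _ _ (nu j))// N0 /=.
have -> : mean (tensor nu) (fun x => \1_N (tnth x j)) =
    mean (tensor nu) \1_[set x : n.-tuple T | N (tnth x j)].
  by apply: eq_mean => x; rewrite !indicE; congr ((_ : bool)%:R); apply/idP/idP; rewrite !inE.
rewrite mean_indic// => e.
by rewrite -[LHS]fineK ?fin_num_measure// e.
Qed.

End EssentiallyBounded.

Section OptimalPotentials.
Context {R : realType} {m d : nat}.
Local Notation T := (borelV R d).
Variables (eps : R) (X : 'I_m -> set 'rV[R]_d) (c : 'M[R]_(m, d) -> R).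
Variables (nu : 'I_m -> probability T R).
Local Notation cst := (@cost R m d X c).
Hypotheses (m0 : (0 < m)%N) (eps0 : 0 < eps) (cX : forall j, compact (X j)).
Hypotheses (bc : bm cst) (nuX : forall j, nu j (X j) = 1%E).

Let mX j : measurable (X j : set T).
Proof.
apply: closed_measurable_borelV.
exact: (compact_closed (@norm_hausdorff R 'rV[R]_d) (@cX j)).
Qed.

Let mD : measurable (stack @^-1` prod_domain X : set (m.-tuple T)).
Proof. exact: measurable_stack_domain. Qed.

(** The potentials may be modified on null sets, and the domain has full mass. *)
Lemma dual_objectiveE (f g : 'I_m -> T -> R) : (forall j, measurable_fun setT (f j)) ->
  (forall j, bm (g j)) -> (forall j, {ae nu j, forall a, f j a = g j a}) ->
  dual_objective eps X c nu f = dual eps cst nu g - eps.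
Proof.
move=> mf bg fg; rewrite /dual_objective /dual.
have bG := bm_gibbs eps bc bg.
have -> : \sum_(j < m) \int[nu j]_x f j x = \sum_(j < m) mean (nu j) (g j).
  by apply: eq_bigr => j _; apply: mean_ae; [exact: mf|exact: bm_measurable|exact: fg].
pose h x := expR ((\sum_(j < m) f j (tnth x j) - cst x) / eps).
have mh : measurable_fun setT h.
  apply: measurableT_comp => //; apply: measurable_funM => //.
  apply: measurable_funB; last exact: bm_measurable.
  by apply: measurable_sum => j; apply: measurableT_comp => //; exact: measurable_tnth.
have -> : \int[tensor nu]_(x in stack @^-1` prod_domain X)
    expR ((\sum_(j < m) f j (tnth x j) - c (stack x)) / eps) =
    mean (tensor nu) (h \_ (stack @^-1` prod_domain X)).
  rewrite /mean [RHS]/Rintegral /Rintegral integral_mkcond; congr fine.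
  apply: eq_integral => x _; rewrite !patchE; case: ifPn => // xD.
  by rewrite /h /cost patchE xD.
have -> : mean (tensor nu) (h \_ (stack @^-1` prod_domain X)) = mean (tensor nu) (gibbs eps cst g).
  apply: mean_ae; [exact/(measurable_restrictT _ mD)/measurable_funTS|exact: bm_measurable|].
  have aeD j : {ae tensor nu, forall x, X j (tnth x j) /\ f j (tnth x j) = g j (tnth x j)}.
    apply: (@ae_tnth _ _ _ m nu j (fun a => X j a /\ f j a = g j a)).
    apply: filterI; last exact: fg.
    exists (~` X j); split; [exact: measurableC| |by []].
    by rewrite probability_setC// nuX subee.
  have {}aeD := filter_forall (ae_filter_ringOfSetsType (tensor nu)) aeD.
  apply: filterS aeD => x xD; rewrite patchE mem_set; last first.
    by move=> j; rewrite row_stack; have [] := xD j.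
  rewrite /h /gibbs /oplus (eq_bigr (fun j => g j (tnth x j)))// => j _.
  by have [] := xD j.
by rewrite (mean_gibbs eps bc nu bg); ring.
Qed.

(** Bounded versions of the optimal potentials maximize the dual functional
    among all bounded potentials: the normalization only fixes the constants
    that can be moved from one potential to another. *)
Lemma optimal_bounded (f : 'I_m -> T -> R) : optimal_potentials eps X c nu f ->
  exists g : 'I_m -> T -> R, [/\ forall j, bm (g j),
    forall j, {ae nu j, forall a, f j a = g j a} &
    forall h : 'I_m -> T -> R, (forall j, bm (h j)) -> dual eps cst nu h <= dual eps cst nu g].
Proof.
move=> [[fL _] fmax].
have fP j := Lfun_bm (fL j).
have ex j : exists g, bm g /\ {ae nu j, forall x, f j x = g x}.
  by have [_ [g bg fg]] := fP j; exists g.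
have [g gP] := choice ex.
exists g; split; [by move=> j; have [] := gP j|by move=> j; have [] := gP j|].
move=> h bh.
have [m' em] : exists m', m = m'.+1 by case: m m0 => // m' _; exists m'.
have lp : (m.-1 < m)%N by rewrite em.
pose l : 'I_m := Ordinal lp.
pose s j := if j == l then \sum_(i < m | i != l) mean (nu i) (h i) else - mean (nu j) (h j).
have s0 : \sum_(j < m) s j = 0.
  rewrite (bigD1 l)//= {1}/s eqxx -big_split/= big1// => j /negPf jl.
  by rewrite /s jl subrr.
have bs j : bm (fun a => h j a + s j) by apply: bmD; [exact: bh|exact: bm_cst].
rewrite -(dual_shift eps cst nu bh s0) -(lerD2r (- eps)).
rewrite -(dual_objectiveE (fun j => bm_measurable (bs j)) bs) => [|j]; last exact: aeW.
rewrite -(dual_objectiveE (fun j => (fP j).1) (fun j => (gP j).1) (fun j => (gP j).2)).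
apply: fmax; split=> j; first exact: bm_Lfun.
move=> jm; rewrite -/(mean (nu j) _) meanD ?mean_cst//; last exact: bm_cst.
rewrite /s ifN ?subrr//; apply: contraTneq jm => ->.
by rewrite /l /= em ltnn.
Qed.

Lemma optimal_schrodinger (g : 'I_m -> T -> R) : (forall j, bm (g j)) ->
  (forall h : 'I_m -> T -> R, (forall j, bm (h j)) -> dual eps cst nu h <= dual eps cst nu g) ->
  (forall j, defect eps cst nu g j = 0) /\ schrodinger eps cst nu g.
Proof.
move=> bg gmax.
have d0 j : defect eps cst nu g j = 0.
  by apply: defect_eq0 => //; apply: gmax => i; exact: bm_update.
by split=> //; exact: schrodinger_defect.
Qed.

Lemma variance_ae (f g : 'I_m -> T -> R) j : measurable_fun setT (f j) -> bm (g j) ->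
  {ae nu j, forall a, f j a = g j a} ->
  variance (nu j) (f j) = (var (nu j) (g j))%:E.
Proof.
move=> mf bg fg.
have bv : bm (fun a => (g j a - mean (nu j) (g j)) ^+ 2).
  by apply: bmX; apply: bmB => //; exact: bm_cst.
have e : fine ('E_(nu j)[f j])%E = mean (nu j) (g j).
  by rewrite unlock; apply: mean_ae => //; exact: bm_measurable.
rewrite /variance covariance.unlock e expectation.unlock /var EFin_mean//.
apply: ae_eq_integral => //.
- apply/measurable_EFinP; apply: measurable_funM; apply: measurable_funB => //; exact: measurable_cst.
- by apply/measurable_EFinP; exact: bm_measurable.
by apply: filterS fg => x /= fgx _; rewrite -fgx expr2.
Qed.

End OptimalPotentials.

(** * Conditioning on the data *)

Section Conditioning.
Context {dO dS : measure_display} {Omega : measurableType dO} {S : measurableType dS}.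
Context {R : realType}.
Variables (P : probability Omega R) (Y : Omega -> S) (Q : Omega -> probability Omega R).
Hypotheses (mY : measurable_fun setT Y) (PYQ : conditional_probability P Y Q).

Lemma measurable_conditional A : measurable A -> measurable_fun setT (fun w => Q w A).
Proof.
move=> mA _ B mB; have [/(_ measurableT B mB) h _] := PYQ mA.
apply: (smallest_sub _ _ h); first exact: sigma_algebra_measurable.
by move=> _ [E mE <-]; exact: mY.
Qed.

(** The mass that [Q w] gives to [Y @^-1` E] integrates to 0 over the event that
    [Y] falls outside [E]. *)
Lemma conditional_outside E : measurable E ->
  {ae P, forall w, ~ E (Y w) -> Q w (Y @^-1` E) = 0%E}.
Proof.
move=> mE.
have mYE F : measurable F -> measurable (Y @^-1` F).
  by move=> mF; rewrite -[X in measurable X]setTI; exact: mY.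
have [_ /(_ (~` E) (measurableC mE))] := PYQ (mYE _ mE).
rewrite -preimage_setI setICr preimage_set0 measure0 => i0.
have mf : measurable_fun (Y @^-1` (~` E)) (fun w => Q w (Y @^-1` E)).
  by apply: measurable_funTS; apply: measurable_conditional; exact: mYE.
apply: (iffLR (ae_eq_integral_abs P (mYE _ (measurableC mE)) mf)).
by rewrite -[RHS]i0; apply: eq_integral => w _; rewrite gee0_abs.
Qed.

(** A measurable function of the data is constant for the conditional
    probability, since it cannot cross any rational level. *)
Lemma conditional_frozen (v : S -> R) : measurable_fun setT v ->
  {ae P, forall w, {ae Q w, forall w', v (Y w') = v (Y w)}}.
Proof.
move=> mv.
pose E (q : rat) := [set y | ratr q < v y].
have mE q : measurable (E q) by exact: measurable_gtr.
have h (n : nat) : {ae P, forall w, forall q : rat, unpickle n = Some q ->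
    (~ E q (Y w) -> Q w (Y @^-1` E q) = 0%E) /\
    (~ (~` E q) (Y w) -> Q w (Y @^-1` (~` E q)) = 0%E)}.
  case: (unpickle n) => [q|]; last by apply: aeW => w q.
  have h1 := conditional_outside (mE q).
  have h2 := conditional_outside (measurableC (mE q)).
  by apply: filterS2 h1 h2 => w w1 w2 q' [<-].
apply: filterS (ae_foralln h) => w {}h.
have hq q := h (pickle q) q (pickleK q).
pose F (q : rat) : set Omega := if `[< E q (Y w) >] then Y @^-1` (~` E q) else Y @^-1` E q.
have mF q : measurable (F q).
  rewrite /F; case: ifP => _; rewrite -[X in measurable X]setTI; apply: mY => //.
  exact: measurableC.
have F0 q : Q w (F q) = 0%E.
  have [h1 h2] := hq q; rewrite /F; case: asboolP => e; last exact: h1.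
  by apply: h2; apply.
have : (Q w).-negligible (\bigcup_q F q).
  rewrite (_ : \bigcup_q F q = \bigcup_n (if unpickle n is Some q then F q else set0)).
    apply: negligible_bigcup => n; case: unpickle => [q|]; last exact: negligible_set0.
    by exists (F q); split; [exact: mF|exact: F0|].
  apply/seteqP; split => [x [q _ Fx]|x [n _]]; first by exists (pickle q); rewrite ?pickleK.
  by case: unpickle => // q Fx; exists q.
apply: negligibleS => w' /= /eqP; rewrite neq_lt => /orP[] lt_v.
  have [q] := rat_in_itvoo lt_v; rewrite in_itv /= => /andP[q1 q2].
  exists q => //; rewrite /F; case: asboolP => [_|/(_ q2)//].
  by rewrite /E /= => q3; have := lt_trans q1 q3; rewrite ltxx.
have [q] := rat_in_itvoo lt_v; rewrite in_itv /= => /andP[q1 q2].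
exists q => //; rewrite /F; case: asboolP => // q3.
by have := lt_trans q1 q3; rewrite ltxx.
Qed.

End Conditioning.

Section DistributionFunctions.
Context {dO : measure_display} {Omega : measurableType dO} {R : realType}.

Lemma cdf_right_cvg (P : probability Omega R) (Z : Omega -> R) t :
  measurable_fun setT Z ->
  fine (P [set w | Z w <= x]) @[x --> t^'+] --> fine (P [set w | Z w <= t]).
Proof.
move=> mZ; pose Zm : {RV P >-> R} := HB.pack Z (isMeasurableFun.Build _ _ _ _ Z mZ).
have e x : cdf Zm x = P [set w | Z w <= x] by rewrite /cdf /distribution /pushforward; congr (P _).
have h : cdf Zm x @[x --> t^'+] --> (fine (P [set w | Z w <= t]))%:E.
  rewrite fineK ?fin_num_measure//; last exact: measurable_ler.
  by rewrite -e; exact: cdf_right_continuous.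
rewrite (_ : (fun x => _) = fine \o cdf Zm); first exact: (fine_cvg h).
by apply/funext => x; rewrite /= e.
Qed.

Lemma eq_probability_ae (P : probability Omega R) (A B : set Omega) :
  measurable A -> measurable B -> {ae P, forall w, A w <-> B w} -> fine (P A) = fine (P B).
Proof.
move=> mA mB AB; rewrite -!mean_indic//; apply: mean_ae.
- exact: measurable_indic.
- exact: measurable_indic.
apply: filterS AB => w [h1 h2]; rewrite !indicE; congr ((_ : bool)%:R).
by apply/idP/idP; rewrite !inE.
Qed.

(** Right-continuity reduces the Kolmogorov distance between two distribution
    functions to a supremum over rational arguments, hence its measurability
    in a parameter. *)
Lemma measurable_kolmogorov (Q : Omega -> probability Omega R) (P : probability Omega R)
    (Z W : Omega -> R) delta : (forall A, measurable A -> measurable_fun setT (fun w => Q w A)) ->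
  measurable_fun setT Z -> measurable_fun setT W -> 0 < delta ->
  measurable [set w | delta < `|sup [set `|fine (Q w [set w' | Z w' <= t]) -
    fine (P [set w' | W w' <= t])| | t in [set: R]] - 0|].
Proof.
move=> mQ mZ mW d0.
pose g w t := `|fine (Q w [set w' | Z w' <= t]) - fine (P [set w' | W w' <= t])|.
have mg t : measurable_fun setT (fun w => g w t).
  apply: measurableT_comp => //; apply: measurable_funB => //.
  by apply: measurableT_comp => //; apply: mQ; exact: measurable_ler.
have g1 w t : g w t <= 1.
  have b (P' : probability Omega R) A : measurable A -> 0 <= fine (P' A) <= 1.
    by move=> mA; rewrite fine_ge0//= -lee_fin fineK ?fin_num_measure// probability_le1.
  have /andP[a0 a1] := b (Q w) _ (measurable_ler t mZ).
  have /andP[b0 b1] := b P _ (measurable_ler t mW).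
  by rewrite /g ler_norml; apply/andP; split; lra.
have hs w : has_sup [set g w t | t in [set: R]].
  by split; [exists (g w 0), 0|exists 1 => _ [t _ <-]].
have sg w t : g w t <= sup [set g w t | t in [set: R]].
  exact: (sup_upper_bound (hs w) (imageT (g w) t)).
have s0 w : 0 <= sup [set g w t | t in [set: R]].
  exact: le_trans (normr_ge0 _) (sg w 0).
rewrite (_ : [set w | _] = \bigcup_q [set w | delta < g w (ratr q)]).
  by apply: bigcupT_measurable_rat => q; exact: measurable_gtr.
apply/seteqP; split => w /=; rewrite subr0 ger0_norm; [|exact: s0| |exact: s0].
  move=> /(sup_gt (hs w).1)[_ [t _ <-]] gt.
  have cg : g w x @[x --> t^'+] --> g w t.
    by apply: cvg_norm; apply: cvgB; exact: cdf_right_cvg.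
  have [e /= e0 eP] : \forall x \near t^'+, delta < g w x by exact: (cvgr_gt _ cg).
  have [q] : exists q : rat, ratr q \in `]t, (t + e)[%R by apply: rat_in_itvoo; rewrite ltrDl.
  rewrite in_itv /= => /andP[tq qt]; exists q => //=; apply: eP => //=.
  by rewrite distrC gtr0_norm ?subr_gt0// ltrBlDl.
by move=> [q _ gq]; exact: lt_le_trans gq (sg w _).
Qed.

End DistributionFunctions.

(** * Consistency of the bootstrap *)

Section Variance.
Context {disp : measure_display} {T : measurableType disp} {R : realType}.

Lemma var_shift (mu : probability T R) (f : T -> R) k : bm f ->
  var mu f = mean mu (fun a => (f a - k) ^+ 2) - (mean mu f - k) ^+ 2.
Proof.
move=> bf; have b2 := bmX 2 bf.
have mean_sqr l : mean mu (fun a => (f a - l) ^+ 2) =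
    mean mu (fun a => f a ^+ 2) - 2 * l * mean mu f + l ^+ 2.
  have bl : bm (fun a => 2 * l * f a) by apply: bmM => //; exact: bm_cst.
  rewrite -meanZ// -meanB// -[X in _ = _ + X](mean_cst mu) -meanD; [|exact: bmB|exact: bm_cst].
  by apply: eq_mean => a; ring.
by rewrite /var !mean_sqr; ring.
Qed.

Lemma centered_norm (mu : probability T R) (f : T -> R) F a :
  bm f -> (forall a, `|f a| <= F) -> `|f a - mean mu f| <= 2 * F.
Proof.
move=> bf fF; rewrite (le_trans (ler_normB _ _))// mulr_natl mulr2n lerD//.
exact: mean_norm_le.
Qed.

Lemma var_ge0 (mu : probability T R) (f : T -> R) : 0 <= var mu f.
Proof. by apply: mean_ge0 => a; exact: sqr_ge0. Qed.

Lemma var_le (mu : probability T R) (f : T -> R) F :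
  bm f -> (forall a, `|f a| <= F) -> var mu f <= (2 * F) ^+ 2.
Proof.
move=> bf fF; apply: mean_le.
  by apply: bmX; apply: bmB => //; exact: bm_cst.
move=> a; rewrite -(real_normK (num_real _)) lerXn2r ?nnegrE//.
  by rewrite mulr_ge0// (le_trans _ (fF point)).
exact: centered_norm.
Qed.

Section Sample.
Context {dO : measure_display} {Omega : measurableType dO} {m n : nat}.
Variables (P : probability Omega R) (mu : 'I_m -> probability T R).
Variable Y : 'I_m -> 'I_n.+1 -> {mfun Omega >-> T}.
Hypotheses (n0 : (0 < n)%N).
Hypothesis Yind : independent_sample P (fun q : 'I_m * 'I_n.+1 => mu q.1)
  (fun q => Y q.1 q.2).

Local Notation N := (n.+1%:R : R).
Local Notation emp w := (fun j : 'I_m => empirical (fun i => Y j i w) : probability T R).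

Let N0 : 0 < N. Proof. by rewrite ltr0n. Qed.

Let sN0 : 0 < Num.sqrt N. Proof. by rewrite sqrtr_gt0. Qed.

Lemma bm_mean_empirical j g : bm g -> bm (fun w => mean (emp w j) g).
Proof.
move=> bg; rewrite (_ : (fun w => _) = fun w => N^-1 * \sum_(i < n.+1) g (Y j i w)).
  by apply: bmM; [exact: bm_cst|apply: bm_sum => i _; exact: bm_comp].
by apply/funext => w; rewrite mean_empirical.
Qed.

Lemma mean_sqr_empirical j g B : bm g -> (forall a, `|g a| <= B) -> mean (mu j) g = 0 ->
  mean P (fun w => mean (emp w j) g ^+ 2) <= (m%:R + m%:R ^+ 2) * B ^+ 2 / N.
Proof.
move=> bg gB g0; have bz := bm_tnth j bg.
have := second_moment Yind bz (fun x => gB (tnth x j)) n0.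
under eq_mean do rewrite mean_tnth//.
rewrite mean_tnth// g0 expr0n/= add0r => /le_trans; apply.
have B0 : 0 <= B by exact: le_trans (gB point).
have h1 : \sum_(i < m) mean (mu i) (fun a => marginal mu (fun x => g (tnth x j)) i a ^+ 2) <=
    m%:R * B ^+ 2.
  rewrite mulr_natl -[X in _ *+ X]card_ord -sumr_const; apply: ler_sum => i _.
  apply: mean_le; first by apply: bmX; exact: bm_marginal.
  move=> a; rewrite -(real_normK (num_real _)) lerXn2r ?nnegrE//.
  by apply: mean_norm_le => //; exact: (bm_tset i a bz).
have h2 : (m%:R * B / N) ^+ 2 <= m%:R ^+ 2 * B ^+ 2 / N.
  rewrite !exprMn ler_wpM2l ?mulr_ge0 ?sqr_ge0// expr2 ger_pMl ?invr_gt0//.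
  by rewrite invf_le1// ler1n.
rewrite !mulrDl lerD//.
by rewrite mulrC ler_pM2r ?invr_gt0.
Qed.

Lemma bm_var_empirical j f : bm f -> bm (fun w => `|var (emp w j) f - var (mu j) f|).
Proof.
move=> bf; apply: bm_norm; apply: bmB; last exact: bm_cst.
rewrite (_ : (fun w => _) = fun w => mean (emp w j) (fun a => (f a - 0) ^+ 2) -
    (mean (emp w j) f - 0) ^+ 2).
  apply: bmB; first by apply: bm_mean_empirical; apply: bmX; apply: bmB => //; exact: bm_cst.
  by apply: bmX; apply: bmB; [exact: bm_mean_empirical|exact: bm_cst].
by apply/funext => w; exact: var_shift.
Qed.

Definition var_cst (F : R) : R :=
  (m%:R + m%:R ^+ 2) * (((2 * F) ^+ 2) ^+ 2 + (2 * F) ^+ 2) + 1.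

Lemma mean_var_empirical j f F : bm f -> (forall a, `|f a| <= F) ->
  mean P (fun w => `|var (emp w j) f - var (mu j) f|) <= var_cst F / Num.sqrt N.
Proof.
move=> bf fF; pose M := mean (mu j) f; pose v := var (mu j) f.
pose g a := f a - M; pose h a := g a ^+ 2 - v.
have bg : bm g by apply: bmB => //; exact: bm_cst.
have bh : bm h by apply: bmB; [exact: bmX|exact: bm_cst].
have g0 : mean (mu j) g = 0 by rewrite meanB ?mean_cst ?subrr//; exact: bm_cst.
have h0 : mean (mu j) h = 0.
  by rewrite meanB ?mean_cst; [rewrite subrr|exact: bmX|exact: bm_cst].
have gF a : `|g a| <= 2 * F by exact: centered_norm.
have hF a : `|h a| <= (2 * F) ^+ 2.
  have v0 : 0 <= v by exact: var_ge0.
  have vF : v <= (2 * F) ^+ 2 by exact: var_le.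
  have g2 : g a ^+ 2 <= (2 * F) ^+ 2.
    rewrite -(real_normK (num_real _)) lerXn2r ?nnegrE//.
    exact: le_trans (gF a).
  by rewrite /h ler_norml; have := sqr_ge0 (g a); move=> ?; apply/andP; split; lra.
have Eg := mean_sqr_empirical bg gF g0; have Eh := mean_sqr_empirical bh hF h0.
have bU := bm_mean_empirical j bh; have bV := bm_mean_empirical j bg.
have dec w : `|var (emp w j) f - v| <= (Num.sqrt N)^-1 + Num.sqrt N * mean (emp w j) h ^+ 2 +
    mean (emp w j) g ^+ 2.
  have -> : var (emp w j) f - v = mean (emp w j) h - mean (emp w j) g ^+ 2.
    rewrite (var_shift _ M bf) /h meanB ?mean_cst; [|exact: bmX|exact: bm_cst].
    by rewrite /g meanB ?mean_cst//; [ring|exact: bm_cst].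
  move: (mean (emp w j) h) (mean (emp w j) g) => a b.
  rewrite (le_trans (ler_normB _ _))// [`|b ^+ 2|]ger0_norm ?sqr_ge0// lerD2r.
  by rewrite addrC; exact: norm_le_sqr.
apply: (@le_trans _ _ (mean P (fun w => (Num.sqrt N)^-1 + Num.sqrt N * mean (emp w j) h ^+ 2 +
    mean (emp w j) g ^+ 2))).
  apply: le_mean => //; first exact: bm_var_empirical.
  apply: bmD; last exact: bmX.
  by apply: bmD; [exact: bm_cst|apply: bmM; [exact: bm_cst|exact: bmX]].
rewrite meanD; [|by apply: bmD; [exact: bm_cst|apply: bmM; [exact: bm_cst|exact: bmX]]|exact: bmX].
rewrite meanD; [|exact: bm_cst|by apply: bmM; [exact: bm_cst|exact: bmX]].
rewrite mean_cst meanZ; last exact: bmX.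
rewrite /var_cst; set C := m%:R + m%:R ^+ 2 in Eg Eh *.
have C0 : 0 <= C by rewrite addr_ge0// sqr_ge0.
have -> : (C * (((2 * F) ^+ 2) ^+ 2 + (2 * F) ^+ 2) + 1) / Num.sqrt N =
    (Num.sqrt N)^-1 + C * ((2 * F) ^+ 2) ^+ 2 / Num.sqrt N + C * (2 * F) ^+ 2 / Num.sqrt N by ring.
have NN : N = Num.sqrt N ^+ 2 by rewrite sqr_sqrtr// ltW.
apply: lerD; first rewrite lerD2l.
  rewrite (le_trans (ler_wpM2l (ltW sN0) Eh))// {2}NN; apply: le_of_eq.
  by field; rewrite gt_eqF.
rewrite (le_trans Eg)// ler_wpM2l ?(mulr_ge0 C0 (sqr_ge0 _))//.
rewrite lef_pV2 ?posrE// {2}NN expr2 ler_peMl ?(ltW sN0)//.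
by rewrite -[leLHS]sqrtr1 ler_sqrt// ler1n.
Qed.

End Sample.
End Variance.

Section Bootstrap.
Context {R : realType} {m d : nat}.
Local Notation T := (borelV R d).
Variables (eps : R) (X : 'I_m -> set 'rV[R]_d) (c : 'M[R]_(m, d) -> R).
Variables (nu : 'I_m -> probability T R) (f : 'I_m -> T -> R) (K F p B : R).
Local Notation cst := (@cost R m d X c).
Hypotheses (m0 : (0 < m)%N) (eps0 : 0 < eps) (bc : bm cst) (cK : forall x, `|cst x| <= K).
Hypotheses (bf : forall j, bm (f j)) (fF : forall j a, `|f j a| <= F).
Hypotheses (p0 : 0 < p) (pf : forall x, p <= gibbs eps cst f x).
Hypothesis zB : forall x, `|excess eps cst f x| <= B.
Hypothesis fS : schrodinger eps cst nu f.
Hypothesis defect0 : forall j, defect eps cst nu f j = 0.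
Variable j0 : 'I_m.
Hypothesis var_gt0 : 0 < var (nu j0) (f j0).

Local Notation S := (Seps eps X c).
Local Notation rem := (remainder_cst (m:=m) eps K F p B).

Let sig (j : 'I_m) : R := Num.sqrt (var (nu j) (f j)).

Let sigF j : `|sig j| <= 2 * F.
Proof.
have F0 : 0 <= F by exact: le_trans (fF j0 point).
rewrite ger0_norm ?sqrtr_ge0// -(ger0_norm (mulr_ge0 (ler0n _ 2) F0)) -sqrtr_sqr.
by rewrite ler_wsqrtr// var_le.
Qed.

Let sig0 : 0 < sig j0. Proof. by rewrite sqrtr_gt0. Qed.

Let sigE j : sig j ^+ 2 = var (nu j) (f j).
Proof. by rewrite sqr_sqrtr// var_ge0. Qed.

Let F0 : 0 <= F. Proof. exact: le_trans (fF j0 point). Qed.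

Let err_cst0 : 0 <= err_cst (m:=m) B.
Proof. by rewrite /err_cst addr_ge0// mulr_ge0 ?sqr_ge0// mulr_ge0 ?sqr_ge0. Qed.

Let rem0 : 0 <= rem. Proof. exact: remainder_cst_ge0. Qed.

Let Snu : S nu = \sum_(j < m) mean (nu j) (f j).
Proof. by rewrite /Seps (S_eps_schrodinger m0 eps0 bc bf fS). Qed.

(** All defects vanish, and the Schrodinger system makes the mean excess vanish. *)
Lemma err_population n : err eps X c f n nu = (Num.sqrt n.+1%:R)^-1.
Proof.
have -> : err eps X c f n nu = Num.sqrt n.+1%:R * n.+1%:R^-1.
  rewrite /err big1; last by move=> j _; exact: defect0.
  have -> : mean (tensor nu) (excess eps cst f) = 0.
    apply: (addrI 1); rewrite -(mean_gibbs eps bc nu bf) addr0.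
    exact: (schrodinger_mean j0 bf fS).
  by rewrite expr0n/= mulr0 !add0r.
have N0 : 0 < Num.sqrt n.+1%:R :> R by rewrite sqrtr_gt0.
rewrite -[X in _ * X^-1](@sqr_sqrtr _ n.+1%:R)//.
by field; rewrite gt_eqF.
Qed.

(** The coefficients of [1 / sqrt N] in the concentration of the signed sum and in
    the Lindeberg error. *)
Definition smoothing_cst (del : R) : R := 1 + m%:R * (72 * (2 * F) ^+ 3) / del ^+ 3.

Section SampleSize.
Context {dO : measure_display} {Omega : measurableType dO}.
Variables (n : nat) (P : probability Omega R) (Q : Omega -> probability Omega R).
Variables (Y YB : 'I_m -> 'I_n.+1 -> {mfun Omega >-> T}).
Hypotheses (n0 : (0 < n)%N).
Hypothesis Yind : independent_sample P (fun q : 'I_m * 'I_n.+1 => nu q.1)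
  (fun q => Y q.1 q.2).
Hypothesis PYQ : conditional_probability P
  (fun w => [tuple [tuple Y j i w | i < n.+1] | j < m]) Q.
Hypothesis YBind : {ae P, forall w, independent_sample (Q w)
  (fun q : 'I_m * 'I_n.+1 => empirical (fun i : 'I_n.+1 => Y q.1 i w))
  (fun q => YB q.1 q.2)}.

Local Notation N := (n.+1%:R : R).
Local Notation nuN w := (fun j : 'I_m => empirical (fun i => Y j i w) : probability T R).
Local Notation nuB w := (fun j : 'I_m => empirical (fun i => YB j i w) : probability T R).

Let sN0 : 0 < Num.sqrt N. Proof. by rewrite sqrtr_gt0. Qed.

Let cdfB w t := fine (Q w [set w' | Num.sqrt N * (S (nuB w') - S (nuN w')) <= t]).
Let cdf t := fine (P [set w | Num.sqrt N * (S (nuN w) - S nu) <= t]).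

Lemma cdf_sample (del t : R) : 0 < del ->
  `|cdf t - rads (signs n sig) (below t) 0| <=
  del / sig j0 + smoothing_cst del / Num.sqrt N +
  rem * err_cst (m:=m) B / del / Num.sqrt N.
Proof.
move=> d0.
apply: (le_trans (cdf_empirical_cost m0 eps0 bc cK bf fF p0 pf zB n0 Yind (S nu) t sigF sig0 d0)).
rewrite Snu subrr normr0 mulr0 addr0 err_population big1; last first.
  by move=> j _; rewrite sigE subrr normr0.
rewrite mulr0 addr0.
apply: le_of_eq; rewrite /smoothing_cst.
by move: (Num.sqrt N) sN0 (sig j0) sig0 => s s0 r r0; field; rewrite !gt_eqF.
Qed.

(** The random part of the distance between the bootstrap distribution and the
    signed sum. *)
Definition fluctuation (del : R) w : R :=
  9 / del ^+ 2 * \sum_(j < m) `|var (nuN w j) (f j) - var (nu j) (f j)| +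
  (rem * err_cst (m:=m) B + rem) / del * err eps X c f n (nuN w).

Let data w : m.-tuple (n.+1.-tuple T) := [tuple [tuple Y j i w | i < n.+1] | j < m].

Let mdata : measurable_fun setT data.
Proof. by apply: measurable_mktuple => j; apply: measurable_mktuple. Qed.

Let mQ A : measurable A -> measurable_fun setT (fun w => Q w A).
Proof. exact: (measurable_conditional mdata PYQ). Qed.

Let mSB : measurable_fun setT (fun w => Num.sqrt N * (S (nuB w) - S (nuN w))).
Proof.
apply: measurable_funM; first exact: measurable_cst.
by apply: measurable_funB; exact: (measurable_Seps m0 eps0 bc cK).
Qed.

Let mSN s : measurable_fun setT (fun w => Num.sqrt N * (S (nuN w) - s)).
Proof.
apply: measurable_funM; first exact: measurable_cst.
by apply: measurable_funB; [exact: (measurable_Seps m0 eps0 bc cK)|exact: measurable_cst].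
Qed.

Let mSB' s : measurable_fun setT (fun w => Num.sqrt N * (S (nuB w) - s)).
Proof.
apply: measurable_funM; first exact: measurable_cst.
by apply: measurable_funB; [exact: (measurable_Seps m0 eps0 bc cK)|exact: measurable_cst].
Qed.

Let frozen : {ae P, forall w, {ae Q w, forall w', S (nuN w') = S (nuN w)}}.
Proof.
pose v (y : m.-tuple (n.+1.-tuple T)) :=
  S (fun j => empirical (fun i => tnth (tnth y j) i) : probability T R).
have mtn j i : measurable_fun setT (fun y : m.-tuple (n.+1.-tuple T) => tnth (tnth y j) i).
  by apply: (measurableT_comp (measurable_tnth i)); exact: measurable_tnth.
pose Yt j i : {mfun m.-tuple (n.+1.-tuple T) >-> T} :=
  HB.pack (fun y : m.-tuple (n.+1.-tuple T) => tnth (tnth y j) i)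
    (isMeasurableFun.Build _ _ _ _ _ (mtn j i)).
have mv : measurable_fun setT v by exact: (measurable_Seps m0 eps0 bc cK Yt).
have vE w : v (data w) = S (nuN w).
  congr S; apply/funext => j; congr (empirical _ : probability T R).
  by apply/funext => i; rewrite !tnth_mktuple.
have := conditional_frozen mdata PYQ mv.
by apply: filterS => w; apply: filterS => w'; rewrite !vE.
Qed.

(** For almost all data, the bootstrap sample is drawn from the empirical measures
    and the empirical cost is a constant. *)
Lemma cdf_bootstrap (del : R) : 0 < del ->
  {ae P, forall w, forall t, `|cdfB w t - rads (signs n sig) (below t) 0| <=
    del / sig j0 + smoothing_cst del / Num.sqrt N + fluctuation del w}.
Proof.
move=> d0; apply: filterS2 YBind frozen => w Bind Fw t.
have -> : cdfB w t = fine (Q w [set w' | Num.sqrt N * (S (nuB w') - S (nuN w)) <= t]).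
  apply: (eq_probability_ae (measurable_ler t mSB) (measurable_ler t (mSB' (S (nuN w))))).
  by apply: filterS Fw => w' /= ->.
have := cdf_empirical_cost (mu := nuN w) m0 eps0 bc cK bf fF p0 pf zB n0 Bind (S (nuN w)) t sigF sig0 d0.
under eq_bigr do rewrite sigE.
move=> /le_trans; apply.
have := Seps_empirical m0 eps0 bc cK bf fF p0 pf zB (fun j i => Y j i w).
rewrite /fluctuation.
move: (err _ _ _ _ _ _) (\sum_(j < m) `|var _ _ - _|) => e V.
move: (Num.sqrt N * `|_|) => u ue.
rewrite -!addrA !lerD2l.
have -> : smoothing_cst del / Num.sqrt N + (9 / del ^+ 2 * V + (rem * err_cst (m:=m) B + rem) / del * e) =
   (Num.sqrt N)^-1 + (m%:R * (72 * (2 * F) ^+ 3) / (del ^+ 3 * Num.sqrt N) +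
   (9 / del ^+ 2 * V + (rem * (err_cst (m:=m) B * e) + rem * e) / del)).
  rewrite /smoothing_cst; move: (Num.sqrt N) sN0 => s s0.
  by field; rewrite !gt_eqF.
by rewrite !lerD2l ler_pM2r ?invr_gt0// lerD2l.
Qed.

Let bm_fluctuation (del : R) : bm (fluctuation del).
Proof.
apply: bmD; apply: bmM; [exact: bm_cst| |exact: bm_cst|exact: (bm_err eps bc bf)].
by apply: bm_sum => j _; apply: bm_var_empirical.
Qed.

Definition fluctuation_cst (del : R) : R :=
  9 / del ^+ 2 * (m%:R * var_cst (m:=m) F) +
  (rem * err_cst (m:=m) B + rem) / del * err_cst (m:=m) B.

Lemma mean_fluctuation (del : R) : 0 < del ->
  mean P (fluctuation del) <= fluctuation_cst del / Num.sqrt N.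
Proof.
move=> d0; have be := bm_err eps bc bf Y.
have bv j := bm_var_empirical nu Y j (bf j).
have bV : bm (fun w => \sum_(j < m) `|var (nuN w j) (f j) - var (nu j) (f j)|).
  by apply: bm_sum => j _; exact: bv.
rewrite meanD; [|by apply: bmM => //; exact: bm_cst|by apply: bmM => //; exact: bm_cst].
rewrite [mean _ _]meanZ// [X in _ + X]meanZ// /fluctuation_cst [leRHS]mulrDl; apply: lerD.
  rewrite -[leRHS]mulrA ler_wpM2l//; first by rewrite divr_ge0// exprn_ge0// ltW.
  rewrite mean_sum// -[leRHS]mulrA mulr_natl -[X in _ *+ X]card_ord -sumr_const.
  by apply: ler_sum => j _; exact: mean_var_empirical.
rewrite -[leRHS]mulrA ler_wpM2l//.
  by rewrite divr_ge0 ?(ltW d0)// addr_ge0// mulr_ge0.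
by rewrite -err_population; exact: (mean_err bc bf zB n0 Yind).
Qed.

Definition bootstrap_cst (delta : R) : R := let del := delta * sig j0 / 4 in
  (2 * smoothing_cst del + rem * err_cst (m:=m) B / del + fluctuation_cst del) / (delta / 2).

(** The level of the smoothing is chosen so that its contribution to the
    distance is at most [delta / 2]. *)
Lemma bootstrap_deviation (delta : R) : 0 < delta ->
  (P [set w | (delta < `|sup [set `|cdfB w t - cdf t| | t in [set: R]] - 0|)%R] <=
   (bootstrap_cst delta / Num.sqrt N)%:E)%E.
Proof.
move=> delta0; pose del := delta * sig j0 / 4.
have d0 : 0 < del by rewrite divr_gt0// mulr_gt0.
have mA := measurable_kolmogorov P mQ mSB (mSN (S nu)) delta0.
pose H w := fluctuation del w +
  (2 * smoothing_cst del + rem * err_cst (m:=m) B / del) / Num.sqrt N.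
have bH : bm H by apply: bmD; [exact: bm_fluctuation|exact: bm_cst].
have H0 w : 0 <= H w.
  have D0 : 0 <= smoothing_cst del.
    by rewrite addr_ge0// !mulr_ge0 ?exprn_ge0 ?mulr_ge0 ?invr_ge0 ?exprn_ge0 ?(ltW d0).
  have V0 : 0 <= \sum_(j < m) `|var (nuN w j) (f j) - var (nu j) (f j)| by exact: sumr_ge0.
  rewrite /H addr_ge0//; last first.
    by rewrite divr_ge0 ?(ltW sN0)// addr_ge0 ?mulr_ge0// invr_ge0 ltW.
  rewrite /fluctuation addr_ge0// mulr_ge0 ?err_ge0//.
    by rewrite divr_ge0// exprn_ge0// ltW.
  by rewrite divr_ge0 ?(ltW d0)// addr_ge0// mulr_ge0.
have mB : measurable [set w | delta / 2 < H w] by apply: measurable_gtr; exact: bm_measurable.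
have [M [mM M0 HM]] := cdf_bootstrap d0.
have PB : fine (P [set w | delta / 2 < H w]) <= bootstrap_cst delta / Num.sqrt N.
  have delta2 : 0 < delta / 2 by rewrite divr_gt0.
  apply: (le_trans (markov_mean P bH H0 delta2)).
  rewrite /bootstrap_cst -/del [leRHS]mulrAC ler_pM2r ?invr_gt0//.
  rewrite /H meanD ?mean_cst; [|exact: bm_fluctuation|exact: bm_cst].
  by rewrite addrC [leRHS]mulrDl lerD2l mean_fluctuation.
apply: (@le_trans _ _ (P ([set w | delta / 2 < H w] `|` M))); last first.
  by rewrite measureU0// -[leLHS]fineK ?fin_num_measure// lee_fin.
apply: le_measure; rewrite ?inE//; first exact: measurableU.
move=> w /= hw; apply: contrapT => /not_orP[hH hM].
have {}hM t : `|cdfB w t - rads (signs n sig) (below t) 0| <=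
    del / sig j0 + smoothing_cst del / Num.sqrt N + fluctuation del w.
  by move: t; apply: contrapT => /HM.
pose D := [set `|cdfB w t - cdf t| | t in [set: R]].
have ubD : ubound D (delta / 2 + H w).
  move=> _ [t _ <-]; rewrite (le_trans (ler_distD (rads (signs n sig) (below t) 0) _ _))//.
  rewrite [X in _ + X]distrC (le_trans (lerD (hM t) (cdf_sample t d0)))//.
  have -> : delta / 2 = del / sig j0 + del / sig j0.
    by rewrite /del; move: (sig j0) sig0 => r r0; field; rewrite gt_eqF.
  rewrite /H; move: (fluctuation del w) (smoothing_cst del) (_ / del) => u v x.
  by apply: le_of_eq; ring.
have D0 : D !=set0 by exists `|cdfB w 0 - cdf 0|, 0.
move: hw; rewrite -/D subr0 ger0_norm; last first.
  apply: (@le_trans _ _ `|cdfB w 0 - cdf 0|) => //.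
  by apply: sup_upper_bound; [split=> //; exists (delta / 2 + H w)|exists 0].
move=> /lt_le_trans/(_ (ge_sup D0 ubD)).
have e : delta = delta / 2 + delta / 2 by field.
by rewrite {1}e ltrD2l => /hH.
Qed.

End SampleSize.

End Bootstrap.

Theorem theorem4p8 (R : realType) (m d k : nat) (eps : R)
    (X : 'I_m -> set 'rV[R]_d)
    (nu : 'I_m -> probability (borelV R d) R)
    (c : 'M[R]_(m, d) -> R)
    (f : 'I_m -> borelV R d -> R)
    (dO : measure_display) (Omega : measurableType dO)
    (P : probability Omega R)
    (Xs : 'I_m -> nat -> {RV P >-> borelV R d})
    (XB : forall n : nat, 'I_m -> 'I_n.+1 -> {RV P >-> borelV R d})
    (PB : nat -> Omega -> probability Omega R) :
  (2 <= m)%N -> (1 <= d)%N -> 0 < eps ->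
  (forall j x, X j x -> forall i, -1 <= x ord0 i <= 1) ->
  (forall j, compact (X j)) ->
  (forall j, (X j)° !=set0) ->
  (forall j, X j = closure (X j)°) ->
  (forall j, nu j (X j) = 1%E) ->
  d%:R / 2 + 1 <= k%:R :> R ->
  Ck k (prod_domain X) c ->
  optimal_potentials eps X c nu f ->
  (0 < \sum_(j < m) variance (nu j) (f j))%E ->
  independent_sample P (fun p : 'I_m * nat => nu p.1)
    (fun p => Xs p.1 p.2) ->
  (* sample size n.+1 *)
  (forall n, conditional_probability P
     (fun w => [tuple [tuple Xs j i w | i < n.+1] | j < m]) (PB n)) ->
  (forall n, {ae P, forall w,
     independent_sample (PB n w)
       (fun p : 'I_m * 'I_n.+1 =>
          empirical (fun i : 'I_n.+1 => Xs p.1 i w))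
       (fun p => XB n p.1 p.2)}) ->
  let S (mu : 'I_m -> probability (borelV R d) R) : R :=
    fine (S_eps eps X c mu) in
  let nuN n w j : probability (borelV R d) R :=
    empirical (fun i : 'I_n.+1 => Xs j i w) in
  let nuB n w j : probability (borelV R d) R :=
    empirical (fun i : 'I_n.+1 => XB n j i w) in
  cvg_in_probability P
    (fun n w => sup [set
       `| fine (PB n w [set w' |
            Num.sqrt n.+1%:R * (S (nuB n w') - S (nuN n w')) <= t])
        - fine (P [set w' |
            Num.sqrt n.+1%:R * (S (nuN n w') - S nu) <= t]) |
       | t in [set: R]])
    0.
Proof.
move=> m2 _ eps0 _ cX _ _ nuX _ [cc _ _] fopt var0 Xind Qcond XBind S nuN nuB.
have m0 : (0 < m)%N by exact: leq_trans m2.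
have bc : bm (cost X c) by exact: bm_cost.
have [K _ cK] := bm_bound bc.
have [g [bg fg gmax]] := optimal_bounded m0 cX bc nuX fopt.
have [defect0 gS] := optimal_schrodinger eps0 bc bg gmax.
have mf j : measurable_fun setT (f j) by have [[fL _] _] := fopt; have [] := Lfun_bm (fL j).
have [j0 vj0] : exists j0, 0 < var (nu j0) (g j0).
  apply: contrapT => no; move: var0.
  rewrite (eq_bigr (fun=> 0%E)) ?big1 ?ltxx// => j _.
  rewrite (variance_ae (mf j) (bg j) (fg j)); congr EFin; apply/eqP.
  rewrite eq_le var_ge0 andbT leNgt; apply/negP => vj; by apply: no; exists j.
have [F _ gF] : exists2 F, 0 < F & forall a, `|\sum_(j < m) `|g j a| | <= F.
  by apply: bm_bound; apply: bm_sum => j _; exact: bm_norm.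
have {}gF j a : `|g j a| <= F.
  rewrite (le_trans _ (gF a))// (le_trans _ (ler_norm _))// (bigD1 j)//= lerDl.
  exact: sumr_ge0.
have [p p0 pg] := gibbs_ge eps bc bg.
have [B _ zB] := bm_bound (bm_excess eps bc bg).
move=> delta delta0.
pose C := bootstrap_cst eps nu g K F p B j0 delta.
have sqrt_cvg : (C / Num.sqrt n.+1%:R)%:E @[n --> \oo] --> 0%E.
  apply: cvg_EFin; first exact: nearW.
  rewrite -[X in _ --> X](mulr0 C); apply: cvgM; first exact: cvg_cst.
  rewrite (_ : (fun n : nat => (Num.sqrt n.+1%:R)^-1) = Num.sqrt \o @harmonic R); last first.
    by apply/funext => n /=; rewrite sqrtrV.
  rewrite -sqrtr0; apply: continuous_cvg; first exact: sqrt_continuous.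
  exact: cvg_harmonic.
apply: (@squeeze_cvge _ _ _ _ (cst 0%E) _ (fun n => (C / Num.sqrt n.+1%:R)%:E)) => //; last exact: cvg_cst.
exists 1%N => // n /= n1; rewrite measure_ge0/=.
have inj : injective (fun q : 'I_m * 'I_n.+1 => (q.1, q.2 : nat)).
  by move=> [j i] [j' i'] /= [-> /val_inj ->].
apply: (bootstrap_deviation m0 eps0 bc cK bg gF p0 pg zB gS defect0 vj0 n1
  (independent_sample_reindex inj Xind) (Qcond n) (XBind n) delta0).
Qed.
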